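(* Let $f:(\mathbb{T}^2,\infty)\to(\mathbb{T}^2,\infty)$ be a weakly non-degenerate contracting germ. Then the monomialization procedure applied to $f$ produces a dynamical system if and only if $f$ is of the form $$f(x_1,x_2)=\big((a_1+x_1)\wedge(a_2+p_2x_2),\ (b_1+q_1x_1)\wedge(b_2+x_2)\big),$$ with either: (a) $p_2,q_1\in\{1,\infty\}$ (i.e., $f$ is linear), and either $a_2=b_1=\infty$ ($f$ is diagonal), or $a_1=b_2\in\mathbb{T}$; (b) $p_2=\infty$, $q_1\in\mathbb{N}^*\setminus\{1\}$, and $b_2=q_1a_1$; (c) $q_1=\infty$, $p_2\in\mathbb{N}^*\setminus\{1\}$, and $a_1=p_2b_2$.
   Context: $\mathbb{T}=\mathbb{R}\cup\{\infty\}$ with min-plus operations ($\wedge=\min$, tropical multiplication $+$), topologized by Euclidean open sets and the sets $(a,\infty]$; $\infty$ also denotes $(\infty,\dots,\infty)$; $\mathbb{N}^*=\{1,2,\dots\}$. By convention a term $a+px$ is identically $\infty$ if $p=\infty$. In the linear case the coefficients $a_1,a_2,b_1,b_2$ are allowed to lie in $\mathbb{T}$; otherwise they lie in $\mathbb{R}$. $\mathbb{K}$ is an algebraically closed field with a non-trivial non-archimedean valuation $\nu_0$ with value group $\mathbb{R}$. The tropicalization of $\sum_I\alpha_Ix^I$ is $\bigwedge_I(\nu_0(\alpha_I)+\langle I,x\rangle)$ (componentwise for maps). A tropical germ is (the class, up to equality on a neighborhood of $\infty$, of) a tuple of tropical power series which on a neighborhood of $\infty$ are determined by finitely many monomials.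 A germ $f:(\mathbb{T}^d,\infty)\to(\mathbb{T}^d,\infty)$ is weakly non-degenerate if some invertible germ $(\mathbb{A}^d_{\mathbb{K}},0)\to(\mathbb{A}^d_{\mathbb{K}},0)$ tropicalizes to $f$; it is contracting if every neighborhood $U$ of $\infty$ contains an open neighborhood $V$ of $\infty$ with $\overline{f(V)}\subset V$. The canonical formal inverse $g=(g_1,\dots,g_d)$ of $f$ is the tropicalization of $\mathbf{f}^{-1}$ for a generic $\mathbf{f}$ tropicalizing to $f$. Regular modification of a tropical variety $V\subset\mathbb{T}^n$ along a tropical polynomial $P$: the projection to $V$ of the graph of $P|_V$ completed in $\mathbb{T}^{n+1}$, at each codimension-one face where balancing fails, by a facet in direction $e_{n+1}$ with the unique positive weight restoring balancing; $\mathrm{div}(P)$ is the image of the added facets with their weights. Monomialization procedure: let $\pi:X\to\mathbb{T}^d$, $X\subset\mathbb{T}^{2d}$, be the composition of the regular modifications along $f_1,\dots,f_d$, and $\eta:Y\to\mathbb{T}^d$ that along $g_1,\dots,g_d$; with coordinates $(x,y)$ on $\mathbb{T}^{2d}$, the map $F(x,y)=(y,x)$ is an isomorphism from $X$ to $Y$ near $\infty$ with $f\circ\pi=\eta\circ F$ on the strict transform of $\pi$ (the closure of the locus where $\pi$ is one-to-one). One has the freedom of replacing $f_i$ by $f_i+a_i$, $g_i$ by $g_i+b_i$ and $F$ by $(x,y)\mapsto(y-a,x+b)$, $a,b\in\mathbb{R}^d$ (and of reordering the functions). The procedure produces a dynamical system if, using this freedom, the modifications $\pi$ and $\eta$ can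 be taken to coincide, so that $X=Y$ and $F(X)=X$; in terms of divisors this is the condition $\sum_i\mathrm{div}(f_i)=\sum_i\mathrm{div}(g_i)$ near $\infty$. *)

(* Defs.v *)
From HB Require Import structures.
From mathcomp Require Import all_boot all_order all_fingroup all_algebra.
From mathcomp Require Import all_classical all_reals all_analysis.
Set Implicit Arguments.
Unset Strict Implicit.
Unset Printing Implicit Defensive.
Import Order.TTheory GRing.Theory Num.Theory.
Import numFieldNormedType.Exports.
Local Open Scope classical_set_scope.
Local Open Scope ring_scope.

(* Points of T^n are the rows x of extended reals with no coordinate equal to
   -oo (this is an open subset of the space of all rows, and the topology of
   \bar R induces on T = ]-oo, +oo] the one generated by the Euclidean open
   sets and the ]a, +oo]).  Germs at the point [tinf] are represented by
   functions defined on all rows, and are compared near [tinf] only. *)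

Section TropicalSpace.
Variable R : realType.

Definition Tpt n : set 'rV[\bar R]_n := [set x | forall i, x 0 i != -oo%E].

Definition tinf n : 'rV[\bar R]_n := const_mx +oo%E.

Definition emb n (p : 'rV[R]_n) : 'rV[\bar R]_n := map_mx (@EFin R) p.

End TropicalSpace.
Arguments Tpt {R} n.
Arguments tinf {R n}.

Definition mon (d : nat) := {ffun 'I_d -> nat}.

Section TropicalSeries.
Variables (R : realType) (d : nat).
Implicit Types (c : mon d -> \bar R) (f g : 'rV[\bar R]_d -> 'rV[\bar R]_d).

(* The convention 0 * +oo = 0 of \bar R makes absent variables disappear. *)
Definition tterm c (m : mon d) (x : 'rV[\bar R]_d) : \bar R :=
  (c m + \sum_(i < d) (m i)%:R%:E * x 0%R i)%E.

Definition teval c (x : 'rV[\bar R]_d) : \bar R :=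
  ereal_inf [set tterm c m x | m in setT].

Definition tropical_germ f : Prop :=
  forall i, exists (c : mon d -> \bar R) (S : seq (mon d)),
    (forall m, c m != -oo%E) /\
    \forall x \near tinf,
      f x 0 i = teval c x /\
      teval c x = ereal_inf [set tterm c m x | m in [set` S]].

Definition contracting f : Prop :=
  forall U : set 'rV[\bar R]_d, nbhs tinf U ->
    exists V : set 'rV[\bar R]_d,
      [/\ open V, V tinf, V `<=` U `&` Tpt d
        & closure (f @` V) `&` Tpt d `<=` V].

End TropicalSeries.

Section FormalSeries.
Variables (K : fieldType) (d : nat).

Definition pseries := mon d -> K.
Implicit Types (phi psi : pseries) (G H : 'I_d -> pseries).

Definition mon_deg (m : mon d) : nat := (\sum_(i < d) m i)%N.

Definition mon_of N (k : {ffun 'I_d -> 'I_N}) : mon d :=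
  [ffun i => nat_of_ord (k i)].

Definition ps_one : pseries := fun m => (m == [ffun=> 0%N])%:R.

Definition ps_var (i : 'I_d) : pseries :=
  fun m => (m == [ffun j => nat_of_bool (j == i)])%:R.

Definition ps_mul phi psi : pseries := fun m =>
  \sum_(k : {ffun 'I_d -> 'I_(mon_deg m).+1} | [forall i, k i <= m i]%N)
    phi (mon_of k) * psi [ffun i => (m i - k i)%N].

Definition ps_monomial H (k : mon d) : pseries :=
  \big[ps_mul/ps_one]_(i < d) iter (k i) (ps_mul (H i)) ps_one.

(* phi \o H, meaningful when the H i have no constant term: then the monomials
   of degree > mon_deg m in phi do not contribute to the coefficient of m. *)
Definition ps_comp phi H : pseries := fun m =>
  \sum_(k : {ffun 'I_d -> 'I_(mon_deg m).+1})
    phi (mon_of k) * ps_monomial H (mon_of k) m.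

Definition inverse_germs G H : Prop :=
  [/\ forall i, G i [ffun=> 0%N] = 0,
      forall i, H i [ffun=> 0%N] = 0,
      forall i m, ps_comp (G i) H m = ps_var i m
    & forall i m, ps_comp (H i) G m = ps_var i m].

Definition invertible_germ G : Prop := exists H, inverse_germs G H.

End FormalSeries.

(* Non-archimedean valuation with value group R (hence non-trivial). *)
Record is_valuation (R : realType) (K : fieldType) (nu : K -> \bar R) : Prop :=
  IsValuation {
    val_neqNy : forall x, nu x != -oo%E;
    val_eqy : forall x, nu x = +oo%E <-> x = 0;
    valM : forall x y, nu (x * y) = (nu x + nu y)%E;
    valD : forall x y, (Order.min (nu x) (nu y) <= nu (x + y)%R)%E;
    val_surj : forall r : R, exists x, nu x = r%:E }.

Section Lifts.
Variables (R : realType) (K : fieldType) (nu : K -> \bar R) (d : nat).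
Implicit Types (f g : 'rV[\bar R]_d -> 'rV[\bar R]_d).

Definition trop (G : 'I_d -> pseries K d) (x : 'rV[\bar R]_d) :
  'rV[\bar R]_d := \row_i teval (nu \o G i) x.

Definition tropicalizes_to (G : 'I_d -> pseries K d) f : Prop :=
  \forall x \near tinf, trop G x = f x.

Definition weakly_nondegenerate f : Prop :=
  exists G : 'I_d -> pseries K d, invertible_germ G /\ tropicalizes_to G f.

(* A polynomial condition on n (distinct) coefficients of G: the polynomial
   sum_(m <- S) kappa m * u^m takes at these coefficients the valuation given
   by its tropicalization, i.e. no cancellation occurs.  For coefficients of
   prescribed valuations this says that the residues of their leading terms lie
   off the hypersurface of the initial form, so it holds on a non-empty
   Zariski open set of leading terms. *)
Definition generic_for n (idx : 'I_n -> 'I_d * mon d)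
    (S : seq (mon n)) (kappa : mon n -> K) (G : 'I_d -> pseries K d) : Prop :=
  let u j := G (idx j).1 (idx j).2 in
  nu (\sum_(m <- S) kappa m * \prod_(j < n) u j ^+ m j)
  = ereal_inf [set tterm (nu \o kappa) m (\row_j nu (u j)) | m in [set` S]].

Definition canonical_inverse f g : Prop :=
  exists (n : nat) (idx : 'I_n -> 'I_d * mon d)
         (S : seq (mon n)) (kappa : mon n -> K),
    [/\ injective idx, uniq S &
      forall G H, inverse_germs G H -> tropicalizes_to G f ->
        generic_for idx S kappa G -> tropicalizes_to H g].

End Lifts.

Section Modifications.
Variable R : realType.

(* Pure-dimensional weighted polyhedral sets in T^n.  [weight V x w]: the
   facet of V having x in its relative interior has weight w (the values at
   the other points are irrelevant). *)
Record wset (n : nat) := WSet {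
  support : set 'rV[\bar R]_n;
  weight : 'rV[\bar R]_n -> nat -> Prop }.

Definition real_mx m n (B : 'M[int]_(m, n)) : 'M[R]_(m, n) :=
  map_mx (fun a : int => a%:~R) B.

(* The rows of B form a basis of the lattice of integral vectors in their real
   span (in particular they are linearly independent). *)
Definition lattice_basis m n (B : 'M[int]_(m, n)) : Prop :=
  forall c : 'rV[R]_m,
    (forall j, (c *m real_mx B) 0 j \is a Num.int) ->
    forall i, c 0 i \is a Num.int.

(* Around the real point p, the set V (of dimension k + 1) is the union of the
   distinct half-spaces p + L + R_+ v_i, of weights w_i, where L is spanned by
   the rows of B and v_i is primitive modulo L; P is affine on each of them,
   with slopes lam along L and s_i along v_i.  So p lies in the relative
   interior of a codimension-one face, of direction L, of a polyhedral
   structure of V adapted to P. *)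
Definition codim1_star k n (V : wset n) (P : 'rV[\bar R]_n -> \bar R)
    (p : 'rV[R]_n) (B : 'M[int]_(k, n)) (lam : 'cV[R]_k) (r : nat)
    (v : 'I_r -> 'rV[int]_n) (w : 'I_r -> nat) (s : 'I_r -> R) : Prop :=
  let pt (i : 'I_r) (c : 'rV[R]_k) (t : R) :=
    p + c *m real_mx B + t *: real_mx (v i) in
  [/\ support V (emb p) /\ P (emb p) \is a fin_num,
      (forall i, lattice_basis (col_mx B (v i))) /\
        (forall i j (c : 'rV[R]_k),
           real_mx (v i - v j) = c *m real_mx B -> i = j),
      forall i, (0 < w i)%N,
      \forall y \near p, support V (emb y) <->
        exists (i : 'I_r) (c : 'rV[R]_k) (t : R), 0 <= t /\ y = pt i c t
    & \forall y \near p, forall i c t, 0 <= t -> y = pt i c t ->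
        P (emb y) = (P (emb p) + ((c *m lam) 0 0 + t * s i)%R%:E)%E /\
        (0 < t -> weight V (emb y) (w i))].

(* Adding to the facets (v_i, s_i) of the graph of P a facet of weight omega
   in the direction e_(n+1) makes it balanced along the face above p, of
   direction the row span of (B, lam). *)
Definition restoring_weight k n (V : wset n) (P : 'rV[\bar R]_n -> \bar R)
    (p : 'rV[R]_n) (omega : nat) : Prop :=
  exists (B : 'M[int]_(k, n)) (lam : 'cV[R]_k) (r : nat)
         (v : 'I_r -> 'rV[int]_n) (w : 'I_r -> nat) (s : 'I_r -> R),
    codim1_star V P p B lam v w s /\
    exists mu : 'rV[R]_k,
      \sum_(i < r) (w i)%:R *: row_mx (real_mx (v i)) (s i)%:M
        + omega%:R *: row_mx 0 1%:M
      = mu *m row_mx (real_mx B) lam.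

Definition div_points k n (V : wset n) P : set 'rV[\bar R]_n :=
  [set x | exists (p : 'rV[R]_n) (omega : nat),
     [/\ x = emb p, (0 < omega)%N & restoring_weight k V P p omega]].

(* V has dimension k + 1, and the projection to V is [lsubmx].  The closure is
   taken among all extended rows; the points it may have outside T^n are far
   from [tinf]. *)
Definition modification k n (V : wset n) (P : 'rV[\bar R]_n -> \bar R) :
    wset (n + 1) :=
  {| support := [set z : 'rV_(n + 1) |
       support V (lsubmx z) /\
       (rsubmx z 0 0 = P (lsubmx z) \/
        closure (div_points k V P) (lsubmx z) /\
        (P (lsubmx z) <= rsubmx z 0%R 0%R)%E)];
     weight := fun (z : 'rV_(n + 1)) w =>
       (rsubmx z 0 0 = P (lsubmx z) /\ weight V (lsubmx z) w) \/
       (rsubmx z 0 0 <> P (lsubmx z) /\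
        exists2 p : 'rV[R]_n, lsubmx z = emb p
          & restoring_weight k V P p w) |}.

Definition wset_eq_near_inf n (V W : wset n) : Prop :=
  \forall z \near tinf, (support V z <-> support W z) /\
    (forall w, weight V z w <-> weight W z w).

Definition tplane : wset 2 := {| support := Tpt 2; weight := fun _ w => w = 1%N |}.

Definition modification2 (h : 'I_2 -> 'rV[\bar R]_2 -> \bar R) :
    wset (2 + 1 + 1) :=
  modification 1 (modification 1 tplane (h 0)) (h 1 \o lsubmx).

Definition xpart (z : 'rV[\bar R]_(2 + 1 + 1)) : 'rV[\bar R]_2 :=
  lsubmx (lsubmx z).

Definition ypart (z : 'rV[\bar R]_(2 + 1 + 1)) : 'rV[\bar R]_2 :=
  \row_i (if i == 0 then rsubmx (lsubmx z) 0 0 else rsubmx z 0 0).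

Definition xypoint (x y : 'rV[\bar R]_2) : 'rV[\bar R]_(2 + 1 + 1) :=
  row_mx (row_mx x (const_mx (y 0 0))) (const_mx (y 0 1)).

Definition renormalized (f : 'rV[\bar R]_2 -> 'rV[\bar R]_2)
    (s : {perm 'I_2}) (a : 'rV[R]_2) (i : 'I_2) (x : 'rV[\bar R]_2) : \bar R :=
  (f x 0%R (s i) + (a 0%R i)%:E)%E.

(* The map F from the modification along f_(s i) + a_i to the one along
   g_(t i) + b_i; when s = t = 1 this is (x, y) |-> (y - a, x + b). *)
Definition swap_map (s t : {perm 'I_2}) (a b : 'rV[R]_2)
    (z : 'rV[\bar R]_(2 + 1 + 1)) : 'rV[\bar R]_(2 + 1 + 1) :=
  xypoint
    (\row_i (ypart z 0%R (s^-1%g i) - (a 0%R (s^-1%g i))%:E)%E)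
    (\row_i (xpart z 0%R (t i) + (b 0%R i)%:E)%E).

Definition produces_dynamical_system (K : fieldType) (nu : K -> \bar R)
    (f : 'rV[\bar R]_2 -> 'rV[\bar R]_2) : Prop :=
  exists2 g, canonical_inverse nu f g &
    exists (s t : {perm 'I_2}) (a b : 'rV[R]_2),
      let X := modification2 (renormalized f s a) in
      let Y := modification2 (renormalized g t b) in
      wset_eq_near_inf X Y /\
      \forall z \near tinf,
        (swap_map s t a b @` support X) z <-> support X z.

End Modifications.

(* a + p x, where p = None stands for p = +oo. *)
Definition affine_term (R : realType) (a : \bar R) (p : option nat)
    (x : \bar R) : \bar R :=
  if p is Some n then (a + n%:R%:E * x)%E else +oo%E.

Definition normal_form (R : realType) (a1 a2 b1 b2 : \bar R)
    (p2 q1 : option nat) (x : 'rV[\bar R]_2) : 'rV[\bar R]_2 :=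
  \row_i (if i == 0
    then Order.min (a1 + x 0%R 0%R)%E (affine_term a2 p2 (x 0 1))
    else Order.min (affine_term b1 q1 (x 0 0)) (b2 + x 0%R 1%R)%E).

(* Main.v *)
From Pilot Require Import Defs.
From HB Require Import structures.
From mathcomp Require Import all_boot all_order all_fingroup all_algebra.
From mathcomp Require Import all_classical all_reals all_analysis.
From mathcomp Require Import ring lra zify.
Import Pilot.Defs.
Set Implicit Arguments.
Unset Strict Implicit.
Unset Printing Implicit Defensive.
Import Order.TTheory GRing.Theory Num.Theory.
Import numFieldNormedType.Exports.
Local Open Scope classical_set_scope.
Local Open Scope ring_scope.

(** Everything is read on four lowest terms.  Let an invertible germ [G] over
    [K] tropicalize to [f], and let [l i j] be the exponent and the valuation of
    the lowest monomial of [G i] on the axis j, or [None] if there is none.  The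
    linear part of [G] is invertible, so each [G i] has a linear term on some
    axis, and close enough to infinity that term and the lowest terms on the
    axes are below all the other monomials: f_i is the minimum of at most two
    terms a + n x_j ([trop_minform]).  Conversely these terms are determined by
    f_i near infinity ([minform_has_low]), hence common to all the lifts of
    [f].

    The inverse [H] of [G] solves a recursion on the degree, which shows at the
    same time that it exists ([inverse_germs_exists]) and that it converges
    when [G] does ([inverse_germs_convergent]).  The coefficients of [H] on the
    axes have monomial expressions in those of [G] and in the determinant of
    the linear part of [G] ([inverse_axis_low], [inverse_axis_linear]), so the
    lowest terms of [H] are known as soon as the valuation of that determinant
    is ([inverse_has_low]).  If the two products in the determinant do not
    cancel, this valuation is their minimum delta.  Non-cancellation is one
    polynomial condition, which gives a canonical inverse
    ([canonical_inverse_minmap]).  It is unique near infinity because two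
    polynomial conditions are always satisfied by a common lift
    ([generic_lift]): multiplying the coefficients by suitable powers of one
    unit theta turns each condition into a condition on the value at theta of a
    polynomial in one variable, whose valuation is as small as possible when
    the residue of theta avoids the residues of finitely many roots.

    Suppose that the procedure produces a dynamical system.  Above each x the
    graph is the lowest part of a modification, so equal modifications have
    equal defining functions near infinity ([modification2_inj]): up to
    translations and to the order, the lowest terms of [f] are those of its
    canonical inverse ([produces_lows]).  The resulting equations on exponents
    and constants give the three normal forms, except in two families where f
    does not increase some function min_j (c_j + x_j).  Such an f is not
    contracting ([contracting_not_below]): on a neighborhood V of infinity that
    contains the closure of f(V), the infimum of this function would be
    attained, by compactness of the extended reals, and then lowered inside the
    open set V.

    Suppose conversely that [f] has one of the normal forms.  The formula for
    the lowest terms of the inverse shows that g_i + b_i = f_i for a suitable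
    b, so the two modifications coincide, and it remains to see that F
    preserves them.  The divisor of a minimum of two terms is the line where
    the two terms are equal, with weight one ([div_plane]), and the divisor on
    the first modification of the second function lies on the graph of the
    first one ([div_space]).  Hence (x, y) is in the modification if and only if
    each of the two triples formed by y_i and the terms of f_i attains its
    minimum at least twice, and some y_i does not exceed f_i
    ([in_modificationE]).  In these three-term conditions x and y play
    exchangeable parts, and F preserves them. *)

(** * Formal power series in two variables *)

Section Monomials.

Definition mk (a b : nat) : mon 2 := [ffun i => if i == 0 then a else b].

Lemma mk0 a b : mk a b 0 = a. Proof. by rewrite ffunE. Qed.
Lemma mk1 a b : mk a b 1 = b. Proof. by rewrite ffunE. Qed.

Lemma I2P (P : 'I_2 -> Prop) : P 0 -> P 1 -> forall i, P i.
Proof.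
move=> P0 P1 i; case: (unliftP 0 i) => [j ->|-> //].
by rewrite (ord1 j) (_ : lift _ _ = 1) //; apply: val_inj.
Qed.

Lemma mon2E (m : mon 2) : m = mk (m 0) (m 1).
Proof. by apply/ffunP; apply: I2P; rewrite ?mk0 ?mk1. Qed.

Lemma mon_deg2 (m : mon 2) : mon_deg m = (m 0%R + m 1%R)%N.
Proof. by rewrite /mon_deg big_ord_recl big_ord1 (_ : lift _ _ = 1) //; apply: val_inj. Qed.

Lemma mon_deg_mk a b : mon_deg (mk a b) = (a + b)%N.
Proof. by rewrite mon_deg2 mk0 mk1. Qed.

Lemma mk_inj a b c d : mk a b = mk c d -> a = c /\ b = d.
Proof. by move=> e; rewrite -(mk0 a b) -{2}(mk1 a b) e mk0 mk1. Qed.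

(** A finite function on two indices is a pair: double sums replace the sums
    over [{ffun _}] in the products and compositions of series. *)
Lemma sum_box (V : nmodType) N (P : 'I_2 -> pred nat) (F : mon 2 -> V) :
  \sum_(k : {ffun 'I_2 -> 'I_N} | [forall i, P i (k i)]) F (mon_of k)
  = \sum_(a < N | P 0 a) \sum_(b < N | P 1 b) F (mk a b).
Proof.
pose h (p : 'I_N * 'I_N) : {ffun 'I_2 -> 'I_N} :=
  [ffun i => if i == 0 then p.1 else p.2].
have hb : bijective h.
  exists (fun k : {ffun 'I_2 -> 'I_N} => (k 0, k 1)) => [[a b]|k].
    by rewrite /h !ffunE.
  by apply/ffunP; apply: I2P; rewrite ffunE.
rewrite (reindex h) /=; last exact: onW_bij.
rewrite pair_big_dep /=; apply: eq_big => [[a b]|[a b] _] /=.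
  apply/forallP/andP => [H|[Ha Hb] i].
    by have := H 0; have := H 1; rewrite !ffunE.
  by move: i; apply: I2P; rewrite ffunE.
by congr F; apply/ffunP; apply: I2P; rewrite !ffunE.
Qed.

End Monomials.

(** A synonym of [pseries K 2] which carries the ring structure; on
    [pseries] itself the pointwise product of functions would interfere. *)
Definition fps (K : fieldType) : Type := mon 2 -> K.

Section FpsMul.
Variable K : fieldType.
Implicit Types phi psi chi : pseries K 2.

Lemma ps_mulE phi psi m : ps_mul phi psi m =
  \sum_(a < (m 0%R).+1) \sum_(b < (m 1%R).+1)
    phi (mk a b) * psi (mk (m 0%R - a) (m 1%R - b)).
Proof.
rewrite /ps_mul.
pose F k := phi k * psi [ffun i => (m i - k i)%N].
transitivity (\sum_(k : {ffun 'I_2 -> 'I_(mon_deg m).+1} |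
    [forall i, (fun j => k i <= m i)%N i]) F (mon_of k)).
  apply: eq_bigr => k _; rewrite /F; congr (_ * psi _).
  by apply/ffunP => i; rewrite !ffunE.
rewrite (sum_box _ (fun i a => a <= m i)%N F) mon_deg2.
rewrite (big_ord_widen_cond (m 0%R + m 1%R)%N.+1 xpredT (fun a => \sum_(b < (m 1%R).+1)
  phi (mk a b) * psi (mk (m 0%R - a) (m 1%R - b)))) ?ltnS ?leq_addr //.
apply: eq_big => [a|a _]; first by rewrite ltnS.
rewrite (big_ord_widen_cond (m 0%R + m 1%R)%N.+1 xpredT (fun b =>
  phi (mk a b) * psi (mk (m 0%R - a) (m 1%R - b)))) ?ltnS ?leq_addl //.
apply: eq_big => [b|b _]; first by rewrite ltnS.
rewrite /F; congr (_ * psi _).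
by apply/ffunP; apply: I2P; rewrite !ffunE.
Qed.

(** Each coefficient of a product involves finitely many coefficients of the
    factors, so the ring axioms for series are inherited from the
    polynomials in K[Y][X] that truncate them. *)
Definition trunc N phi : {poly {poly K}} :=
  \poly_(a < N) \poly_(b < N) phi (mk a b).

Lemma coef_trunc N phi a b : (a < N)%N -> (b < N)%N ->
  (trunc N phi)`_a`_b = phi (mk a b).
Proof. by move=> aN bN; rewrite coef_poly aN coef_poly bN. Qed.

Lemma coefMM (p q : {poly {poly K}}) a b : (p * q)`_a`_b =
  \sum_(i < a.+1) \sum_(j < b.+1) p`_i`_j * q`_(a - i)`_(b - j).
Proof. by rewrite coefM coef_sum; apply: eq_bigr => i _; rewrite coefM. Qed.

Lemma ps_mul_coef (p q : {poly {poly K}}) phi psi (m : mon 2) :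
  (forall a b, (a <= m 0%R)%N -> (b <= m 1%R)%N -> phi (mk a b) = p`_a`_b) ->
  (forall a b, (a <= m 0%R)%N -> (b <= m 1%R)%N -> psi (mk a b) = q`_a`_b) ->
  ps_mul phi psi m = (p * q)`_(m 0%R)`_(m 1%R).
Proof.
move=> hp hq; rewrite ps_mulE coefMM; apply: eq_bigr => a _; apply: eq_bigr => b _.
by rewrite hp ?hq ?leq_subr // -ltnS.
Qed.

Lemma ps_mulP N phi psi (m : mon 2) : (m 0%R < N)%N -> (m 1%R < N)%N ->
  ps_mul phi psi m = (trunc N phi * trunc N psi)`_(m 0%R)`_(m 1%R).
Proof.
move=> m0 m1; apply: ps_mul_coef => a b am bm; rewrite coef_trunc //;
  by [exact: leq_ltn_trans m0|exact: leq_ltn_trans m1].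
Qed.

Lemma ps_mulC : commutative (@ps_mul K 2).
Proof.
move=> phi psi; apply/funext => m; set N := (maxn (m 0%R) (m 1%R)).+1.
by rewrite !(@ps_mulP N) ?ltnS ?leq_maxl ?leq_maxr // mulrC.
Qed.

Lemma ps_mulA : associative (@ps_mul K 2).
Proof.
move=> phi psi chi; apply/funext => m; set N := (maxn (m 0%R) (m 1%R)).+1.
have m0 : (m 0%R < N)%N by rewrite ltnS leq_maxl.
have m1 : (m 1%R < N)%N by rewrite ltnS leq_maxr.
rewrite (@ps_mul_coef (trunc N phi) (trunc N psi * trunc N chi)); last first.
- move=> a b am bm; have aN := leq_ltn_trans am m0; have bN := leq_ltn_trans bm m1.
  by rewrite (@ps_mulP N) ?mk0 ?mk1.
- move=> a b am bm; rewrite coef_trunc //; [exact: leq_ltn_trans m0|exact: leq_ltn_trans m1].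
rewrite (@ps_mul_coef (trunc N phi * trunc N psi) (trunc N chi)) ?mulrA //.
- move=> a b am bm; have aN := leq_ltn_trans am m0; have bN := leq_ltn_trans bm m1.
  by rewrite (@ps_mulP N) ?mk0 ?mk1.
- move=> a b am bm; rewrite coef_trunc //; [exact: leq_ltn_trans m0|exact: leq_ltn_trans m1].
Qed.

Lemma ps_one_coef (m : mon 2) : ps_one K m = (1 : {poly {poly K}})`_(m 0%R)`_(m 1%R).
Proof.
rewrite /ps_one coef1; case: (m =P _) => [->|e].
  by rewrite !ffunE /= coef1.
case: (m 0%R =P 0%N) => [e0|]; last by rewrite coef0.
rewrite coef1; case: (m 1%R =P 0%N) => [e1|//].
by case: e; rewrite (mon2E m) e0 e1; apply/ffunP; apply: I2P; rewrite !ffunE.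
Qed.

Lemma ps_mul1 : left_id (@ps_one K 2) (@ps_mul K 2).
Proof.
move=> phi; apply/funext => m; set N := (maxn (m 0%R) (m 1%R)).+1.
have m0 : (m 0%R < N)%N by rewrite ltnS leq_maxl.
have m1 : (m 1%R < N)%N by rewrite ltnS leq_maxr.
rewrite (@ps_mul_coef 1 (trunc N phi)) ?mul1r ?coef_trunc -?mon2E //.
- by move=> a b _ _; rewrite ps_one_coef mk0 mk1.
- move=> a b am bm; rewrite coef_trunc //; [exact: leq_ltn_trans m0|exact: leq_ltn_trans m1].
Qed.

HB.instance Definition _ := GRing.Zmodule.copy (fps K) (mon 2 -> K).

Lemma ps_mulDl : left_distributive (@ps_mul K 2 : fps K -> fps K -> fps K) +%R.
Proof.
move=> phi psi chi; apply/funext => m.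
have -> : (ps_mul phi chi + ps_mul psi chi : fps K) m =
  ps_mul phi chi m + ps_mul psi chi m by [].
rewrite !ps_mulE -big_split; apply: eq_bigr => a _; rewrite -big_split; apply: eq_bigr => b _.
exact: mulrDl.
Qed.

Lemma ps_one_neq0 : (@ps_one K 2 : fps K) != 0.
Proof.
apply/eqP => /(congr1 (fun f : fps K => f [ffun=> 0%N])).
rewrite /ps_one eqxx /= => /eqP; rewrite (_ : (0 : fps K) _ = 0) //.
by rewrite oner_eq0.
Qed.

HB.instance Definition _ := GRing.Zmodule_isComNzRing.Build (fps K)
  ps_mulA ps_mulC ps_mul1 ps_mulDl ps_one_neq0.

Lemma fps_sum I (r : seq I) (P : pred I) (F : I -> fps K) m :
  (\sum_(i <- r | P i) F i) m = \sum_(i <- r | P i) F i m.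
Proof. by elim/big_rec2 : _ => // i y x _ <-. Qed.

Lemma fpsM (x y : fps K) m : (x * y) m = \sum_(a < (m 0%R).+1) \sum_(b < (m 1%R).+1)
    x (mk a b) * y (mk (m 0%R - a) (m 1%R - b)).
Proof. exact: ps_mulE. Qed.

Definition fpow (H : 'I_2 -> pseries K 2) (a b : nat) : fps K :=
  (H 0 : fps K) ^+ a * (H 1 : fps K) ^+ b.

Lemma ps_monomialE H a b : ps_monomial H (mk a b) = fpow H a b.
Proof.
have it (x : fps K) n : iter n (ps_mul x) (@ps_one K 2) = x ^+ n.
  by elim: n => //= n ->; rewrite exprS.
rewrite /ps_monomial !big_ord_recl big_ord0 (_ : lift _ _ = 1); last exact: val_inj.
by rewrite mk0 mk1 !it -[RHS]mulr1 -mulrA.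
Qed.

Lemma ps_compE phi H m : ps_comp phi H m =
  \sum_(a < (mon_deg m).+1) \sum_(b < (mon_deg m).+1) phi (mk a b) * fpow H a b m.
Proof.
rewrite /ps_comp; pose F k := phi k * ps_monomial H k m.
transitivity (\sum_(k : {ffun 'I_2 -> 'I_(mon_deg m).+1} |
    [forall i, (fun _ _ => true) i (k i)]) F (mon_of k)).
  by apply: eq_bigl => k; symmetry; apply/forallP.
rewrite (sum_box _ (fun _ _ => true)); apply: eq_bigr => a _; apply: eq_bigr => b _.
by rewrite /F ps_monomialE.
Qed.

End FpsMul.

Section PowerLemma.
Variables (K : fieldType) (S : nat -> nat -> K -> K -> Prop).
Hypothesis S0 : forall n d, S n d 0 0.
Hypothesis SD : forall n d x x' y y', S n d x x' -> S n d y y' -> S n d (x + y) (x' + y').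
Hypothesis SM : forall n d n' d' x x' y y', S n d x x' -> S n' d' y y' ->
  S (n + n') (d + d') (x * y) (x' * y').
Hypothesis S1 : S 0 0 1 1.

(** This relation says that x and x' have order at least n and that their
    coefficients of degree less than N + n are related by S. For a relation
    S compatible with sums and products, with n counting the factors, this
    passes to the monomials in two series. Three relations are used: the
    trivial one for orders of vanishing, equality for the dependence of
    powers on truncations, and a lower bound on valuations for convergence. *)
Definition graded N n (x x' : pseries K 2) := forall m : mon 2,
  ((mon_deg m < n)%N -> x m = 0 /\ x' m = 0) /\
  ((mon_deg m < N + n)%N -> S n (mon_deg m) (x m) (x' m)).

Lemma graded_one N : graded N 0 (1 : fps K) (1 : fps K).
Proof.
move=> m; split=> // _; rewrite (_ : (1 : fps K) m = ps_one K m) // /ps_one.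
case: eqP => [->|_]; last exact: S0.
rewrite (_ : mon_deg _ = 0%N) // /mon_deg big1 // => i _; by rewrite ffunE.
Qed.

Lemma graded_mul N n n' (x x' y y' : fps K) : graded N n x x' ->
  graded N n' y y' -> graded N (n + n') (x * y) (x' * y').
Proof.
move=> hx hy m.
have dE a b : (a < (m 0%R).+1)%N -> (b < (m 1%R).+1)%N ->
  (mon_deg (mk a b) + mon_deg (mk (m 0%R - a) (m 1%R - b)) = mon_deg m)%N.
  rewrite !mon_deg_mk mon_deg2; lia.
have zero a b : (a < (m 0%R).+1)%N -> (b < (m 1%R).+1)%N ->
  (mon_deg (mk a b) < n)%N \/ (mon_deg (mk (m 0%R - a) (m 1%R - b)) < n')%N ->
  x (mk a b) * y (mk (m 0%R - a) (m 1%R - b)) = 0 /\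
  x' (mk a b) * y' (mk (m 0%R - a) (m 1%R - b)) = 0.
  move=> am bm [h|h].
    by have [/(_ h)[-> ->] _] := hx (mk a b); rewrite !mul0r.
  by have [/(_ h)[-> ->] _] := hy (mk (m 0%R - a) (m 1%R - b)); rewrite !mulr0.
split=> hm; rewrite !fpsM.
  by split; apply: big1 => a _; apply: big1 => b _;
    have [] := zero a b (ltn_ord a) (ltn_ord b); rewrite //;
    have := dE a b (ltn_ord a) (ltn_ord b); lia.
have SS (I : Type) (r : seq I) (F F' : I -> K) d k : (forall i, S d k (F i) (F' i)) ->
    S d k (\sum_(i <- r) F i) (\sum_(i <- r) F' i).
  by move=> H; elim/big_ind2 : _ => // *; exact: SD.
apply: (SS) => a; apply: (SS) => b.
have d := dE a b (ltn_ord a) (ltn_ord b).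
case: (boolP ((mon_deg (mk a b) < n) ||
    (mon_deg (mk (m 0%R - a) (m 1%R - b)) < n'))%N) => [/orP h|].
  by have [-> ->] := zero a b (ltn_ord a) (ltn_ord b) h; exact: S0.
rewrite negb_or -!leqNgt => /andP[h1 h2].
rewrite -d; apply: SM.
  by apply: (hx _).2; lia.
by apply: (hy _).2; lia.
Qed.

Lemma graded_exp N n (x x' : fps K) k : graded N n x x' ->
  graded N (k * n) (x ^+ k) (x' ^+ k).
Proof.
by move=> h; elim: k => [|k IH]; [exact: graded_one|rewrite !exprS mulSn; exact: graded_mul].
Qed.

Lemma graded_fpow N H H' a b : (forall i, graded N 1 (H i) (H' i)) ->
  graded N (a + b) (fpow H a b) (fpow H' a b).
Proof.
move=> h; rewrite /fpow -[a in (a + _)%N]muln1 -[b in (_ + b)%N]muln1.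
by apply: graded_mul; apply: graded_exp.
Qed.

End PowerLemma.

Section Composition.
Variable K : fieldType.
Implicit Types (phi psi : pseries K 2) (G H : 'I_2 -> pseries K 2).

Definition centered G := forall i, G i [ffun=> 0%N] = 0.

Lemma mon_deg0P (m : mon 2) : (mon_deg m < 1)%N -> m = [ffun=> 0%N].
Proof.
rewrite mon_deg2 => h; rewrite (mon2E m); apply/ffunP; apply: I2P; rewrite !ffunE /=; lia.
Qed.

Lemma graded_centered (S : nat -> nat -> K -> K -> Prop) G G' N : centered G -> centered G' ->
  (forall i m, (mon_deg m < N + 1)%N -> S 1 (mon_deg m) (G i m) (G' i m)) ->
  forall i, graded S N 1 (G i) (G' i).
Proof.
move=> c c' h i m; split=> [/mon_deg0P ->|/h]; first by rewrite c c'.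
exact.
Qed.

Lemma fpow_order H a b (m : mon 2) : centered H -> (mon_deg m < a + b)%N -> fpow H a b m = 0.
Proof.
move=> c; have h := @graded_fpow K (fun _ _ _ _ => True).
have [] := h (fun _ _ => I) (fun _ _ _ _ _ _ _ _ => I) (fun _ _ _ _ _ _ _ _ _ _ => I) I
   0%N H H a b (graded_centered c c (fun _ _ _ => I)) m.
by move=> h1 _ /h1[].
Qed.

(** A product of at least two series without constant term involves, in
    degree N, only coefficients of degree less than N. This is what makes
    the equation of the inverse a recursion. *)
Lemma fpow_agree H H' N a b (m : mon 2) : centered H -> centered H' ->
  (forall i m, (mon_deg m < N)%N -> H i m = H' i m) -> (1 < a + b)%N ->
  (mon_deg m < N.+1)%N -> fpow H a b m = fpow H' a b m.
Proof.
case: N => [|N] c c' h ab hm.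
  have m0 : (mon_deg m < a + b)%N by lia.
  by rewrite !fpow_order.
have := @graded_fpow K (fun _ _ x y => x = y) _ _ _ _ N H H' a b.
move=> /(_ _ _ _ _ _ m)-[]//.
- by move=> n d x x' y y' -> ->.
- by move=> n d n' d' x x' y y' -> ->.
- by apply: graded_centered => // i m' hm'; apply: h; lia.
- by move=> _; apply; lia.
Qed.

Lemma sum_big_range (N M : nat) (F : nat -> nat -> K) : (N <= M)%N ->
  (forall a b, (N <= a)%N || (N <= b)%N -> F a b = 0) ->
  \sum_(a < N) \sum_(b < N) F a b = \sum_(a < M) \sum_(b < M) F a b.
Proof.
move=> NM F0; rewrite (big_ord_widen _ (fun a => \sum_(b < N) F a b) NM) big_mkcond /=.
apply: eq_bigr => a _; case: ltnP => aN; last first.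
  by rewrite big1 // => b _; rewrite F0 // aN.
rewrite (big_ord_widen _ (fun b => F a b) NM) big_mkcond /=.
by apply: eq_bigr => b _; case: ltnP => // bN; rewrite F0 // bN orbT.
Qed.

(** The terms of large degree of the outer series contribute nothing, so the
    range of the sum is free. *)
Lemma comp_range N phi H (m : mon 2) : centered H -> (mon_deg m < N)%N ->
  ps_comp phi H m = \sum_(a < N) \sum_(b < N) phi (mk a b) * fpow H a b m.
Proof.
move=> c mN; rewrite ps_compE.
apply: (sum_big_range (F := fun a b => phi (mk a b) * fpow H a b m)) => // a b ab.
by rewrite fpow_order ?mulr0 //; lia.
Qed.

(** Constants, polynomials in Y and polynomials in X, Y are mapped to series
    by three ring morphisms; since evaluation is a morphism, so is
    composition in its outer argument. *)
Definition fconst (c : K) : fps K := fun m => c * ps_one K m.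

Lemma fconst_mul c (x : fps K) m : (fconst c * x) m = c * x m.
Proof.
rewrite -[in RHS](mul1r x) !fpsM mulr_sumr; apply: eq_bigr => a _.
by rewrite mulr_sumr; apply: eq_bigr => b _; rewrite mulrA.
Qed.

Fact fconst_is_zmod : zmod_morphism fconst.
Proof. by move=> a b; apply/funext => m; rewrite /fconst mulrBl. Qed.
Fact fconst_is_monoid : monoid_morphism fconst.
Proof.
split; first by apply/funext => m; rewrite /fconst mul1r.
by move=> a b; apply/funext => m; rewrite fconst_mul /fconst mulrA.
Qed.
HB.instance Definition _ := GRing.isZmodMorphism.Build _ _ fconst fconst_is_zmod.
HB.instance Definition _ := GRing.isMonoidMorphism.Build _ _ fconst fconst_is_monoid.

Definition ev1 H : {poly K} -> fps K := horner_eval (H 1 : fps K) \o map_poly fconst.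
HB.instance Definition _ H := GRing.RMorphism.on (ev1 H).
Definition ev2 H : {poly {poly K}} -> fps K := horner_eval (H 0 : fps K) \o map_poly (ev1 H).
HB.instance Definition _ H := GRing.RMorphism.on (ev2 H).

Lemma ev2E N H (p : {poly {poly K}}) m : (size p <= N)%N ->
  (forall a, (size (p`_a)%R <= N)%N) ->
  ev2 H p m = \sum_(a < N) \sum_(b < N) p`_a`_b * fpow H a b m.
Proof.
move=> sp spa; rewrite /ev2 /= /horner_eval (@horner_coef_wide _ N); last first.
  by rewrite (leq_trans (size_poly _ _)).
rewrite fps_sum; apply: eq_bigr => a _; rewrite coef_map /=.
rewrite /ev1 /= /horner_eval (@horner_coef_wide _ N); last first.
  by rewrite (leq_trans (size_poly _ _)).
rewrite mulr_suml fps_sum; apply: eq_bigr => b _; rewrite coef_map /=.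
by rewrite -mulrA fconst_mul /fpow mulrC [_ ^+ b * _]mulrC mulrC.
Qed.

Lemma poly2_bound (p : {poly {poly K}}) N0 : exists N, [/\ (N0 <= N)%N,
  (size p <= N)%N & forall a, (size (p`_a)%R <= N)%N].
Proof.
exists (N0 + (size p + \sum_(a < size p) size (p`_a)%R))%N; split; [lia|lia|].
move=> a; case: (ltnP a (size p)) => ap; last by rewrite nth_default // size_poly0.
rewrite (bigD1 (Ordinal ap)) //=; lia.
Qed.

Lemma ev2_comp H phi (p : {poly {poly K}}) (m : mon 2) : centered H ->
  (forall a b, (a + b <= mon_deg m)%N -> p`_a`_b = phi (mk a b)) ->
  ev2 H p m = ps_comp phi H m.
Proof.
move=> c h; have [N [mN pN paN]] := poly2_bound p (mon_deg m).+1.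
rewrite (@ev2E N) // (@comp_range N) //.
apply: eq_bigr => a _; apply: eq_bigr => b _.
case: (leqP (a + b) (mon_deg m)) => ab; first by rewrite h.
by rewrite fpow_order // !mulr0.
Qed.

(** In each degree the outer series may be replaced by polynomials, for
    which composition is evaluation. *)
Lemma ps_compM phi psi H : centered H ->
  ps_comp (ps_mul phi psi) H = (ps_comp phi H : fps K) * ps_comp psi H :> fps K.
Proof.
move=> c; apply/funext => m; set N := (mon_deg m).+1.
have m01 := mon_deg2 m.
rewrite -(@ev2_comp _ _ (trunc N phi * trunc N psi)) //; last first.
  move=> a b ab; rewrite (@ps_mulP _ N) ?mk0 ?mk1 //; lia.
rewrite rmorphM !fpsM; apply: eq_bigr => a _; apply: eq_bigr => b _.
have /= an := ltn_ord a; have /= bn := ltn_ord b.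
congr (_ * _); apply: ev2_comp => // a' b'; rewrite mon_deg_mk => ab;
  rewrite coef_trunc //; lia.
Qed.

Lemma ps_comp1 H : centered H -> ps_comp (@ps_one K 2) H = 1 :> fps K.
Proof.
move=> c; apply/funext => m; rewrite -(@ev2_comp _ _ 1) ?rmorph1 //.
by move=> a b _; rewrite ps_one_coef mk0 mk1.
Qed.

Lemma fpow_comp H G a b : centered G ->
  ps_comp (fpow H a b) G = fpow (fun i => ps_comp (H i) G) a b.
Proof.
move=> c; rewrite /fpow.
have X i k : ps_comp ((H i : fps K) ^+ k) G = (ps_comp (H i) G : fps K) ^+ k.
  elim: k => [|k IH]; first exact: ps_comp1.
  by rewrite !exprS -IH; exact: ps_compM.
by rewrite -!X; exact: ps_compM.
Qed.

Lemma comp_centered H G : centered H -> centered G ->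
  centered (fun i => ps_comp (H i) G).
Proof.
move=> cH cG i; rewrite ps_compE.
have -> : mon_deg ([ffun=> 0%N] : mon 2) = 0%N by rewrite mon_deg2 !ffunE.
rewrite !big_ord1 [X in H i X](_ : _ = [ffun=> 0%N]) ?cH ?mul0r //.
by apply/ffunP; apply: I2P; rewrite !ffunE.
Qed.

(** Both sides are the same double sum, because composition with [G] is
    multiplicative on the monomials in [H]. *)
Lemma ps_compA phi H G : centered H -> centered G ->
  ps_comp (ps_comp phi H) G = ps_comp phi (fun i => ps_comp (H i) G).
Proof.
move=> cH cG; apply/funext => m.
have cHG := comp_centered cH cG.
set N := (mon_deg m).+1; set M := (N + N)%N.
rewrite (@comp_range N) // (@comp_range M (phi)) //; last by rewrite /M /N; lia.
transitivity (\sum_(a < M) \sum_(b < M) \sum_(c < N) \sum_(d < N)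
   phi (mk a b) * (fpow H a b (mk c d) * fpow G c d m)); last first.
  apply: eq_bigr => a _; apply: eq_bigr => b _.
  rewrite -fpow_comp // (@comp_range N) // mulr_sumr; apply: eq_bigr => c _.
  by rewrite mulr_sumr.
under [RHS]eq_bigr do rewrite exchange_big.
rewrite [RHS]exchange_big; apply: eq_bigr => c _.
under [RHS]eq_bigr do rewrite exchange_big.
rewrite [RHS]exchange_big; apply: eq_bigr => d _.
rewrite (@comp_range M (phi)) //; last first.
  by rewrite mon_deg_mk; have := ltn_ord c; have := ltn_ord d; rewrite /M /N /=; lia.
rewrite mulr_suml; apply: eq_bigr => a _; rewrite mulr_suml; apply: eq_bigr => b _.
by rewrite mulrA.
Qed.

Lemma ps_var_centered : centered (@ps_var K 2).
Proof.
move=> i; rewrite /ps_var; case: eqP => // /ffunP/(_ i).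
by rewrite !ffunE eqxx.
Qed.

(** Polynomials seen as series; the powers of the two variables are computed
    among them. *)
Definition ofp (p : {poly {poly K}}) : fps K := fun m => p`_(m 0%R)`_(m 1%R).

Lemma ofpM p q : ofp p * ofp q = ofp (p * q).
Proof.
by apply/funext => m; apply: ps_mul_coef => a b _ _; rewrite /ofp mk0 mk1.
Qed.

Lemma ofp1 : ofp 1 = 1.
Proof. by apply/funext => m; rewrite /ofp -ps_one_coef. Qed.

Lemma ofpX p k : ofp p ^+ k = ofp (p ^+ k).
Proof. by elim: k => [|k IH]; rewrite ?ofp1 // !exprS IH ofpM. Qed.

Lemma ps_var_mk i : ps_var K i = fun m => (m == mk (i == 0) (i == 1))%:R.
Proof.
apply/funext => m; rewrite /ps_var; congr ((_ == _)%:R).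
by apply/ffunP; move: i; apply: I2P; apply: I2P; rewrite !ffunE.
Qed.

Lemma eq_mk (m : mon 2) a b : (m == mk a b) = (m 0%R == a) && (m 1%R == b).
Proof.
apply/eqP/andP => [->|[/eqP e0 /eqP e1]]; first by rewrite mk0 mk1.
by rewrite (mon2E m) e0 e1.
Qed.

Lemma ps_var_ofp0 : ps_var K 0 = ofp 'X.
Proof.
apply/funext => m; rewrite ps_var_mk eq_mk /ofp coefX.
by case: eqP; rewrite ?coef0 ?coef1.
Qed.

Lemma ps_var_ofp1 : ps_var K 1 = ofp 'X%:P.
Proof.
apply/funext => m; rewrite ps_var_mk eq_mk /ofp coefC.
by case: eqP; rewrite ?coef0 ?coefX.
Qed.

Lemma fpow_var a b m : fpow (@ps_var K 2) a b m = (m == mk a b)%:R.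
Proof.
rewrite /fpow ps_var_ofp0 ps_var_ofp1 !ofpX ofpM eq_mk /ofp -rmorphXn coefMC coefXn.
by case: eqP; rewrite ?mul0r ?coef0 // mul1r coefXn.
Qed.

Lemma ps_comp_var phi : ps_comp phi (@ps_var K 2) = phi.
Proof.
apply/funext => m; rewrite ps_compE.
have m01 := mon_deg2 m.
have h0 : (m 0%R < (mon_deg m).+1)%N by lia.
have h1 : (m 1%R < (mon_deg m).+1)%N by lia.
rewrite (bigD1 (Ordinal h0)) //= (bigD1 (Ordinal h1)) //= fpow_var -mon2E eqxx mulr1.
rewrite !big1 ?addr0 // => [a an|b bn].
  apply: big1 => b _; rewrite fpow_var eq_mk eq_sym; move: an; rewrite -val_eqE /=.
  by move=> /negbTE->; rewrite mulr0.
rewrite fpow_var eq_mk eqxx eq_sym /=; move: bn; rewrite -val_eqE /=.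
by move=> /negbTE->; rewrite mulr0.
Qed.

Lemma var_comp i H : centered H -> ps_comp (ps_var K i) H = H i.
Proof.
move=> c; apply/funext => m; rewrite -(@ev2_comp _ _ (if i == 0 then 'X else 'X%:P)) //.
  move: i; apply: I2P => /=.
    by rewrite /ev2 /= /horner_eval map_polyX hornerX.
  by rewrite /ev2 /= /horner_eval map_polyC hornerC /= /ev1 /= /horner_eval map_polyX hornerX.
move=> a b _; move: i; apply: I2P => /=; first by rewrite ps_var_ofp0 /ofp mk0 mk1.
by rewrite ps_var_ofp1 /ofp mk0 mk1.
Qed.

End Composition.

(** * The formal inverse function theorem *)

Section FormalInverse.
Variable K : fieldType.
Implicit Types (phi psi : pseries K 2) (G H : 'I_2 -> pseries K 2).

(** The exponent of x_j^n. *)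
Definition ax (j : 'I_2) (n : nat) : mon 2 := [ffun i => if i == j then n else 0%N].

Lemma ax0E n : ax 0 n = mk n 0.
Proof. by apply/ffunP; apply: I2P; rewrite !ffunE. Qed.
Lemma ax1E n : ax 1 n = mk 0 n.
Proof. by apply/ffunP; apply: I2P; rewrite !ffunE. Qed.
Lemma mon_deg_ax j n : mon_deg (ax j n) = n.
Proof. by move: j; apply: I2P; rewrite ?ax0E ?ax1E mon_deg_mk ?addn0. Qed.

Lemma sum_I2 (V : nmodType) (F : 'I_2 -> V) : \sum_i F i = F 0 + F 1.
Proof. by rewrite big_ord_recl big_ord1 (_ : lift _ _ = 1) //; apply: val_inj. Qed.

Definition lin G : 'M[K]_2 := \matrix_(i, j) G i (ax j 1).

(** The contribution to a composition of the monomials of degree at least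
    two of the outer series. *)
Definition nonlin phi H : fps K := fun m =>
  \sum_(a < (mon_deg m).+1) \sum_(b < (mon_deg m).+1 | (1 < a + b)%N)
    phi (mk a b) * fpow H a b m.

Lemma fpow_single H j : fpow H (j == 0) (j == 1) = H j.
Proof.
by move: j; apply: I2P; rewrite /fpow /= ?expr1 ?expr0 ?mulr1 ?mul1r.
Qed.

Lemma low_sum N (F : nat -> nat -> K) :
  \sum_(a < N.+2) \sum_(b < N.+2 | ~~ (1 < a + b)%N) F a b = F 0 0 + F 0 1 + F 1 0.
Proof.
have z (P : pred nat) (f : nat -> K) :
    (forall b, P b.+2 -> f b.+2 = 0) ->
    \sum_(b < N.+2 | P b) f b = (if P 0 then f 0 else 0) + (if P 1 then f 1 else 0).
  move=> hP; rewrite big_mkcond 2!big_ord_recl /=.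
  rewrite -[RHS]addr0 -addrA; congr (_ + (_ + _)); apply: big1 => i _; rewrite /bump.
  by case: ifP => // /hP.
pose G a := \sum_(b < N.+2 | ~~ (1 < a + b)%N) F a b.
rewrite (z xpredT G) //=; last by move=> a _; apply: big_pred0.
by rewrite /G (z (fun b => ~~ (1 < 0 + b)%N)) // (z (fun b => ~~ (1 < 1 + b)%N)) //= addr0.
Qed.

Lemma comp_split phi H : phi [ffun=> 0%N] = 0 -> centered H -> forall m,
  ps_comp phi H m = \sum_j phi (ax j 1) * H j m + nonlin phi H m.
Proof.
move=> phi0 cH m; rewrite sum_I2 ax0E ax1E.
have [m0|m1] := ltnP (mon_deg m) 1.
  rewrite ps_compE /nonlin (mon_deg0P m0).
  have -> : mon_deg ([ffun=> 0%N] : mon 2) = 0%N by rewrite mon_deg2 !ffunE.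
  rewrite !cH !big_ord1 big_mkcond big_ord1 /= (_ : mk 0 0 = [ffun=> 0%N]) ?phi0.
    by rewrite mul0r !mulr0 !addr0.
  by apply/ffunP; apply: I2P; rewrite !ffunE.
rewrite ps_compE /nonlin; case: (mon_deg m) m1 => // N _.
have -> : \sum_(a < N.+2) \sum_(b < N.+2) phi (mk a b) * fpow H a b m =
  \sum_(a < N.+2) \sum_(b < N.+2 | ~~ (1 < a + b)%N) phi (mk a b) * fpow H a b m +
  \sum_(a < N.+2) \sum_(b < N.+2 | (1 < a + b)%N) phi (mk a b) * fpow H a b m.
  rewrite -big_split; apply: eq_bigr => a _.
  by rewrite (bigID (fun b : 'I__ => (1 < a + b)%N)) /= addrC.
congr (_ + _).
have e0 := fpow_single H 0; have e1 := fpow_single H 1.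
rewrite -[in RHS]e0 -[in RHS]e1.
rewrite (low_sum _ (fun a b => phi (mk a b) * fpow H a b m)).
rewrite (_ : mk 0 0 = [ffun=> 0%N]) ?phi0 ?mul0r ?add0r; first by rewrite addrC.
by apply/ffunP; apply: I2P; rewrite !ffunE.
Qed.

(** Inverting the linear part of [G] turns G o H = id into an expression of
    [H] by its own coefficients of smaller degree. *)
Lemma comp_lin_nonlin G H : centered G -> centered H ->
  lin G \in unitmx ->
  (forall i, ps_comp (G i) H = ps_var K i) <->
  (forall j m, H j m =
     \sum_i invmx (lin G) j i * (ps_var K i m - nonlin (G i) H m)).
Proof.
move=> cG cH uG; split=> [e j m|e i].
  have e' i : ps_var K i m - nonlin (G i) H m = \sum_k lin G i k * H k m.
    rewrite -e comp_split // addrK; by apply: eq_bigr => k _; rewrite mxE.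
  under eq_bigr do rewrite e' mulr_sumr.
  rewrite exchange_big /=.
  transitivity (\sum_k (invmx (lin G) *m lin G) j k * H k m).
    rewrite mulVmx // (bigD1 j) //= mxE eqxx mul1r big1 ?addr0 // => k kj.
    by rewrite mxE eq_sym (negbTE kj) mul0r.
  apply: eq_bigr => k _; rewrite mxE mulr_suml.
  by apply: eq_bigr => i _; rewrite mulrA.
apply/funext => m; rewrite comp_split //.
have -> : \sum_j G i (ax j 1) * H j m = ps_var K i m - nonlin (G i) H m; last by rewrite subrK.
transitivity (\sum_k (lin G *m invmx (lin G)) i k * (ps_var K k m - nonlin (G k) H m)).
  under [RHS]eq_bigr do rewrite mxE mulr_suml.
  rewrite exchange_big; apply: eq_bigr => j _.
  rewrite [in LHS]e mulr_sumr; apply: eq_bigr => k _.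
  by rewrite mulrA [in RHS]mxE.
rewrite mulmxV // (bigD1 i) //= mxE eqxx mul1r big1 ?addr0 // => k kj.
by rewrite mxE eq_sym (negbTE kj) mul0r.
Qed.

Lemma nonlin0 phi H : nonlin phi H [ffun=> 0%N] = 0.
Proof.
rewrite /nonlin.
have -> : mon_deg ([ffun=> 0%N] : mon 2) = 0%N by rewrite mon_deg2 !ffunE.
by rewrite big_ord1 big_mkcond big_ord1.
Qed.

(** The recursive equation is solved by iteration from zero: each step fixes
    the coefficients of one more degree. *)
Lemma right_inverse G : centered G -> lin G \in unitmx ->
  exists H, centered H /\ forall i, ps_comp (G i) H = ps_var K i.
Proof.
move=> cG uG.
pose step H : 'I_2 -> pseries K 2 := fun j m =>
  \sum_i invmx (lin G) j i * (ps_var K i m - nonlin (G i) H m).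
pose it n := iter n step (fun=> fun=> 0).
have stepc H : centered (step H).
  move=> j; rewrite /step big1 // => i _.
  by rewrite nonlin0 ps_var_centered subr0 mulr0.
have itc n : centered (it n) by case: n => [|n] //=; exact: stepc.
have step_agree N H H' : centered H -> centered H' ->
    (forall i m, (mon_deg m < N)%N -> H i m = H' i m) ->
    forall i m, (mon_deg m < N.+1)%N -> step H i m = step H' i m.
  move=> c c' h i m hm; apply: eq_bigr => k _; congr (_ * (_ - _)).
  apply: eq_bigr => a _; apply: eq_bigr => b ab; congr (_ * _).
  exact: (@fpow_agree K H H' N).
have agree1 n i m : (mon_deg m < n)%N -> it n i m = it n.+1 i m.
  by elim: n i m => [//|n IH] i m hm; apply: (@step_agree n (it n) (it n.+1)).
have agree n k i m : (mon_deg m < n)%N -> it (n + k)%N i m = it n i m.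
  elim: k => [|k IH] hm; first by rewrite addn0.
  by rewrite addnS -agree1 ?IH // (leq_trans hm) ?leq_addr.
have [H HE] : exists H : 'I_2 -> pseries K 2,
    forall n i m, (mon_deg m < n)%N -> H i m = it n i m.
  exists (fun i m => it (mon_deg m).+1 i m) => n i m hm.
  by rewrite -[in RHS](subnKC hm) agree.
have cH : centered H by move=> i; rewrite (HE (mon_deg ([ffun=> 0%N] : mon 2)).+1) // itc.
exists H; split=> //; apply/(comp_lin_nonlin cG cH uG) => j m.
transitivity (step (it (mon_deg m).+1) j m); first exact: (HE (mon_deg m).+2).
by apply: (step_agree (mon_deg m).+1) => // i m' hm'; rewrite -HE.
Qed.

Lemma ps_var_ax i j : ps_var K i (ax j 1) = (i == j)%:R.
Proof.
rewrite ps_var_mk eq_mk /ax !ffunE; move: i j; do 2!apply: I2P; by [].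
Qed.

Lemma nonlin1 phi H m : centered H -> (mon_deg m <= 1)%N -> nonlin phi H m = 0.
Proof.
move=> cH hm; apply: big1 => a _; apply: big1 => b ab.
by rewrite fpow_order ?mulr0 //; lia.
Qed.

Lemma lin_inverse G H : centered G -> centered H ->
  (forall i, ps_comp (G i) H = ps_var K i) -> lin G *m lin H = 1%:M.
Proof.
move=> cG cH e; apply/matrixP => i k; rewrite !mxE.
have := congr1 (fun f => f (ax k 1)) (e i).
rewrite comp_split // nonlin1 ?mon_deg_ax // addr0 ps_var_ax => <-.
by apply: eq_bigr => j _; rewrite !mxE.
Qed.

(** A right inverse H has itself a right inverse, which is equal to [G] by
    associativity. *)
Lemma inverse_germs_exists G : centered G -> lin G \in unitmx ->
  exists H, inverse_germs G H.
Proof.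
move=> cG uG.
have [H [cH GH]] := right_inverse cG uG.
have uH : lin H \in unitmx by have /mulmx1_unit[] := lin_inverse cG cH GH.
have [G' [cG' HG']] := right_inverse cH uH.
have GG' i : G i = G' i.
  rewrite -[LHS](ps_comp_var (G i)).
  have <- : (fun i => ps_comp (H i) G') = @ps_var K 2 by apply/funext => j; rewrite HG'.
  by rewrite -ps_compA // GH var_comp.
exists H; split=> // i m; first by rewrite GH.
by rewrite (_ : G = G') ?HG' //; apply/funext.
Qed.

Lemma inverse_germs_lin G H : inverse_germs G H -> lin G *m lin H = 1%:M.
Proof.
by case=> cG cH GH _; apply: lin_inverse => // i; apply/funext => m; rewrite GH.
Qed.

Lemma inverse_germs_rec G H : inverse_germs G H -> forall j m, H j m =
     \sum_i invmx (lin G) j i * (ps_var K i m - nonlin (G i) H m).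
Proof.
move=> GH; have /mulmx1_unit[uG _] := inverse_germs_lin GH.
case: GH => cG cH GH _; apply/comp_lin_nonlin => // i.
by apply/funext => m; rewrite GH.
Qed.

End FormalInverse.

(** * Valuations and convergence *)

Section NearInfinity.
Variable R : realType.

Definition far n (M : R) (x : 'rV[\bar R]_n) := forall i, (M%:E < x 0%R i)%E.

Lemma far_le n (M M' : R) (x : 'rV[\bar R]_n) : M <= M' -> far M' x -> far M x.
Proof. by move=> h fx i; apply: le_lt_trans (fx i); rewrite lee_fin. Qed.

Lemma near_tinfP n (P : set 'rV[\bar R]_n) :
  (\forall x \near tinf, P x) <-> exists M : R, forall x, far M x -> P x.
Proof.
split=> [[Q nQ QP]|[M MP]].
  have h i : exists M : R, forall y, (M%:E < y)%E -> Q 0 i y.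
    have := nQ 0 i; rewrite mxE => -[M [_ HM]].
    by exists M => y; exact: HM.
  have /choice[M HM] := h.
  exists (\sum_i `|M i|) => x fx; apply: QP => i j; rewrite (ord1 i).
  apply: HM; apply: le_lt_trans (fx j); rewrite lee_fin.
  rewrite (bigD1 j) //= (le_trans (ler_norm _)) // lerDl.
  by apply: sumr_ge0 => k _; exact: normr_ge0.
exists (fun _ _ y => (M%:E < y)%E) => [i j|x hx]; last by apply: MP => i; exact: hx.
by rewrite mxE; exists M; split => //; exact: num_real.
Qed.

Lemma near_far n (M : R) : \forall x \near (tinf : 'rV[\bar R]_n), far M x.
Proof. by apply/near_tinfP; exists M. Qed.

Lemma far_neqNy n (M : R) (x : 'rV[\bar R]_n) i : far M x -> x 0 i != -oo%E.
Proof. by move=> /(_ i); case: (x _ _). Qed.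

Lemma near_Tpt n : \forall x \near (tinf : 'rV[\bar R]_n), Tpt n x.
Proof. by apply: filterS (near_far n 0) => x fx i; exact: far_neqNy fx. Qed.

End NearInfinity.

Section Valuation.
Variables (R : realType) (K : fieldType) (nu : K -> \bar R).
Hypothesis hnu : is_valuation nu.
Local Open Scope ereal_scope.

Lemma nu0 : nu 0%R = +oo. Proof. exact/(val_eqy hnu). Qed.

Lemma nu_fin x : x != 0%R -> nu x \is a fin_num.
Proof.
move=> x0; have := val_neqNy hnu x; case E: (nu x) => [r||] // _.
by move/(val_eqy hnu): E => e; rewrite e eqxx in x0.
Qed.

Lemma nu_real x (a : R) : nu x = a%:E -> x != 0%R.
Proof. by move=> h; apply/eqP => x0; rewrite x0 nu0 in h. Qed.

Lemma nu_eqy x : (nu x == +oo) = (x == 0%R).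
Proof. by apply/eqP/eqP => /(val_eqy hnu). Qed.

Lemma nu1 : nu 1%R = 0.
Proof.
have := valM hnu 1%R 1%R; rewrite mul1r.
have := nu_fin (oner_neq0 K); case: (nu 1%R) => [r||] // _ [h].
by congr EFin; lra.
Qed.

Lemma nuX x n : nu (x ^+ n)%R = n%:R%:E * nu x.
Proof.
elim: n => [|n IH]; first by rewrite expr0 nu1 mul0e.
rewrite exprS (valM hnu) IH; have [->|x0] := eqVneq x 0%R.
  rewrite nu0; case: n {IH} => [|n]; first by rewrite mul0e mul1e adde0.
  by rewrite !gt0_muley ?lte_fin ?ltr0n.
move/fineK: (nu_fin x0) => <-; rewrite -!EFinM -EFinD; congr EFin.
by rewrite -[n.+1%:R]natr1; ring.
Qed.

Lemma nuN x : nu (- x)%R = nu x.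
Proof.
rewrite -mulN1r (valM hnu).
suff -> : nu (- 1)%R = 0 by rewrite add0e.
have := valM hnu (-1)%R (-1)%R; rewrite mulrNN mulr1 nu1.
have : (- 1 : K)%R != 0%R by rewrite oppr_eq0 oner_neq0.
by move/nu_fin; case: (nu (-1)%R) => [r||] // _ [h]; congr EFin; lra.
Qed.

Lemma nuV x : x != 0%R -> nu (x^-1)%R = - nu x.
Proof.
move=> x0; have := valM hnu x (x^-1)%R; rewrite mulfV // nu1.
have := nu_fin x0; have : (x^-1)%R != 0%R by rewrite invr_eq0.
move/nu_fin; case: (nu _) => [r||] // _; case: (nu _) => [s||] // _ [h].
by congr EFin; lra.
Qed.

Lemma nu_le_add x y c : c <= nu x -> c <= nu y -> c <= nu (x + y)%R.
Proof. by move=> hx hy; apply: le_trans (valD hnu x y); rewrite le_min hx hy. Qed.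

Lemma nu_le_sum I (r : seq I) (P : pred I) (F : I -> K) c :
  (forall i, P i -> c <= nu (F i)) -> c <= nu (\sum_(i <- r | P i) F i)%R.
Proof.
move=> h; elim/big_rec : _ => [|i x Pi hx]; first by rewrite nu0 leey.
by apply: nu_le_add => //; apply: h.
Qed.

Lemma nu_strict x y : nu x < nu y -> nu (x + y)%R = nu x.
Proof.
move=> h; apply/eqP; rewrite eq_le; apply/andP; split; last first.
  by apply: nu_le_add => //; exact: ltW.
have := valD hnu (x + y)%R (- y)%R; rewrite addrK nuN ge_min.
by case/orP => // h'; have := lt_le_trans h h'; rewrite ltxx.
Qed.

Lemma nu_le_mul x y (a b : R) : a%:E <= nu x -> b%:E <= nu y -> (a + b)%:E <= nu (x * y)%R.
Proof. by move=> h1 h2; rewrite (valM hnu) EFinD; exact: leeD. Qed.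

End Valuation.

Section Convergence.
Variables (R : realType) (K : fieldType) (nu : K -> \bar R).
Hypothesis hnu : is_valuation nu.
Implicit Types (phi : pseries K 2) (G H : 'I_2 -> pseries K 2).

(** A lower bound on the valuations that is affine in the degree:
    convergence on a ball. *)
Definition bounded_by (rho tau : R) phi := forall m,
  ((tau - rho * (mon_deg m)%:R)%:E <= nu (phi m))%E.

Definition convergent phi := exists rho tau, bounded_by rho tau phi.

Lemma bounded_by_le rho tau rho' tau' phi : rho <= rho' -> tau' <= tau ->
  bounded_by rho tau phi -> bounded_by rho' tau' phi.
Proof.
move=> h1 h2 b m; apply: le_trans (b m); rewrite lee_fin lerB //.
by rewrite ler_wpM2r.
Qed.

Lemma convergent_common G : (forall i, convergent (G i)) ->
  exists rho tau, [/\ 0 <= rho, tau <= 0 & forall i, bounded_by rho tau (G i)].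
Proof.
move=> h; have [rho0 [tau0 b0]] := h 0; have [rho1 [tau1 b1]] := h 1.
exists (`|rho0| + `|rho1|), (- (`|tau0| + `|tau1|)); split.
- by rewrite addr_ge0.
- by rewrite oppr_le0 addr_ge0.
move=> i; have := ler_norm rho0; have := ler_norm rho1; have := normr_ge0 rho0; have := normr_ge0 rho1.
have := ler_norm (- tau0); have := ler_norm (- tau1); have := normr_ge0 tau0; have := normr_ge0 tau1.
rewrite !normrN => *.
by elim/I2P: i; [apply: (bounded_by_le _ _ b0)|apply: (bounded_by_le _ _ b1)]; lra.
Qed.

(** Induction on the degree along the recursive equation of the inverse. A
    product of k coefficients of H of total degree d has valuation at least
    k tau - rho d; taking tau large absorbs, for k at least 2, the constants
    of the bounds on [G] and on the inverse of its linear part, and rho then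
    takes care of the linear terms. *)
Lemma inverse_germs_convergent G H : inverse_germs G H ->
  (forall i, convergent (G i)) -> forall i, convergent (H i).
Proof.
move=> GH /convergent_common[rho0 [sigma [rho0_ge0 sigma_le0 bG]]].
have rec := inverse_germs_rec GH.
set B := invmx (lin G) in rec.
have [beta [beta0 hB]] : exists beta, beta <= 0 /\ forall j i, (beta%:E <= nu (B j i))%E.
  have h (x : K) : exists b : R, b <= 0 /\ (b%:E <= nu x)%E.
    have := val_neqNy hnu x; case: (nu x) => [r||] // _.
      exists (- `|r|); rewrite oppr_le0 normr_ge0 lee_fin lerNl -normrN; split=> //.
      exact: ler_norm.
    by exists 0; rewrite leey.
  have [b00 [? h00]] := h (B 0 0); have [b01 [? h01]] := h (B 0 1).
  have [b10 [? h10]] := h (B 1 0); have [b11 [? h11]] := h (B 1 1).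
  exists (b00 + b01 + b10 + b11); split; first lra.
  by move=> j i; elim/I2P: j; elim/I2P: i; [apply: le_trans h00|apply: le_trans h01|
     apply: le_trans h10|apply: le_trans h11]; rewrite lee_fin; lra.
(* The choice of tau makes beta + sigma - rho0 k + (k - 1) tau nonnegative
   for every k >= 2, that of rho makes the variables satisfy the bound. *)
set tau := 2 * rho0 - beta - sigma; set rho := tau - beta.
have cH : centered H by case: GH.
have key n : forall i m, (mon_deg m < n)%N ->
    ((tau - rho * (mon_deg m)%:R)%:E <= nu (H i m))%E.
  elim: n => [//|n IH] j m; rewrite ltnS leq_eqVlt => /orP[/eqP mn|]; last exact: IH.
  case: n IH mn => [|n] IH mn.
    by rewrite (@mon_deg0P m) ?mn // cH (nu0 hnu) leey.
  rewrite rec; apply: (nu_le_sum hnu) => i _.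
  have -> : tau - rho * (mon_deg m)%:R = beta + (tau - beta - rho * (mon_deg m)%:R) by ring.
  apply: (nu_le_mul hnu) => //.
  have vv : ((tau - beta - rho * (mon_deg m)%:R)%:E <= nu (ps_var K i m))%E.
    rewrite /ps_var; case: eqP => [->|_]; last by rewrite (nu0 hnu) leey.
    rewrite (_ : mon_deg _ = 1%N); last by rewrite -[RHS](mon_deg_ax i 1); congr mon_deg; apply/ffunP => k; rewrite !ffunE; case: eqP.
    by rewrite (nu1 hnu) lee_fin /rho; lra.
  apply: (nu_le_add hnu) => //; rewrite (nuN hnu).
  apply: (nu_le_sum hnu) => a _; apply: (nu_le_sum hnu) => b ab.
  pose S (k d : nat) (x y : K) := ((k%:R * tau - rho * d%:R)%:E <= nu x)%E.
  have gr : graded S n (a + b) (fpow H a b) (fpow H a b).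
    apply: graded_fpow.
    - by move=> k d; rewrite /S (nu0 hnu) leey.
    - by move=> k d x x' y y'; rewrite /S => *; apply: (nu_le_add hnu).
    - move=> k d k' d' x x' y y'; rewrite /S => h1 h2.
      rewrite (_ : _ - _ = (k%:R * tau - rho * d%:R) + (k'%:R * tau - rho * d'%:R)).
        exact: (nu_le_mul hnu).
      by rewrite !natrD; ring.
    - by rewrite /S (nu1 hnu) lee_fin !mul0r mulr0 subr0.
    - apply: graded_centered => // i' m' hm'; rewrite /S mul1r; apply: IH; lia.
  have hm : (mon_deg m < n + (a + b))%N by lia.
  have := (gr m).2 hm; rewrite /S => hf.
  have hg := bG i (mk a b); rewrite mon_deg_mk in hg.
  apply: le_trans (nu_le_mul hnu hg hf); rewrite lee_fin /rho.
  have k2 : 2 <= (a + b)%:R :> R by rewrite ler_nat.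
  set k := (a + b)%:R in k2 *; set d := (mon_deg m)%:R.
  suff : 0 <= beta + sigma - rho0 * k + (k - 1) * tau by rewrite /rho; lra.
  rewrite /tau; nra.
by move=> i; exists rho, tau => m; apply: (key (mon_deg m).+1).
Qed.

End Convergence.

(** * Lowest terms on the axes *)

(** A term a + n x_j is recorded as [Some (n, a)], the term +oo as [None]. *)
Definition low_term (R : realType) := option (nat * R).

Section MinForms.
Variable R : realType.
Local Open Scope ereal_scope.

Definition aterm (o : low_term R) (y : \bar R) : \bar R :=
  if o is Some (n, a) then a%:E + n%:R%:E * y else +oo.

Definition minform (l : 'I_2 -> low_term R) (x : 'rV[\bar R]_2) : \bar R :=
  Order.min (aterm (l 0%R) (x 0%R 0%R)) (aterm (l 1%R) (x 0%R 1%R)).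

Definition no_const (o : low_term R) := if o is Some (0, _) then false else true.

Definition is_linear (o : low_term R) := if o is Some (1, _) then true else false.

Lemma is_linearP o : is_linear o -> exists a, o = Some (1%N, a).
Proof. by case: o => [[[|[|n]] a]|] //= _; exists a. Qed.

Lemma minform_le l (x : 'rV[\bar R]_2) j : minform l x <= aterm (l j) (x 0%R j).
Proof. by elim/I2P: j; rewrite /minform ge_min lexx ?orbT. Qed.

Lemma le_minform l (x : 'rV[\bar R]_2) c : (forall j, c <= aterm (l j) (x 0%R j)) -> c <= minform l x.
Proof. by move=> h; rewrite /minform le_min !h. Qed.

Definition axpoint (j : 'I_2) (r : R) : 'rV[\bar R]_2 :=
  \row_i (if i == j then r%:E else +oo).

Lemma far_axpoint j (M r : R) : (M < r)%R -> far M (axpoint j r).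
Proof. by move=> Mr i; rewrite mxE; case: ifP; rewrite ?lte_fin ?ltry. Qed.

Lemma aterm_y o : no_const o -> aterm o +oo = +oo.
Proof.
case: o => [[[|n] a]|] //= _.
by rewrite gt0_muley ?lte_fin ?ltr0n.
Qed.

Lemma minform_axpoint l j r : (forall j, no_const (l j)) ->
  minform l (axpoint j r) = aterm (l j) r%:E.
Proof.
move=> wf; rewrite /minform; elim/I2P: j; rewrite !mxE /= ?(aterm_y (wf _)).
  by rewrite miney.
by rewrite minye.
Qed.

(** Two real points beyond the bound recover the slope, then the constant. *)
Lemma aterm_inj (o o' : low_term R) (M : R) :
  (forall r, (M < r)%R -> aterm o r%:E = aterm o' r%:E) -> o = o'.
Proof.
case: o o' => [[n a]|] [[n' a']|] h //=.
- have h1 := h (M + 1)%R; have h2 := h (M + 2)%R.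
  have := h1 ltac:(lra); have := h2 ltac:(lra) => /= -[e2] [e1].
  have nn : n%:R = n'%:R :> R by lra.
  move/eqP: (nn); rewrite eqr_nat => /eqP e; subst n'.
  by congr (Some (_, _)); lra.
- by have := h (M + 1)%R ltac:(lra).
- by have := h (M + 1)%R ltac:(lra).
Qed.

End MinForms.

Section Lows.
Variables (R : realType) (K : fieldType) (nu : K -> \bar R).
Hypothesis hnu : is_valuation nu.
Implicit Types (phi : pseries K 2) (G H : 'I_2 -> pseries K 2).
Local Open Scope ereal_scope.

Definition has_low phi (j : 'I_2) (o : low_term R) : Prop :=
  match o with
  | Some (n, a) => (forall k, (k < n)%N -> phi (ax j k) = 0%R) /\ nu (phi (ax j n)) = a%:E
  | None => forall k, phi (ax j k) = 0%R
  end.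

Lemma has_low_exists phi j : exists o, has_low phi j o.
Proof.
have [ex|nex] := pselect (exists k, phi (ax j k) != 0%R).
  exists (Some (ex_minn ex, fine (nu (phi (ax j (ex_minn ex)))))) => /=.
  case: ex_minnP => n n0 nmin; split=> [k kn|]; last by rewrite fineK // (nu_fin hnu).
  by apply/eqP; apply/negPn/negP => /nmin; rewrite leqNgt kn.
by exists None => k; apply/eqP; apply/negPn/negP => h; apply: nex; exists k.
Qed.

Lemma ax_0 j : ax j 0 = [ffun=> 0%N].
Proof. by apply/ffunP => i; rewrite !ffunE; case: ifP. Qed.

Lemma has_low_no_const phi j o : phi [ffun=> 0%N] = 0%R -> has_low phi j o -> no_const o.
Proof. by case: o => [[[|n] a]|] //= h []; rewrite ax_0 h (nu0 hnu). Qed.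

Definition mterm (m : mon 2) (x : 'rV[\bar R]_2) : \bar R :=
  (m 0%R)%:R%:E * x 0%R 0%R + (m 1%R)%:R%:E * x 0%R 1%R.

Lemma ttermE phi m x : tterm (nu \o phi) m x = nu (phi m) + mterm m x.
Proof. by rewrite /tterm /mterm sum_I2. Qed.

Lemma natmul_neqNy (n : nat) (y : \bar R) : y != -oo -> n%:R%:E * y != -oo.
Proof.
case: y => [r||] //= _; case: n => [|n]; first by rewrite mul0e.
by rewrite gt0_muley ?lte_fin ?ltr0n.
Qed.

Lemma mterm_neqNy m M x : far M x -> mterm m x != -oo.
Proof.
by move=> fx; rewrite /mterm adde_eq_ninfty negb_or !natmul_neqNy ?(far_neqNy _ fx).
Qed.

Lemma mterm_y (m : mon 2) M x i : far M x -> (0 < m i)%N -> x 0%R i = +oo -> mterm m x = +oo.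
Proof.
move=> fx mi xi; have := natmul_neqNy (m 0%R) (far_neqNy 0%R fx).
have := natmul_neqNy (m 1%R) (far_neqNy 1%R fx).
move: mi xi; rewrite /mterm; elim/I2P: i => mi ->.
  by rewrite gt0_muley ?lte_fin ?ltr0n // => ? _; rewrite addye.
by rewrite [_ * +oo]gt0_muley ?lte_fin ?ltr0n // => _ ?; rewrite addey.
Qed.

Lemma mterm_ax j n x : mterm (ax j n) x = n%:R%:E * x 0%R j.
Proof.
by rewrite /mterm !ffunE; elim/I2P: j; rewrite /= mul0e ?adde0 ?add0e.
Qed.

(** The quotient of the two monomials has a degree D >= 1, so it contributes
    at least M D, whereas the constants lose at most |a - tau| + rho (n +
    D). *)
Lemma mterm_domination (n : nat) (a rho tau M : R) (m : mon 2) j v x :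
  (0 <= rho)%R -> (`|a - tau| + rho * n.+1%:R <= M)%R -> far M x ->
  (tau - rho * (mon_deg m)%:R)%:E <= v -> (n <= m j)%N -> (n < mon_deg m)%N ->
  a%:E + n%:R%:E * x 0%R j <= v + mterm m x.
Proof.
move=> rho0 hM fx hv nm nd.
have M0 : (0 <= M)%R by apply: le_trans hM; rewrite addr_ge0 // mulr_ge0.
apply: le_trans (leeD hv (lexx _)).
have [[i hi]|hfin] := pselect (exists i, (0 < m i)%N && (x 0%R i == +oo)).
  by have /andP[mi /eqP xi] := hi; rewrite (mterm_y fx mi xi) addey ?leey.
have real i : exists r, (M < r)%R /\ forall k, (k <= m i)%N -> k%:R%:E * x 0%R i = (k%:R * r)%:E.
  have := fx i; case E: (x 0%R i) => [r||] // Mr; first by exists r.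
  exists (M + 1)%R; split; first lra.
  move=> k km; have : ~~ (0 < m i)%N by apply/negP => mi; apply: hfin; exists i; rewrite mi E eqxx.
  by rewrite -eqn0Ngt => /eqP mi; move: km; rewrite mi leqn0 => /eqP->; rewrite mul0e mul0r.
rewrite mon_deg2 in nd *.
have [r0 [Mr0 h0]] := real 0%R; have [r1 [Mr1 h1]] := real 1%R.
rewrite /mterm h0 // h1 //.
have dn : ((mon_deg m - n)%N%:R = (m 0%R)%:R + (m 1%R)%:R - n%:R :> R)%R.
  by rewrite mon_deg2 natrB ?natrD // ltnW.
have dn1 : (1 <= (m 0%R)%:R + (m 1%R)%:R - n%:R :> R)%R.
  by rewrite -dn ler1n mon_deg2 subn_gt0.
have dn2 : ((m 0%R)%:R + (m 1%R)%:R <= n.+1%:R * ((m 0%R)%:R + (m 1%R)%:R - n%:R) :> R)%R.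
  by rewrite -natr1; have : (0 <= n%:R :> R)%R by []; nra.
have key : (a - tau + rho * ((m 0%R)%:R + (m 1%R)%:R)
    <= M * ((m 0%R)%:R + (m 1%R)%:R - n%:R))%R.
  set D := ((m 0%R)%:R + (m 1%R)%:R - n%:R)%R in dn dn1 dn2 *.
  have an := ler_norm (a - tau); have an0 := normr_ge0 (a - tau)%R.
  have : (rho * ((m 0%R)%:R + (m 1%R)%:R) <= rho * (n.+1%:R * D))%R by rewrite ler_wpM2l.
  have : ((`|a - tau| + rho * n.+1%:R) * D <= M * D)%R by rewrite ler_wpM2r //; lra.
  have : (`|a - tau| <= `|a - tau| * D)%R by rewrite ler_peMr.
  by rewrite !mulrDl mulrA; lra.
have m0 : (0 <= (m 0%R)%:R :> R)%R by []. have m1 : (0 <= (m 1%R)%:R :> R)%R by [].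
move: nm; elim/I2P: j => nm.
  rewrite h0 // lee_fin natrD.
  have nm' : (n%:R <= (m 0%R)%:R :> R)%R by rewrite ler_nat.
  have : (M * ((m 0%R)%:R - n%:R) <= r0 * ((m 0%R)%:R - n%:R))%R by rewrite ler_wpM2r //; lra.
  have : (M * (m 1%R)%:R <= r1 * (m 1%R)%:R)%R by rewrite ler_wpM2r //; lra.
  lra.
rewrite h1 // lee_fin natrD.
have nm' : (n%:R <= (m 1%R)%:R :> R)%R by rewrite ler_nat.
have : (M * ((m 1%R)%:R - n%:R) <= r1 * ((m 1%R)%:R - n%:R))%R by rewrite ler_wpM2r //; lra.
have : (M * (m 0%R)%:R <= r0 * (m 0%R)%:R)%R by rewrite ler_wpM2r //; lra.
lra.
Qed.

Lemma not_axE (m : mon 2) : (exists j, m = ax j (m j)) \/ (0 < m 0%R)%N /\ (0 < m 1%R)%N.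
Proof.
case m0: (m 0%R) => [|a].
  by left; exists 1%R; rewrite ax1E {1}(mon2E m) m0.
case m1: (m 1%R) => [|b]; last by right.
by left; exists 0%R; rewrite ax0E {1}(mon2E m) m1.
Qed.

(** A monomial on an axis is dominated by the lowest one of this axis, and a
    mixed monomial by the linear term, which divides it. *)
Lemma trop_minform phi (l : 'I_2 -> low_term R) : convergent nu phi ->
  phi [ffun=> 0%N] = 0%R -> (forall j, has_low phi j (l j)) ->
  (exists j, is_linear (l j)) ->
  \forall x \near tinf, teval (nu \o phi) x = minform l x.
Proof.
move=> [rho' [tau b']] phi0 hl [j1 lin1].
have [rho [rho0 b]] : exists rho, (0 <= rho)%R /\ bounded_by nu rho tau phi.
  exists `|rho'|%R; split => //; apply: (bounded_by_le _ _ b') => //; exact: ler_norm.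
pose Mof (o : low_term R) := if o is Some (n, a) then (`|a - tau| + rho * n.+1%:R)%R else 0%R.
have Mof0 o : (0 <= Mof o)%R by case: o => [[n a]|] //=; rewrite addr_ge0 // mulr_ge0.
pose M := (Mof (l 0%R) + Mof (l 1%R))%R.
have MofM j : (Mof (l j) <= M)%R.
  by elim/I2P: j; rewrite /M ?lerDl ?lerDr.
apply/near_tinfP; exists M => x fx; apply/eqP; rewrite eq_le; apply/andP; split.
  apply: le_minform => j; case E: (l j) (hl j) => [[n a]|] /=; last by rewrite leey.
  move=> [_ na]; apply: ereal_inf_lbound; exists (ax j n) => //.
  by rewrite ttermE /= na mterm_ax.
apply/ereal_infP => _ [m _ <-]; rewrite ttermE.
have [pm|pm] := eqVneq (phi m) 0%R.
  by rewrite pm (nu0 hnu) addye ?leey // (mterm_neqNy _ fx).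
suff [j [n [a [lj nm h]]]] : exists j n a,
    [/\ l j = Some (n, a), (n <= m j)%N & m = ax j n \/ (n < mon_deg m)%N].
  apply: le_trans (minform_le _ _ j) _; rewrite lj /=; case: h => h.
    rewrite h mterm_ax; have := hl j; rewrite lj => -[_ ->]; exact: lexx.
  apply: (@mterm_domination n a rho tau M m j _ x) => //.
  by have := MofM j; rewrite lj.
have [[j mj]|[m0 m1]] := not_axE m.
  have := hl j; case lj: (l j) => [[n a]|] /=; last first.
    by move=> /(_ (m j)); rewrite -mj => e; rewrite e eqxx in pm.
  move=> [small _]; exists j, n, a; split=> //.
    rewrite leqNgt; apply/negP => /small; rewrite -mj => e; by rewrite e eqxx in pm.
  have [mn|mn] := ltnP n (m j); [right|left].
    by rewrite mj mon_deg_ax.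
  rewrite mj; congr ax; apply/eqP; rewrite eqn_leq mn /=.
  by rewrite leqNgt; apply/negP => /small; rewrite -mj => e; rewrite e eqxx in pm.
exists j1; move: lin1; case: (l j1) => [[[|[|n]] a]|] //= _; exists 1%N, a; split=> //.
  by move: j1 {hl}; apply: I2P.
by right; rewrite mon_deg2; lia.
Qed.

Lemma teval_le phi m x : teval (nu \o phi) x <= nu (phi m) + mterm m x.
Proof. by rewrite -ttermE; apply: ereal_inf_lbound; exists m. Qed.

(** At points with one real coordinate only the monomials on one axis count,
    and there the exponent and the constant of the lowest term are seen as
    slope and value. The valuation of the lowest coefficient cannot be
    larger than a: all monomials would then stay above the term by a fixed
    amount. *)
Lemma minform_has_low phi (l : 'I_2 -> low_term R) : (forall j, no_const (l j)) ->
  (\forall x \near tinf, teval (nu \o phi) x = minform l x) ->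
  forall j, has_low phi j (l j).
Proof.
move=> wf /near_tinfP[M h] j.
have le k r : (M < r)%R -> aterm (l j) r%:E <= nu (phi (ax j k)) + (k%:R * r)%:E.
  move=> Mr; rewrite -minform_axpoint // -h; last exact: far_axpoint.
  by apply: le_trans (teval_le _ (ax j k) _) _; rewrite mterm_ax !mxE eqxx.
case lj: (l j) le => [[n a]|] /= le; last first.
  move=> k; have := le k (M + 1)%R ltac:(lra).
  have [->//|p0] := eqVneq (phi (ax j k)) 0%R.
  by have := nu_fin hnu p0; case: (nu _) => //.
have small k : (k < n)%N -> phi (ax j k) = 0%R.
  clear lj; move=> kn; apply/eqP; apply/negPn/negP => p0.
  have := nu_fin hnu p0; case E: (nu (phi (ax j k))) => [v||] // _.
  pose r : R := (`|M| + `|v - a| + 1)%R.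
  have M1 := ler_norm M; have M2 := normr_ge0 M.
  have v1 := ler_norm (v - a)%R; have v2 := normr_ge0 (v - a)%R.
  have := le k r ltac:(rewrite /r; lra); rewrite E lee_fin; clear E.
  have : (k.+1%:R <= n%:R :> R)%R by rewrite ler_nat.
  rewrite -natr1 => kn1.
  have : (r <= (n%:R - k%:R) * r)%R by rewrite ler_peMl /r; lra.
  by rewrite /r; lra.
split=> //; apply/eqP; rewrite eq_le; apply/andP; split; last first.
  clear lj; have := le n (M + 1)%R ltac:(lra); rewrite -EFinM -EFinD.
  have [->|p0] := eqVneq (phi (ax j n)) 0%R; first by move=> _; rewrite (nu0 hnu) leey.
  by have := nu_fin hnu p0; case: (nu _) => [v||] // _; rewrite !lee_fin; lra.
rewrite leNgt; apply/negP => lt.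
have [e [e0 e1 he]] : exists e : R, [/\ (0 < e)%R, (e <= 1)%R & (a + e)%:E <= nu (phi (ax j n))].
  clear lj; move: lt; case: (nu _) => [v||] //; last by exists 1%R; rewrite leey; split.
  rewrite lte_fin => av; exists (Order.min 1 (v - a))%R; split.
  - by rewrite lt_min; lra.
  - by rewrite ge_min lexx.
  - by rewrite lee_fin -lerBrDl ge_min lexx orbT.
have : (a + n%:R * (M + 2) + e)%:E <= teval (nu \o phi) (axpoint j (M + 2)%R).
  clear lj; apply/ereal_infP => _ [m _ <-]; rewrite ttermE.
  have fx : far M (axpoint j (M + 2)%R) by apply: far_axpoint; lra.
  have [pm|pm] := eqVneq (phi m) 0%R.
    by rewrite pm (nu0 hnu) addye ?leey // (mterm_neqNy _ fx).
  have [mj|[i [ij mi]]] : m = ax j (m j) \/ exists i, i != j /\ (0 < m i)%N.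
    have [[i mi]|[m0 m1]] := not_axE m; last first.
      by right; elim/I2P: j {le small he lt fx}; [exists 1%R|exists 0%R].
    have [ij|ij] := eqVneq i j; first by left; rewrite -ij.
    case m0 : (m i) => [|c]; last by right; exists i; rewrite m0.
    by left; rewrite mi m0 ax_0 ffunE ax_0.
  - rewrite mj mterm_ax !mxE eqxx.
    have [mn|nm] := ltnP (m j) n.
      by move: (small _ mn); rewrite -mj => e'; rewrite e' eqxx in pm.
    move: nm; rewrite leq_eqVlt => /orP[/eqP<-|nm].
      apply: le_trans (leeD he (lexx _)); rewrite lee_fin; lra.
    have := le (m j) (M + 1)%R ltac:(lra); rewrite -mj.
    have := nu_fin hnu pm; case: (nu _) => [v||] // _; rewrite !lee_fin.
    have : (n.+1%:R <= (m j)%:R :> R)%R by rewrite ler_nat.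
    rewrite -natr1; lra.
  - rewrite (mterm_y fx mi) ?addey ?leey ?(val_neqNy hnu) //.
    by rewrite mxE (negbTE ij).
rewrite h; last by clear lj; apply: far_axpoint; lra.
rewrite minform_axpoint // lj /= lee_fin; clear lj; lra.
Qed.

(** One finite value of the tropicalization at a point with equal
    coordinates is a bound on all the coefficients. *)
Lemma teval_convergent phi (x : R) : teval (nu \o phi) (const_mx x%:E) != -oo ->
  convergent nu phi.
Proof.
move=> h.
have [t ht] : exists t : R, t%:E <= teval (nu \o phi) (const_mx x%:E).
  by case: (teval _ _) h => [t||] // _; [exists t|exists 0%R; rewrite leey].
exists x, t => m; have := le_trans ht (teval_le phi m _).
rewrite /mterm !mxE mon_deg2 natrD.
have := val_neqNy hnu (phi m); case: (nu _) => [v||] // _; last by move=> _; rewrite leey.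
rewrite !lee_fin; lra.
Qed.

Lemma inf_seq_neqNy (I : choiceType) (S : seq I) (F : I -> \bar R) :
  (forall m, F m != -oo) -> ereal_inf [set F m | m in [set` S]] != -oo.
Proof.
move=> FN; suff [t ht] : exists t : R, t%:E <= ereal_inf [set F m | m in [set` S]].
  by apply: contraTneq ht => ->; rewrite leNgt ltNyr.
have [t ht] : exists t : R, forall m, m \in S -> t%:E <= F m.
  elim: S => [|m S [t ht]]; first by exists 0%R.
  have [s hs] : exists s : R, s%:E <= F m.
    by have := FN m; case: (F m) => [s||] // _; [exists s|exists 0%R; rewrite leey].
  exists (Order.min s t) => k; rewrite in_cons => /orP[/eqP->|/ht].
    by apply: le_trans hs; rewrite lee_fin ge_min lexx.
  by apply: le_trans; rewrite lee_fin ge_min lexx orbT.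
by exists t; apply/ereal_infP => _ [m /= mS <-]; exact: ht.
Qed.

(** Near infinity the tropicalization is a minimum of finitely many terms,
    hence not -oo. *)
Lemma tropicalizes_convergent G f : tropical_germ f -> tropicalizes_to nu G f ->
  forall i, convergent nu (G i).
Proof.
move=> gf /near_tinfP[M hM] i.
have [c [S [cN /near_tinfP[M' hM']]]] := gf i.
pose r : R := (`|M| + `|M'| + 1)%R.
have f1 : far M (const_mx r%:E : 'rV_2).
  by move=> k; rewrite mxE lte_fin /r; have := ler_norm M; have := normr_ge0 M'; lra.
have f2 : far M' (const_mx r%:E : 'rV_2).
  by move=> k; rewrite mxE lte_fin /r; have := ler_norm M'; have := normr_ge0 M; lra.
apply: (@teval_convergent _ r).
have := hM _ f1 => /(congr1 (fun y : 'rV__ => y 0%R i)); rewrite mxE => ->.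
have [-> ->] := hM' _ f2.
apply: inf_seq_neqNy => m; rewrite /tterm adde_eq_ninfty negb_or cN /=.
by rewrite sum_I2 !mxE.
Qed.

End Lows.

(** * Lowest terms of the inverse *)

Definition oth (i : 'I_2) : 'I_2 := if i == 0 then 1 else 0.

Lemma othK : involutive oth.
Proof. by apply: I2P. Qed.

Lemma oth_neq i : oth i != i.
Proof. by move: i; apply: I2P. Qed.

Lemma neq_oth (i j : 'I_2) : i != j -> j = oth i.
Proof. by move: i j; do 2!apply: I2P. Qed.

Lemma sum_oth (V : nmodType) (F : 'I_2 -> V) i : \sum_j F j = F i + F (oth i).
Proof. by rewrite sum_I2; move: i; apply: I2P => //; rewrite addrC. Qed.

Lemma det22 (K : comNzRingType) (A : 'M[K]_2) : \det A = A 0 0 * A 1 1 - A 0 1 * A 1 0.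
Proof.
rewrite (expand_det_row A 0) sum_I2 /cofactor !det_mx11 !mxE.
have l00 : lift 0 0 = 1 :> 'I_2 by apply: val_inj.
have l10 : lift 1 0 = 0 :> 'I_2 by apply: val_inj.
by rewrite !l00 !l10 /= expr0 expr1; ring.
Qed.

Lemma invmx22 (K : fieldType) (A : 'M[K]_2) i j : A \in unitmx ->
  invmx A (oth j) (oth i) = (-1) ^+ (i != j) * A i j / \det A.
Proof.
move=> uA; rewrite /invmx uA !mxE /cofactor det_mx11 !mxE mulrC; congr (_ / _).
have l00 : lift 0 0 = 1 :> 'I_2 by apply: val_inj.
have l10 : lift 1 0 = 0 :> 'I_2 by apply: val_inj.
by move: i j; do 2!apply: I2P; rewrite /oth /= ?l00 ?l10 //= expr2 mulrNN mulr1.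
Qed.

Section AxisOrder.
Variables (K : fieldType) (c : 'I_2).
Implicit Types (x y : fps K).

Definition axis_order n x := forall k, (k < n)%N -> x (ax c k) = 0.

Lemma axis_mul x y n : (x * y) (ax c n) = \sum_(t < n.+1) x (ax c t) * y (ax c (n - t)).
Proof.
rewrite fpsM; move: c; apply: I2P.
  rewrite ax0E mk0 mk1; apply: eq_bigr => t _.
  by rewrite big_ord1 !ax0E.
rewrite ax1E mk0 mk1 big_ord1; apply: eq_bigr => t _.
by rewrite !ax1E.
Qed.

Lemma axis_order_mul x y n n' : axis_order n x -> axis_order n' y ->
  axis_order (n + n') (x * y) /\
  (x * y) (ax c (n + n')) = x (ax c n) * y (ax c n').
Proof.
move=> hx hy; split=> [k kn|].
  rewrite axis_mul big1 // => t _; case: (ltnP t n) => tn; first by rewrite hx ?mul0r.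
  by rewrite (hy (k - t)%N) ?mulr0 //; have := ltn_ord t; lia.
have nn : (n < (n + n').+1)%N by lia.
rewrite axis_mul (bigD1 (Ordinal nn)) //= addKn big1 ?addr0 // => t.
rewrite -val_eqE /= neq_ltn => /orP[tn|tn]; first by rewrite hx ?mul0r.
by rewrite (hy (n + n' - t)%N) ?mulr0 //; have := ltn_ord t; lia.
Qed.

Lemma axis_order_exp x n k : axis_order n x ->
  axis_order (k * n) (x ^+ k) /\ (x ^+ k) (ax c (k * n)) = x (ax c n) ^+ k.
Proof.
move=> hx; elim: k => [|k [IH1 IH2]].
  split=> //; rewrite !expr0 mul0n (_ : (1 : fps K) _ = ps_one K (ax c 0)) //.
  by rewrite /ps_one ax_0 eqxx.
rewrite mulSn !exprS -IH2; exact: axis_order_mul.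
Qed.

End AxisOrder.

Section InverseLows.
Variables (K : fieldType).
Implicit Types (phi : pseries K 2) (G H : 'I_2 -> pseries K 2).

Lemma fpow_oth H (k : mon 2) j :
  fpow H (k 0) (k 1) = (H j : fps K) ^+ k j * (H (oth j) : fps K) ^+ k (oth j).
Proof. by move: j; apply: I2P => //; rewrite /fpow mulrC. Qed.

(** A monomial of degree at least two that involves the other variable
    contains a factor of order n and another factor, so its restriction to
    the axis has order larger than n; powers of x_j above q have order
    larger than q. *)
Lemma nonlin_axis phi H (c j : 'I_2) q n : centered H -> (0 < n <= q)%N -> (1 < q)%N ->
  (forall k, (k < q)%N -> phi (ax j k) = 0) -> axis_order c n (H (oth j)) ->
  nonlin phi H (ax c n) = (n == q)%:R * (phi (ax j q) * H j (ax c 1) ^+ q).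
Proof.
move=> cH /andP[n0 nq] q1 small ord.
have ordj : axis_order c 1 (H j) by case=> // _; rewrite ax_0 cH.
have zero (k : mon 2) : (0 < k (oth j))%N -> (1 < k 0%R + k 1%R)%N ->
    fpow H (k 0) (k 1) (ax c n) = 0.
  move=> kj kd; rewrite (fpow_oth _ _ j).
  have [h1 _] := axis_order_exp (k j) ordj.
  have [h2 _] := axis_order_exp (k (oth j)) ord.
  have [h3 _] := axis_order_mul h1 h2; apply: h3.
  have kE : (k 0%R + k 1%R = k j + k (oth j))%N by move: j {small ord ordj kj h1 h2}; apply: I2P => //; rewrite addnC.
  rewrite kE in kd; move: kd kj n0.
  move: (k j) (k (oth j)) => a b; rewrite muln1; clear; case: b => [//|b].
  rewrite mulSn => kd _ n0; case: a kd => [|a] kd; last by rewrite addSn ltnS addnCA leq_addr.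
  by case: b kd => // b _; rewrite add0n -{1}[n]addn0 ltn_add2l mulSn (leq_trans n0) // leq_addr.
have zero' k : (q <= k)%N -> k != n -> fpow H (ax j k 0) (ax j k 1) (ax c n) = 0.
  move=> qk kn; rewrite (fpow_oth _ _ j).
  rewrite !ffunE eqxx (negbTE (oth_neq j)) expr0 mulr1.
  have [h3 _] := axis_order_exp k ordj; apply: h3; lia.
have term (k : mon 2) : (1 < k 0%R + k 1%R)%N -> k != ax j q ->
   phi k * fpow H (k 0) (k 1) (ax c n) = 0.
  move=> kd kq; have [k0|kj] := posnP (k (oth j)); last by rewrite zero ?mulr0.
  have kE : k = ax j (k j).
    by apply/ffunP => i; rewrite ffunE; case: eqP => [->//|/eqP/neq_oth ij]; rewrite -(othK i) -ij.
  case: (ltnP (k j) q) => kq'; first by rewrite kE small ?mul0r.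
  rewrite kE zero' ?mulr0 //; apply: contraNneq kq => kn.
  by rewrite kE; apply/eqP; congr ax; lia.
rewrite /nonlin mon_deg_ax.
have F0 a b : (1 < a + b)%N -> mk a b != ax j q -> phi (mk a b) * fpow H a b (ax c n) = 0.
  by move=> ab; have := term (mk a b); rewrite mk0 mk1; apply.
have [e|nq'] := eqVneq n q; last first.
  rewrite mul0r big1 // => a _; rewrite big1 // => b ab.
  have [e|] := eqVneq (mk a b) (ax j q); last exact: F0.
  have := zero' q (leqnn q); rewrite -e mk0 mk1 => -> //; rewrite ?mulr0 //.
  by rewrite eq_sym.
subst n; rewrite mul1r.
have axq i : (ax j q i < q.+1)%N by rewrite ffunE; case: ifP.
pose a0 := Ordinal (axq 0); pose b0 := Ordinal (axq 1).
have ab0 : mk a0 b0 = ax j q by rewrite [RHS]mon2E.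
have ab1 : (1 < a0 + b0)%N by rewrite -(mon_deg_mk a0 b0) ab0 mon_deg_ax.
rewrite (bigD1 a0) //= (bigD1 b0) //= ab0 [X in _ + X + _]big1 ?addr0; last first.
  move=> b /andP[ab bn]; rewrite F0 //; apply: contraNneq bn => e; apply/eqP/val_inj.
  by move: e; rewrite -ab0 => /mk_inj[].
rewrite [X in _ + X]big1 ?addr0; last first.
  move=> a an; rewrite big1 // => b ab; rewrite F0 //; apply: contraNneq an => e; apply/eqP/val_inj.
  by move: e; rewrite -ab0 => /mk_inj[].
congr (_ * _); rewrite /= (fpow_oth _ _ j) !ffunE eqxx (negbTE (oth_neq j)) expr0 mulr1.
have [_] := axis_order_exp q ordj; by rewrite muln1.
Qed.

(** Let the row i of [G] have no monomial x_j^k with k < q. The coefficient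
    of n e_c in the identity G_i(H) = x_i, for the axis c other than i, then
    has only two contributions: the linear one of the other variable and,
    when n = q, the one of x_j^q. The former has to vanish for n < q. *)
Lemma inverse_axis_low G H i j q : inverse_germs G H -> (1 < q)%N ->
  (forall k, (k < q)%N -> G i (ax j k) = 0) ->
  axis_order (oth i) q (H (oth j)) /\
  G i (ax (oth j) 1) * H (oth j) (ax (oth i) q) =
    - (G i (ax j q) * H j (ax (oth i) 1) ^+ q).
Proof.
move=> GH' q1 small; have [cG cH GH _] := GH'.
have alpha : G i (ax (oth j) 1) * H (oth j) (ax (oth i) 0) = 0 by rewrite ax_0 cH mulr0.
have eqn n : (0 < n <= q)%N -> axis_order (oth i) n (H (oth j)) ->
   G i (ax (oth j) 1) * H (oth j) (ax (oth i) n) =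
    - ((n == q)%:R * (G i (ax j q) * H j (ax (oth i) 1) ^+ q)).
  move=> nq ord; apply/eqP; rewrite -addr_eq0; apply/eqP.
  rewrite -(nonlin_axis cH nq q1 small ord).
  have := GH i (ax (oth i) n); rewrite comp_split // (sum_oth _ j) small // mul0r add0r => ->.
  rewrite /ps_var; case: eqP => // /ffunP/(_ i); rewrite !ffunE eqxx.
  by rewrite eq_sym (negbTE (oth_neq i)).
have a0 : G i (ax (oth j) 1) != 0.
  apply/eqP => z; have := inverse_germs_lin GH' => /matrixP/(_ i i).
  rewrite !mxE eqxx (sum_oth _ j) !mxE z (small 1%N) // !mul0r addr0 => /eqP.
  by rewrite eq_sym oner_eq0.
have ord n : (n <= q)%N -> axis_order (oth i) n (H (oth j)).
  elim: n => [//|n IH] nq k; rewrite ltnS leq_eqVlt => /orP[/eqP ->|kn]; last first.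
    by apply: IH => //; exact: ltnW.
  case: n IH nq => [|n] IH nq; first by rewrite ax_0 cH.
  have := eqn n.+1 ltac:(lia) (IH ltac:(lia)).
  rewrite (_ : (n.+1 == q) = false) ?mul0r ?oppr0; last by lia.
  by move=> /eqP; rewrite mulf_eq0 (negbTE a0) => /eqP.
split; first exact: ord.
by have := eqn q ltac:(lia) (ord q (leqnn q)); rewrite eqxx mul1r.
Qed.

(** The linear part is triangular, so this entry of the inverse is the
    inverse of a single entry. *)
Lemma inverse_axis_linear G H i j : inverse_germs G H -> G i (ax j 1) = 0 ->
  G (oth i) (ax j 1) * H j (ax (oth i) 1) = 1.
Proof.
move=> GH z; have GB := inverse_germs_lin GH; have BG := mulmx1C GB.
have e1 := (matrixP _ _).2 GB (oth i) (oth i); have e2 := (matrixP _ _).2 GB i (oth i).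
have e3 := (matrixP _ _).2 GB i i.
rewrite !mxE eqxx (sum_oth _ j) !mxE in e1.
rewrite !mxE eqxx (sum_oth _ j) !mxE in e3.
rewrite !mxE (sum_oth _ j) !mxE in e2.
rewrite z mul0r add0r in e2; rewrite z mul0r add0r in e3.
rewrite eq_sym (negbTE (oth_neq i)) /= in e2.
have a0 : G i (ax (oth j) 1) != 0.
  apply/eqP => z'; move: e3; rewrite z' mul0r => /eqP.
  by rewrite eq_sym oner_eq0.
move/eqP: e2; rewrite mulf_eq0 (negbTE a0) /= => /eqP e2.
by rewrite e2 mulr0 addr0 in e1.
Qed.

End InverseLows.

Section InverseTrop.
Variables (R : realType) (K : fieldType) (nu : K -> \bar R).
Hypothesis hnu : is_valuation nu.
Implicit Types (phi : pseries K 2) (G H : 'I_2 -> pseries K 2).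
Implicit Types (l : 'I_2 -> 'I_2 -> low_term R).

(** The value for [None] only meets a factor q - 1 equal to 0, since q > 1
    forces the entry to be linear. *)
Definition lowval (o : low_term R) : R := if o is Some (_, a) then a else 0.

(** The lowest term of the k-th component of the inverse on the axis c,
    delta being the valuation of the determinant. For q = 1 it is the
    cofactor formula for a 2 x 2 matrix; for q > 1 it comes from
    [inverse_axis_low]. *)
Definition inv_low l (delta : R) (k c : 'I_2) : low_term R :=
  if l (oth c) (oth k) is Some (q, b)
  then Some (q, b - delta - (q%:R - 1) * lowval (l c (oth k))) else None.

Definition has_lows G l := forall i j, has_low nu (G i) j (l i j).

Definition linval (o : low_term R) : \bar R := if o is Some (1%N, a) then a%:E else +oo%E.

Definition det_val l : \bar R :=
  Order.min (linval (l 0%R 0%R) + linval (l 1%R 1%R))%E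
            (linval (l 0%R 1%R) + linval (l 1%R 0%R))%E.

Lemma has_low_linval phi j o : phi [ffun=> 0%N] = 0 -> has_low nu phi j o ->
  nu (phi (ax j 1)) = linval o.
Proof.
case: o => [[[|[|n]] a]|] p0 /=.
- by rewrite ax_0 p0 (nu0 hnu) => -[].
- by case.
- by case=> /(_ 1%N) -> // _; rewrite (nu0 hnu).
- by move=> ->; rewrite (nu0 hnu).
Qed.

Lemma row_linear G H l i : inverse_germs G H -> has_lows G l -> exists j, is_linear (l i j).
Proof.
move=> GH hl; have cG : centered G by case: GH.
have [j aj] : exists j, lin G i j != 0.
  apply/existsP; apply: contraT; rewrite negb_exists => /forallP h.
  have := (matrixP _ _).2 (inverse_germs_lin GH) i i.
  rewrite !mxE eqxx big1 => [/eqP|j _]; first by rewrite eq_sym oner_eq0.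
  by have := h j; rewrite negbK => /eqP ->; rewrite mul0r.
exists j; move: aj; rewrite mxE => aj.
have := has_low_linval (cG i) (hl i j); move: (nu_fin hnu aj).
by case: (l i j) => [[[|[|n]] a]|] //= h e; rewrite e in h.
Qed.

Lemma det_val_generic G l : centered G -> has_lows G l ->
  det_val l = Order.min (nu (G 0%R (ax 0%R 1)) + nu (G 1%R (ax 1%R 1)))%E
                        (nu (G 0%R (ax 1%R 1)) + nu (G 1%R (ax 0%R 1)))%E.
Proof. by move=> cG hl; rewrite !(has_low_linval (cG _) (hl _ _)). Qed.

Lemma nu_det_zero G i j : G i (ax j 1) = 0 ->
  nu (\det (lin G)) = (nu (G i (ax (oth j) 1%N)) + nu (G (oth i) (ax j 1%N)))%E.
Proof.
rewrite -(valM hnu) det22 !mxE.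
by move: i j; do 2!apply: I2P; rewrite /oth /= => ->;
  rewrite ?mul0r ?mulr0 ?subr0 ?sub0r ?(nuN hnu) // mulrC.
Qed.

(** For a linear term this is the cofactor formula. A term of exponent q > 1
    forces a zero in the linear part, whose determinant is then one product;
    [inverse_axis_low] and [inverse_axis_linear] give the valuations. *)
Lemma inverse_has_low G H l delta : inverse_germs G H -> has_lows G l ->
  nu (\det (lin G)) = delta%:E ->
  forall k c, has_low nu (H k) c (inv_low l delta k c).
Proof.
move=> GH hl hdet k c.
have [cG cH GHc _] := GH.
have [i ci] : exists i, c = oth i by exists (oth c); rewrite othK.
have [j kj] : exists j, k = oth j by exists (oth k); rewrite othK.
subst k c; rewrite /inv_low !othK.
have := hl i j; have := has_low_no_const hnu (cG i) (hl i j).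
case lij : (l i j) => [[q b]|] /= nc; last first.
  move=> z n; have [h _] := @inverse_axis_low K G H i j n.+2 GH isT (fun t _ => z t).
  by apply: h; lia.
case: q nc lij => [//|[|q]] _ lij [small hb].
  have /mulmx1_unit[uG _] := inverse_germs_lin GH.
  have HE : H (oth j) (ax (oth i) 1) = invmx (lin G) (oth j) (oth i).
    have -> : invmx (lin G) = lin H.
      by rewrite -[LHS]mulmx1 -(inverse_germs_lin GH) mulmxA mulVmx // mul1mx.
    by rewrite mxE.
  split; first by case=> // _; rewrite ax_0 cH.
  rewrite HE invmx22 // mxE !(valM hnu) hb (nuV hnu); last first.
    by apply: (nu_real hnu hdet).
  rewrite hdet subrr mul0r subr0.
  suff -> : nu ((-1) ^+ (i != j)) = 0%E by rewrite add0e.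
  by case: (i != j); rewrite ?expr1 ?expr0 ?(nuN hnu) (nu1 hnu).
have z1 : G i (ax j 1) = 0 by apply: small.
have [h1 h2] := @inverse_axis_low K G H i j q.+2 GH isT small.
have h3 := inverse_axis_linear GH z1.
split=> //.
have acj : G (oth i) (ax j 1) != 0.
  by apply/eqP => z; move: h3; rewrite z mul0r => /eqP; rewrite eq_sym oner_eq0.
have h0 : H j (ax (oth i) 1) != 0.
  by apply/eqP => z; move: h3; rewrite z mulr0 => /eqP; rewrite eq_sym oner_eq0.
have b0 := nu_real hnu hb.
have aik : G i (ax (oth j) 1) != 0.
  apply/eqP => z; move: h2; rewrite z mul0r => /eqP; rewrite eq_sym oppr_eq0 mulf_eq0.
  by rewrite (negbTE b0) expf_eq0 (negbTE h0) andbF.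
have H0 : H (oth j) (ax (oth i) q.+2) != 0.
  apply/eqP => z; move: h2; rewrite z mulr0 => /eqP; rewrite eq_sym oppr_eq0 mulf_eq0.
  by rewrite (negbTE b0) expf_eq0 (negbTE h0) andbF.
have lcj : nu (G (oth i) (ax j 1)) = (lowval (l (oth i) j))%:E.
  have := has_low_linval (cG (oth i)) (hl (oth i) j).
  by have := nu_fin hnu acj; case: (l _ _) => [[[|[|n]] a]|] //= h e; rewrite e in h.
have dE := nu_det_zero z1.
have e2 := congr1 nu h2; have e3 := congr1 nu h3.
rewrite (nuN hnu) (valM hnu (G i (ax (oth j) 1))) (valM hnu (G i (ax j q.+2))) (nuX hnu) hb in e2.
rewrite (valM hnu) (nu1 hnu) lcj in e3.
rewrite hdet lcj in dE.
move: e2 e3 dE; have := nu_fin hnu aik; have := nu_fin hnu h0; have := nu_fin hnu H0.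
case: (nu (H (oth j) _)) => [x||] //= _; case: (nu (H j _)) => [y||] //= _.
case: (nu (G i _)) => [z||] //= _.
move=> [e2] [e3] [->]; congr EFin.
rewrite (_ : y = - lowval (l (oth i) j)) in e2; last by lra.
have -> : x = (z + x) - z by ring.
by rewrite e2; ring.
Qed.

Lemma inverse_trop G H l delta : inverse_germs G H -> has_lows G l ->
  (forall i, convergent nu (G i)) -> nu (\det (lin G)) = delta%:E ->
  tropicalizes_to nu H (fun x => \row_k minform (inv_low l delta k) x).
Proof.
move=> GH hl conv hdet.
have cv := inverse_germs_convergent hnu GH conv.
have hlH := inverse_has_low GH hl hdet.
have [cG cH GHc HGc] := GH.
have HG : inverse_germs H G by [].
have h k := trop_minform hnu (cv k) (cH k) (hlH k) (row_linear k HG hlH).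
apply: filterS2 (h 0) (h 1) => x h0 h1; apply/rowP => k; rewrite !mxE.
by elim/I2P: k.
Qed.

End InverseTrop.

(** * Generic lifts *)

Lemma digits_uniq (B N : nat) (d d' : nat -> nat) :
  (forall t, (d t < B)%N) -> (forall t, (d' t < B)%N) ->
  (\sum_(t < N) d t * B ^ t = \sum_(t < N) d' t * B ^ t)%N ->
  forall t, (t < N)%N -> d t = d' t.
Proof.
elim: N d d' => [//|N IH] d d' hd hd'.
have B0 : (0 < B)%N by apply: leq_ltn_trans (hd 0%N).
have shift (e : nat -> nat) : (\sum_(t < N.+1) e t * B ^ t = (\sum_(t < N) e t.+1 * B ^ t) * B + e 0)%N.
  rewrite big_ord_recl expn0 muln1 addnC; congr addn; rewrite big_distrl.
  by apply: eq_bigr => t _; rewrite lift0 expnS [(B * _)%N]mulnC mulnA.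
rewrite !shift => e.
have e0 : d 0%N = d' 0%N.
  by have := congr1 (modn^~ B) e; rewrite !modnMDl !modn_small.
move: e; rewrite e0 => /addIn/eqP; rewrite eqn_pmul2r // => /eqP e.
case=> [//|t]; rewrite ltnS => tN.
exact: (IH (fun t => d t.+1) (fun t => d' t.+1)).
Qed.

(** Kronecker substitution: weights that are distinct powers of a base
    exceeding all the exponents separate monomials. *)
Lemma kronecker_inj n (c : 'I_n -> nat) (B : nat) (m m' : mon n) : injective c ->
  (forall j, (m j < B)%N) -> (forall j, (m' j < B)%N) ->
  (\sum_j m j * B ^ c j = \sum_j m' j * B ^ c j)%N -> m = m'.
Proof.
case: n c m m' => [|n] c m m' ci; first by move=> *; apply/ffunP => -[].
move=> hm hm' e; have B0 : (0 < B)%N by apply: leq_ltn_trans (hm 0).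
pose N := (\sum_j c j).+1.
have cN j : (c j < N)%N by rewrite /N ltnS (bigD1 j) //= leq_addr.
pose D (m : mon n.+1) t := (\sum_(j | c j == t) m j)%N.
have Dc (k : mon n.+1) j : D k (c j) = k j.
  by rewrite /D (big_pred1 j) // => i /=; apply: inj_eq.
have DB (k : mon n.+1) t : (forall j, (k j < B)%N) -> (D k t < B)%N.
  move=> hk; have [[j jt]|no] := pselect (exists j, c j = t); first by rewrite -jt Dc.
  by rewrite /D big_pred0 // => j; apply/eqP => jt; apply: no; exists j.
have DE (k : mon n.+1) : (\sum_j k j * B ^ c j = \sum_(t < N) D k t * B ^ t)%N.
  under [RHS]eq_bigr do rewrite /D big_distrl big_mkcond /=.
  rewrite exchange_big; apply: eq_bigr => j _.
  rewrite (bigD1 (Ordinal (cN j))) //= eqxx big1 ?addn0 // => t.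
  by rewrite -val_eqE /= eq_sym => /negbTE ->.
apply/ffunP => j; rewrite -!Dc.
move: e; rewrite !DE => e.
exact: (digits_uniq (fun t => DB m t hm) (fun t => DB m' t hm') e).
Qed.

Section GenericTheta.
Variables (R : realType) (K : closedFieldType) (nu : K -> \bar R).
Hypothesis hnu : is_valuation nu.
Local Open Scope ereal_scope.

Lemma nu_mul_eq0 x y : 0 <= nu x -> 0 <= nu y -> nu (x * y)%R = 0 -> nu x = 0 /\ nu y = 0.
Proof.
move=> hx hy; rewrite (valM hnu) => e; have : nu x + nu y <= 0 by rewrite e.
move: hx hy {e}; case: (nu x) => [a||] //; case: (nu y) => [b||] //.
by rewrite !lee_fin => *; split; congr EFin; lra.
Qed.

Lemma nu_prod_root theta (s : seq K) : 0 <= nu theta ->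
  (forall z, z \in s -> 0 <= nu z) ->
  nu (\prod_(z <- s) (theta - z))%R = 0 -> forall z, z \in s -> nu (theta - z)%R = 0.
Proof.
move=> t0; have d0 z : 0 <= nu z -> 0 <= nu (theta - z)%R.
  by move=> z0; apply: (nu_le_add hnu); rewrite ?(nuN hnu).
elim: s => [//|z s IH] h; rewrite big_cons => e.
have hz := h z (mem_head _ _).
have hs y : y \in s -> 0 <= nu y by move=> ys; apply: h; rewrite in_cons ys orbT.
have [e1 e2] : nu (theta - z)%R = 0 /\ nu (\prod_(z <- s) (theta - z))%R = 0.
  apply: nu_mul_eq0 => //; first exact: d0.
  elim: s hs {IH h e} => [|y s IH] hs; first by rewrite big_nil (nu1 hnu).
  rewrite big_cons (valM hnu) adde_ge0 //; first by apply/d0/hs/mem_head.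
  by apply: IH => t ts; apply: hs; rewrite in_cons ts orbT.
move=> y; rewrite in_cons => /orP[/eqP -> //|ys].
exact: IH.
Qed.

(** The polynomial prod (X - z) + 1, over 0 and the integral elements z of
    s, has a root theta. At theta the product is -1, so that all its factors
    are units. *)
Lemma unit_avoiding (s : seq K) : exists theta, nu theta = 0 /\
  forall z, z \in s -> nu (theta - z)%R <= 0 /\ nu (theta - z)%R <= nu z.
Proof.
(* Adding 0 to the list makes theta itself a unit. *)
pose s' := 0%R :: [seq z <- s | 0 <= nu z].
have s'0 z : z \in s' -> 0 <= nu z.
  by rewrite in_cons mem_filter => /orP[/eqP->|/andP[]//]; rewrite (nu0 hnu).
have [theta] : exists theta, root (\prod_(z <- s') ('X - z%:P) + 1)%R theta.
  apply/closed_rootP; rewrite size_polyDl size_prod_XsubC //.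
  by rewrite size_poly1.
rewrite /root hornerD hornerC horner_prod addr_eq0 => /eqP e.
have {}e : nu (\prod_(z <- s') (theta - z))%R = 0.
  rewrite -(nu1 hnu) -(nuN hnu 1%R) -e; congr nu; apply: eq_bigr => z _.
  by rewrite hornerXsubC.
have t0 : 0 <= nu theta.
  rewrite leNgt; apply/negP => tneg.
  have le0 (u : seq K) : (forall z, z \in u -> 0 <= nu z) ->
      nu (\prod_(z <- u) (theta - z))%R <= 0.
    elim: u => [|z u IH] hu; first by rewrite big_nil (nu1 hnu).
    rewrite big_cons (valM hnu) adde_le0 //; last first.
      by apply: IH => y yu; apply: hu; rewrite in_cons yu orbT.
    rewrite (nu_strict hnu) ?ltW // (nuN hnu).
    by apply: lt_le_trans tneg _; apply: hu; exact: mem_head.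
  have := le0 [seq z <- s | 0 <= nu z].
  move: e; rewrite big_cons subr0 (valM hnu) => e.
  have h z : z \in [seq z <- s | 0 <= nu z] -> 0 <= nu z by rewrite mem_filter => /andP[].
  move=> /(_ h) h'; have := lte_leD _ tneg h'; rewrite e adde0 ltxx.
  have tf : nu theta \is a fin_num by case: (nu theta) tneg (val_neqNy hnu theta).
  by rewrite /=; move: e tneg h'; case: (nu theta) tf => // r _; case: (nu _) => // t /eqP; rewrite -EFinD eqe !lee_fin lte_fin => /eqP; lra.
have d0 := nu_prod_root t0 s'0 e.
(* The elements of negative valuation dominate theta in the difference. *)
exists theta; split; first by have := d0 0%R (mem_head _ _); rewrite subr0.
move=> z zs; have [z0|zneg] := leP 0 (nu z).
  by rewrite d0 // in_cons mem_filter z0 zs orbT.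
rewrite addrC (nu_strict hnu) ?(nuN hnu) ?lexx ?ltW //.
exact: lt_le_trans zneg t0.
Qed.

(** By multiplicativity over the linear factors, such a theta gives the
    polynomial a value whose valuation is at most that of each coefficient. *)
Lemma prod_root_gauss theta (s : seq K) :
  (forall z, z \in s -> nu (theta - z)%R <= 0 /\ nu (theta - z)%R <= nu z) ->
  forall k, nu (\prod_(z <- s) (theta - z))%R <= nu (\prod_(z <- s) ('X - z%:P))%R`_k.
Proof.
elim: s => [|z s IH] h k.
  by rewrite !big_nil (nu1 hnu) coef1; case: (k == 0%N); rewrite ?(nu1 hnu) ?(nu0 hnu) ?leey.
have [h1 h2] := h z (mem_head _ _).
have {}IH := IH (fun y ys => h y (mem_behead (s := z :: s) ys)).
rewrite !big_cons (valM hnu) mulrBl coefB coefXM coefCM.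
apply: (nu_le_add hnu).
  case: k => [|k] /=; first by rewrite (nu0 hnu) leey.
  by rewrite -[leRHS]add0e leeD.
by rewrite (nuN hnu) (valM hnu) leeD.
Qed.

(** Over an algebraically closed field, a unit whose residue avoids the
    residues of the roots gives to each polynomial the valuation of its
    content. *)
Lemma gauss_value (Q1 Q2 : {poly K}) : exists theta, nu theta = 0 /\
  forall k, nu Q1.[theta] <= nu Q1`_k /\ nu Q2.[theta] <= nu Q2`_k.
Proof.
have [s1 e1] := closed_field_poly_normal Q1; have [s2 e2] := closed_field_poly_normal Q2.
have [theta [t0 ht]] := unit_avoiding (s1 ++ s2).
exists theta; split=> // k.
have main (Q : {poly K}) s : Q = (lead_coef Q *: \prod_(z <- s) ('X - z%:P))%R ->
    {subset s <= s1 ++ s2} -> nu Q.[theta] <= nu Q`_k.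
  move=> -> sub; rewrite hornerZ coefZ !(valM hnu) leeD //.
  rewrite horner_prod; under eq_bigr do rewrite hornerXsubC.
  by apply: prod_root_gauss => z /sub; exact: ht.
by split; [apply: main e1 _|apply: main e2 _] => z; rewrite mem_cat => ->; rewrite ?orbT.
Qed.

End GenericTheta.

Section GenericLift.
Variables (R : realType) (K : closedFieldType) (nu : K -> \bar R).
Hypothesis hnu : is_valuation nu.
Implicit Types (G : 'I_2 -> pseries K 2).
Local Open Scope ereal_scope.

Definition weight_exp (B : nat) (im : 'I_2 * mon 2) : nat := (B ^ pickle im)%N.

(** Multiplying the coefficients by powers of a unit changes no valuation;
    the exponents B^e, for a numbering e of the coefficients, are those of
    Kronecker substitution. *)
Definition scaled (theta : K) B G : 'I_2 -> pseries K 2 :=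
  fun i m => (theta ^+ weight_exp B (i, m) * G i m)%R.

Lemma nu_scaled theta B G i m : nu theta = 0 -> nu (scaled theta B G i m) = nu (G i m).
Proof. by move=> t0; rewrite (valM hnu) (nuX hnu) t0 mule0 add0e. Qed.

(** After scaling, the polynomial in the coefficients becomes a polynomial
    in theta in which distinct monomials have distinct exponents, so no
    cancellation occurs when theta realizes the minimum of the valuations of
    the coefficients. *)
Lemma generic_poly n (idx : 'I_n -> 'I_2 * mon 2) (S : seq (mon n)) (kappa : mon n -> K)
    G (B : nat) : injective idx -> uniq S -> (forall m j, m \in S -> (m j < B)%N) ->
  exists Q : {poly K}, forall theta, nu theta = 0 -> (forall k, nu Q.[theta] <= nu Q`_k) ->
    generic_for nu idx S kappa (scaled theta B G).
Proof.
move=> idxi uS SB.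
pose u j := G (idx j).1 (idx j).2.
pose C (m : mon n) := (kappa m * \prod_(j < n) u j ^+ m j)%R.
pose E (m : mon n) := (\sum_j m j * B ^ pickle (idx j))%N.
have Einj m m' : m \in S -> m' \in S -> E m = E m' -> m = m'.
  move=> mS mS'; apply: kronecker_inj => [|j|j]; [|exact: SB|exact: SB].
  exact: inj_comp (pcan_inj pickleK) idxi.
exists (\sum_(m <- S) C m *: 'X^(E m))%R => theta t0 hQ.
have coefQ m : m \in S -> (\sum_(m <- S) C m *: 'X^(E m))%R`_(E m) = C m.
  move=> mS; rewrite coef_sum (bigD1_seq m) //= coefZ coefXn eqxx mulr1.
  rewrite big_seq_cond big1 ?addr0 // => m' /andP[m'S mm].
  rewrite coefZ coefXn; case: eqP => [/Einj e|]; last by rewrite mulr0.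
  by rewrite (e mS m'S) eqxx in mm.
have hornerQ : (\sum_(m <- S) C m *: 'X^(E m))%R.[theta] =
    (\sum_(m <- S) kappa m * \prod_(j < n) (scaled theta B G (idx j).1 (idx j).2) ^+ m j)%R.
  rewrite horner_sum; apply: eq_bigr => m _; rewrite hornerZ hornerXn /C -mulrA; congr (_ * _)%R.
  under [in RHS]eq_bigr do rewrite /scaled exprMn -exprM.
  rewrite big_split /= mulrC; congr (_ * _)%R.
  rewrite /E -prodrXr; apply: eq_bigr => j _; rewrite mulnC /weight_exp.
  by case: (idx j).
have nuC m : nu (C m) = tterm (nu \o kappa) m
    (\row_j nu (scaled theta B G (idx j).1 (idx j).2)).
  rewrite /tterm /C (valM hnu); congr (_ + _).
  rewrite (big_morph nu (valM hnu) (nu1 hnu)); apply: eq_bigr => j _.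
  by rewrite mxE (nuX hnu) nu_scaled.
rewrite /generic_for -hornerQ; apply/eqP; rewrite eq_le; apply/andP; split.
  apply/ereal_infP => _ [m /= mS <-]; rewrite -nuC -(coefQ m mS); exact: hQ.
rewrite hornerQ big_seq; apply: (nu_le_sum hnu) => m mS.
apply: ereal_inf_lbound; exists m => //; rewrite -nuC /C !(valM hnu); congr (_ + _).
rewrite !(big_morph nu (valM hnu) (nu1 hnu)); apply: eq_bigr => j _.
by rewrite !(nuX hnu) nu_scaled.
Qed.

(** Two genericity conditions can be satisfied at once without changing the
    tropicalization. *)
Lemma generic_lift n1 idx1 S1 kappa1 n2 idx2 S2 kappa2 G :
  injective idx1 -> uniq S1 -> injective idx2 -> uniq S2 ->
  exists G', [/\ forall i m, nu (G' i m) = nu (G i m),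
    @generic_for R K nu 2 n1 idx1 S1 kappa1 G' & @generic_for R K nu 2 n2 idx2 S2 kappa2 G'].
Proof.
move=> i1 u1 i2 u2.
have bnd n (S : seq (mon n)) : exists B, forall m j, m \in S -> (m j < B)%N.
  exists (\sum_(m <- S) \sum_j m j).+1 => m j mS.
  by rewrite ltnS (big_rem m) //= (bigD1 j) //= -addnA leq_addr.
have [B1 h1] := bnd _ S1; have [B2 h2] := bnd _ S2.
have [|Q1 hQ1] := @generic_poly n1 idx1 S1 kappa1 G (B1 + B2) i1 u1.
  by move=> m j mS; apply: leq_trans (h1 _ _ mS) (leq_addr _ _).
have [|Q2 hQ2] := @generic_poly n2 idx2 S2 kappa2 G (B1 + B2) i2 u2.
  by move=> m j mS; apply: leq_trans (h2 _ _ mS) (leq_addl _ _).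
have [theta [t0 ht]] := gauss_value hnu Q1 Q2.
exists (scaled theta (B1 + B2) G); split.
- by move=> i m; exact: nu_scaled.
- by apply: hQ1 => // k; have [] := ht k.
- by apply: hQ2 => // k; have [] := ht k.
Qed.

End GenericLift.

(** * The canonical formal inverse *)

Section DetGeneric.
Variables (R : realType) (K : closedFieldType) (nu : K -> \bar R).
Hypothesis hnu : is_valuation nu.
Implicit Types (G : 'I_2 -> pseries K 2).

(** The linear coefficients, numbered row by row: the determinant u_0 u_3 -
    u_1 u_2 is the only condition that the lowest terms of the inverse
    require. *)
Definition det_idx (j : 'I_4) : 'I_2 * mon 2 :=
  (if (j < 2)%N then 0 else 1, ax (if odd j then 1 else 0) 1).
Definition det_mon1 : mon 4 := [ffun j => ((val j == 0) || (val j == 3)) : nat]%N.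
Definition det_mon2 : mon 4 := [ffun j => ((val j == 1) || (val j == 2)) : nat]%N.
Definition det_coef (m : mon 4) : K := if m == det_mon1 then 1 else -1.

Lemma det_mon12 : det_mon1 != det_mon2.
Proof. by apply/eqP => /ffunP/(_ 0); rewrite !ffunE. Qed.

Lemma det_idx_inj : injective det_idx.
Proof.
have axi i j : ax i 1 = ax j 1 -> i = j.
  by move=> /ffunP/(_ i); rewrite !ffunE eqxx; case: eqP.
move=> [i hi] [j hj] [h1 /axi h2]; apply: val_inj => /=.
by move: h1 h2; case: i hi => [|[|[|[|//]]]] hi; case: j hj => [|[|[|[|//]]]] hj.
Qed.

Lemma det_genericP G : generic_for nu det_idx [:: det_mon1; det_mon2] det_coef G ->
  nu (\det (lin G)) =
  Order.min (nu (G 0%R (ax 0%R 1)) + nu (G 1%R (ax 1%R 1)))%E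
            (nu (G 0%R (ax 1%R 1)) + nu (G 1%R (ax 0%R 1)))%E.
Proof.
have c1 : det_coef det_mon1 = 1 by rewrite /det_coef eqxx.
have c2 : det_coef det_mon2 = -1 by rewrite /det_coef eq_sym (negbTE det_mon12).
rewrite /generic_for !big_cons big_nil addr0 c1 c2 mul1r mulN1r.
rewrite !big_ord_recl !big_ord0 !ffunE /= !expr1 !expr0 !mulr1 !mul1r.
rewrite (_ : _ - _ = \det (lin G)); last by rewrite det22 !mxE.
move=> ->.
have t1 : tterm (nu \o det_coef) det_mon1 (\row_j nu (G (det_idx j).1 (det_idx j).2)) =
    (nu (G 0%R (ax 0%R 1)) + nu (G 1%R (ax 1%R 1)))%E.
  rewrite /tterm /= c1 (nu1 hnu) add0e !big_ord_recl big_ord0 !ffunE !mxE /=.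
  by rewrite !mul1e !mul0e !add0e adde0.
have t2 : tterm (nu \o det_coef) det_mon2 (\row_j nu (G (det_idx j).1 (det_idx j).2)) =
    (nu (G 0%R (ax 1%R 1)) + nu (G 1%R (ax 0%R 1)))%E.
  rewrite /tterm /= c2 (nuN hnu) (nu1 hnu) add0e !big_ord_recl big_ord0 !ffunE !mxE /=.
  by rewrite !mul1e !mul0e !add0e adde0.
apply/eqP; rewrite eq_le; apply/andP; split.
  rewrite le_min; apply/andP; split; apply: ereal_inf_lbound.
    by exists det_mon1; rewrite //= inE eqxx.
  by exists det_mon2; rewrite //= !inE eqxx orbT.
apply/ereal_infP => _ [m /= mS <-]; move: mS; rewrite !inE => /orP[/eqP->|/eqP->].
  by rewrite t1 ge_min lexx.
by rewrite t2 ge_min lexx orbT.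
Qed.

Implicit Types (l : 'I_2 -> 'I_2 -> low_term R) (f g : 'rV[\bar R]_2 -> 'rV[\bar R]_2).

Definition minmap l (x : 'rV[\bar R]_2) : 'rV[\bar R]_2 := \row_i minform (l i) x.

(** What a weakly non-degenerate germ retains of its lifts. *)
Definition germ_lows f l (delta : R) : Prop :=
  [/\ forall i j, no_const (l i j), \forall x \near tinf, f x = minmap l x,
      forall i, exists j, is_linear (l i j) & det_val l = delta%:E].

Lemma lift_has_lows f l delta G : germ_lows f l delta -> tropicalizes_to nu G f ->
  has_lows nu G l.
Proof.
move=> [wf h1 _ _] h2 i; apply: (minform_has_low hnu (wf i)).
by apply: filterS2 h1 h2 => x -> /(congr1 (fun y : 'rV__ => y 0 i)); rewrite !mxE.
Qed.

Lemma det_val_le G l : centered G -> has_lows nu G l -> (det_val l <= nu (\det (lin G)))%E.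
Proof.
move=> cG hl; rewrite (det_val_generic hnu cG hl) det22 !mxE.
apply: le_trans (valD hnu _ _); rewrite (nuN hnu) !(valM hnu) lexx //.
Qed.

(** The constant delta is real because the tropical determinant does not
    exceed the valuation of an invertible determinant. *)
Lemma germ_lows_exist f : tropical_germ f -> weakly_nondegenerate nu f ->
  exists l delta, germ_lows f l delta.
Proof.
move=> gf [G [[H GH] tG]].
have conv := tropicalizes_convergent hnu gf tG.
have [cG cH GHc HGc] := GH.
have /choice[l hl] : forall i, exists li, forall j, has_low nu (G i) j (li j).
  move=> i; have /choice[li hli] := has_low_exists hnu (G i).
  by exists li.
have lin := row_linear hnu _ GH hl.
exists l, (fine (det_val l)); split=> //.
- by move=> i j; apply: has_low_no_const (cG i) (hl i j).
- have h i := trop_minform hnu (conv i) (cG i) (hl i) (lin i).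
  apply: filterS3 tG (h 0) (h 1) => x <- h0 h1; apply/rowP => k; rewrite !mxE.
  by elim/I2P: k.
rewrite fineK // fin_numE; apply/andP; split.
  rewrite (det_val_generic hnu cG hl) /Order.min; case: ifP => _;
    by rewrite adde_eq_ninfty negb_or !(val_neqNy hnu).
have /mulmx1_unit[uG _] := inverse_germs_lin GH.
apply: contraTneq (det_val_le cG hl) => ->; rewrite -ltNge ltey_eq.
by rewrite (nu_fin hnu) //; move: uG; rewrite unitmxE unitfE.
Qed.

(** The determinant is the only place where a cancellation matters. *)
Lemma canonical_inverse_minmap f l delta : tropical_germ f -> germ_lows f l delta ->
  canonical_inverse nu f (minmap (inv_low l delta)).
Proof.
move=> gf hl; exists 4%N, det_idx, [:: det_mon1; det_mon2], det_coef; split.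
- exact: det_idx_inj.
- by rewrite /= inE det_mon12.
move=> G H GH tG /det_genericP gen.
have lows := lift_has_lows hl tG; have conv := tropicalizes_convergent hnu gf tG.
have [cG _ _ _] := GH.
apply: (inverse_trop hnu GH lows conv).
by rewrite gen -(det_val_generic hnu cG lows); case: hl.
Qed.

(** A lift satisfying both the given genericity condition and the one of the
    determinant has an inverse with both tropicalizations. *)
Lemma canonical_inverse_uniq f g l delta : tropical_germ f ->
  weakly_nondegenerate nu f -> germ_lows f l delta -> canonical_inverse nu f g ->
  \forall x \near tinf, g x = minmap (inv_low l delta) x.
Proof.
move=> gf [G [[H GH] tG]] hl [n [idx [S [kappa [idxi uS can]]]]].
have uD : uniq [:: det_mon1; det_mon2] by rewrite /= inE det_mon12.
have [G' [nuG gen gdet]] := generic_lift hnu kappa det_coef G idxi uS det_idx_inj uD.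
have [cG _ _ _] := GH.
have tG' : tropicalizes_to nu G' f.
  have e : trop nu G' = trop nu G.
    apply/funext => x; apply/rowP => i; rewrite !mxE; congr (teval _ x).
    by apply/funext => m /=; rewrite nuG.
  by rewrite /tropicalizes_to e.
have cG' : centered G'.
  by move=> i; apply/eqP; rewrite -(nu_eqy hnu) nuG (nu_eqy hnu) cG.
have lows := lift_has_lows hl tG'; have conv := tropicalizes_convergent hnu gf tG'.
have hdet : nu (\det (lin G')) = delta%:E.
  by rewrite (det_genericP gdet) -(det_val_generic hnu cG' lows); case: hl.
have uG' : lin G' \in unitmx by rewrite unitmxE unitfE (nu_real hnu hdet).
have [H' GH'] := inverse_germs_exists cG' uG'.
by apply: filterS2 (can G' H' GH' tG' gen) (inverse_trop hnu GH' lows conv hdet) => x <- ->.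
Qed.

End DetGeneric.

(** * Contracting germs *)

Section Contracting.
Variable R : realType.
Local Open Scope ereal_scope.

Lemma nbhs_ereal_gt (a y : \bar R) : a < y -> nbhs y [set t | a < t].
Proof. by move=> h; apply: open_nbhs_nbhs; split=> //; exact: open_ereal_gt_ereal. Qed.

Lemma nbhs_ereal_lt (a y : \bar R) : y < a -> nbhs y [set t | t < a].
Proof. by move=> h; apply: open_nbhs_nbhs; split=> //; exact: open_ereal_lt_ereal. Qed.

(** A filter clusters at the infimum of the suprema of its elements. *)
Lemma ereal_compact : compact [set: \bar R].
Proof.
move=> F FF _; pose p := ereal_inf [set ereal_sup A | A in F].
exists p; split=> // A B FA nB.
have above (b : \bar R) : p < b -> exists2 A0, F A0 & forall y, A0 y -> y < b.
  move=> /ereal_inf_lt[_ [A0 FA0 <-] sb]; exists A0 => // y Ay.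
  by apply: le_lt_trans sb; exact: ereal_sup_ubound.
have below (a : \bar R) A0 : F A0 -> a < p -> exists2 y, A0 y & a < y.
  move=> FA0 ap; have : a < ereal_sup A0.
    by apply: lt_le_trans ap _; apply: ereal_inf_lbound; exists A0.
  by move=> /ereal_sup_gt[y Ay ay]; exists y.
move: p nB above below => [r [e /= e0 eB]|[M [_ MB]]|[M [_ MB]]] above below.
- have [A0 FA0 h0] := above (r + e)%:E ltac:(by rewrite lte_fin ltrDl).
  have [y [Ay A0y] ye] := below (r - e)%:E _ (filterI FA FA0) ltac:(by rewrite lte_fin ltrBlDr ltrDl).
  have := h0 _ A0y; case: y Ay A0y ye => [y||] // Ay A0y; rewrite !lte_fin => y1 y2.
  exists y%:E; split=> //; apply: eB; rewrite /ball /= ltr_norml; lra.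
- have [y Ay yM] := below M%:E _ FA (ltry _).
  by exists y; split=> //; apply: MB.
- have [A0 FA0 h0] := above M%:E (ltNyr _).
  have [y [Ay A0y]] := filter_ex (filterI FA FA0).
  by exists y; split=> //; apply: MB; exact: h0.
Qed.

Lemma nbhs_rV n (x : 'rV[\bar R]_n) (P : 'I_n -> set (\bar R)) :
  (forall i, nbhs (x 0%R i) (P i)) -> nbhs x [set y | forall i, P i (y 0%R i)].
Proof.
move=> h; exists (fun _ i => P i) => [i j|y hy j]; first by rewrite (ord1 i).
exact: hy.
Qed.

(** The set where min_j (c_j + x_j) is less than r. *)
Definition below n (c : 'I_n -> R) (r : R) (x : 'rV[\bar R]_n) :=
  exists j, x 0%R j < (r - c j)%:E.

(** Let m be the infimum over V of min_j (c_j + x_j), where V contains the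
    closure of f(V). If f does not increase this function, f(V) has points
    where it is arbitrarily close to m, and by compactness a point z of the
    closure of f(V) attains it. As V is open and contains z, decreasing one
    coordinate of z inside V contradicts the definition of m. *)
Lemma contracting_not_below n (c : 'I_n.+1 -> R) (f : 'rV[\bar R]_n.+1 -> 'rV[\bar R]_n.+1) :
  contracting f -> (\forall x \near tinf, Tpt _ (f x)) ->
  (\forall x \near tinf, forall r, below c r x -> below c r (f x)) -> False.
Proof.
move=> contr /near_tinfP[M1 hT] /near_tinfP[M2 hle].
pose M : R := (`|M1| + `|M2|)%R.
have M1M : (M1 <= M)%R by rewrite /M; have := ler_norm M1; have := normr_ge0 M2; lra.
have M2M : (M2 <= M)%R by rewrite /M; have := ler_norm M2; have := normr_ge0 M1; lra.
have nU : nbhs tinf (far M : set 'rV[\bar R]_n.+1) by apply/near_tinfP; exists M.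
have [V [oV Vinf VU clV]] := contr _ nU.
have Vfar x : V x -> far M x by move=> /VU[].
have fVV x : V x -> V (f x).
  move=> Vx; apply: clV; split; first by apply: subset_closure; exists x.
  by apply: hT; apply: far_le (Vfar _ Vx).
pose I := [set r : R | exists2 x, V x & below c r x].
have I0 : I !=set0.
  have /near_tinfP[N hN] : nbhs tinf V by apply: open_nbhs_nbhs.
  exists (N + 1 + c 0 + 1)%R, (const_mx (N + 1)%:E).
    by apply: hN => i; rewrite mxE lte_fin; lra.
  by exists 0%R; rewrite mxE lte_fin; lra.
have Ilb : has_lbound I.
  exists (M - \sum_j `|c j|)%R => r [x /Vfar fx [j]] xr.
  have := lt_trans (fx j) xr; rewrite lte_fin => h.
  have : (- c j <= \sum_j `|c j|)%R.
    apply: le_trans (ler_norm _) _; rewrite normrN (bigD1 j) //= lerDl.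
    by apply: sumr_ge0.
  lra.
pose m := inf I.
have inf_le r : I r -> (m <= r)%R by move=> Ir; exact: ge_inf.
have mE e : (0 < e)%R -> exists2 x, V x & below c (m + e) (f x).
  move=> e0; have [r Ir rm] := @inf_adherent _ I e e0 (conj I0 Ilb).
  have [x Vx [j bx]] := Ir; exists x => //; apply: hle; first exact: far_le M2M (Vfar _ Vx).
  by exists j; apply: lt_trans bx _; rewrite lte_fin ltrD2r.
pose A (e : R) := [set y | (exists2 x, V x & f x = y) /\ below c (m + e) y].
(* The images of points where the function is less than m + e: their cluster
   points attain the infimum. *)
pose F := filter_from [set e : R | (0 < e)%R] A.
have FF : ProperFilter F.
  apply: filter_from_proper => [|e /= e0].
    apply: filter_from_filter; first by exists 1%R => /=.
    move=> e e' /= e0 e0'; exists (Num.min e e') => /=; first by rewrite lt_min e0.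
    move=> y [yf [j by_]]; split; split=> //; exists j; apply: lt_le_trans by_ _;
      by rewrite lee_fin lerD2r lerD2l ge_min lexx ?orbT.
  by have [x Vx bx] := mE e e0; exists (f x); split=> //; exists x.
have := @rV_compact (\bar R) n.+1 (fun=> setT) (fun=> ereal_compact) F FF.
case; first by exists 1%R => //=.
move=> z [_ clz].
have zcl : closure (f @` V) z.
  move=> B nB; have FA : F (A 1%R) by exists 1%R => //=.
  by have [y [[[x Vx fx] _] By]] := clz _ _ FA nB; exists y; split=> //; exists x.
have zM i : M%:E <= z 0%R i.
  rewrite leNgt; apply/negP => zi.
  pose Q (k : 'I_n.+1) : set (\bar R) := if k == i then [set t | t < M%:E] else setT.
  have nB : nbhs z [set y : 'rV[\bar R]_n.+1 | forall k, Q k (y 0%R k)].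
    by apply: (@nbhs_rV _ _ Q) => k; rewrite /Q; case: eqP => [->|_]; [exact: nbhs_ereal_lt|exact: filterT].
  have [y [[x Vx <-] /(_ i)]] := zcl _ nB; rewrite /Q eqxx /= => lt.
  by have := lt_trans (Vfar _ (fVV _ Vx) i) lt; rewrite ltxx.
have Vz : V z.
  apply: clV; split=> // i; apply: contraTneq (zM i) => ->.
  by rewrite -ltNge ltNyr.
have [j zj] : exists j, z 0%R j <= (m - c j)%:E.
  apply: contrapT => no.
  have /choice[e he] : forall j, exists e : R, (0 < e)%R /\ (m + e - c j)%:E < z 0%R j.
    move=> j; have : (m - c j)%:E < z 0%R j by rewrite ltNge; apply/negP => h; apply: no; exists j.
    case: (z 0%R j) => [t||] //; last by exists 1%R; rewrite ltry.
    rewrite lte_fin => h; exists ((t - (m - c j)) / 2)%R; rewrite lte_fin; split; lra.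
  have /= [e0 [e0p he0]] : exists e0 : R, (0 < e0)%R /\ forall j, (m + e0 - c j)%:E < z 0%R j.
    exists (\big[Num.min/1%R]_j e j); split.
      by elim/big_ind : _ => // [x y x0 y0|i _]; [rewrite lt_min x0|have [] := he i].
    move=> j; have [_ h] := he j; apply: le_lt_trans h; rewrite lee_fin lerD2r lerD2l.
    exact: bigmin_le.
  have nB : nbhs z [set y : 'rV[\bar R]_n.+1 | forall k, [set t | (m + e0 - c k)%:E < t] (y 0%R k)].
    by apply: (@nbhs_rV _ _ (fun k => [set t | (m + e0 - c k)%:E < t])) => k; exact: nbhs_ereal_gt.
  have FA : F (A e0) by exists e0.
  have [y [[_ [k yk]] /(_ k) /= yk']] := clz _ _ FA nB.
  by have := lt_trans yk yk'; rewrite ltxx.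
have nV : nbhs z V by apply: open_nbhs_nbhs.
have [P nP PV] := nV.
have [rho zrho] : exists rho : R, z 0%R j = rho%:E.
  move: (zM j) zj; case: (z 0%R j) => [t||] // _ _; by exists t.
have := nP 0%R j; rewrite zrho => -[e /= e0 eP].
(* The point z, with its minimizing coordinate decreased. *)
pose z' : 'rV[\bar R]_n.+1 := \row_k (if k == j then (rho - e / 2)%:E else z 0%R k).
have Vz' : V z'.
  apply: PV => i k; rewrite (ord1 i) mxE; case: eqP => [->|_].
    by apply: eP; rewrite /ball /= opprD addrA subrr sub0r opprK gtr0_norm; lra.
  by apply: nbhs_singleton; exact: nP.
rewrite zrho lee_fin in zj.
have : I (m - e / 4)%R.
  by exists z' => //; exists j; rewrite mxE eqxx lte_fin; lra.
by move=> /inf_le; lra.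
Qed.

End Contracting.

(** * Equal modifications force the normal forms *)

Section GraphPoints.
Variable R : realType.
Implicit Types (h : 'I_2 -> 'rV[\bar R]_2 -> \bar R).

Lemma xpart_xypoint (x y : 'rV[\bar R]_2) : xpart (xypoint x y) = x.
Proof. by rewrite /xpart /xypoint !row_mxKl. Qed.

Lemma ypart_xypoint (x y : 'rV[\bar R]_2) : ypart (xypoint x y) = y.
Proof.
apply/rowP => i; rewrite mxE /xypoint row_mxKl !row_mxKr !mxE.
by elim/I2P: i.
Qed.

Lemma xypointE (z : 'rV[\bar R]_(2 + 1 + 1)) : xypoint (xpart z) (ypart z) = z.
Proof.
rewrite -[RHS]hsubmxK -[lsubmx z in RHS]hsubmxK /xypoint /xpart; congr (row_mx (row_mx _ _) _).
  by apply/rowP => i; rewrite (ord1 i) !mxE.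
by apply/rowP => i; rewrite (ord1 i) !mxE.
Qed.

Lemma far_row_mx n p (M : R) (x : 'rV[\bar R]_n) (y : 'rV[\bar R]_p) :
  far M (row_mx x y) <-> far M x /\ far M y.
Proof.
split=> [h|[hx hy] i].
  split=> i; [have := h (lshift p i)|have := h (rshift n i)];
    by rewrite ?row_mxEl ?row_mxEr.
by rewrite mxE; case: (fintype.split i) => j.
Qed.

Lemma far_xypoint (M : R) (x y : 'rV[\bar R]_2) : far M (xypoint x y) <-> far M x /\ far M y.
Proof.
rewrite /xypoint !far_row_mx; split=> [[[hx h0] h1]|[hx hy]].
  split=> // i; elim/I2P: i; [have := h0 0|have := h1 0]; by rewrite mxE.
by split; [split|] => // i; rewrite mxE.
Qed.

(** The graph is always a part of the modification, and by
    [modification2_le] its lowest part. *)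
Lemma modification2_graph h x : Tpt 2 x ->
  support (modification2 h) (xypoint x (\row_i h i x)).
Proof.
by move=> Tx; rewrite /modification2 /= /xypoint !row_mxKl !row_mxKr !mxE; split; [split=> //; left|left].
Qed.

Lemma modification2_le h x y i : support (modification2 h) (xypoint x y) ->
  (h i x <= y 0%R i)%E.
Proof.
rewrite /modification2 /= /xypoint !row_mxKl !row_mxKr !mxE => -[[_ h0] h1].
by elim/I2P: i; [case: h0 => [->|[]]|case: h1 => [->|[]]]; rewrite ?lexx.
Qed.

(** The point of the graph of h above x lies in the other modification, so h
    is at least h' at x, and conversely. The growth assumptions keep the
    points of the graphs near infinity. *)
Lemma modification2_inj h h' :
  (forall M : R, \forall x \near tinf, forall i, (M%:E < h i x)%E) ->
  (forall M : R, \forall x \near tinf, forall i, (M%:E < h' i x)%E) ->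
  wset_eq_near_inf (modification2 h) (modification2 h') ->
  \forall x \near tinf, forall i, h i x = h' i x.
Proof.
move=> hc hc' /near_tinfP[M hM].
apply: filterS3 (near_far 2 M) (hc M) (hc' M) => x fM hx hx' i.
have Tx : Tpt 2 x by move=> j; exact: far_neqNy fM.
have s1 : support (modification2 h') (xypoint x (\row_i h i x)).
  have /hM[e _] : far M (xypoint x (\row_i h i x)).
    by apply/far_xypoint; split=> // j; rewrite mxE.
  by apply/e; exact: modification2_graph.
have s2 : support (modification2 h) (xypoint x (\row_i h' i x)).
  have /hM[e _] : far M (xypoint x (\row_i h' i x)).
    by apply/far_xypoint; split=> // j; rewrite mxE.
  by apply/e; exact: modification2_graph.
have := modification2_le i s1; have := modification2_le i s2; rewrite !mxE => e1 e2.
by apply/eqP; rewrite eq_le e1 e2.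
Qed.

End GraphPoints.

Section NormalForms.
Variable R : realType.
Implicit Types (o : low_term R) (l : 'I_2 -> low_term R).

Definition shift_low o (r : R) : low_term R := omap (fun na => (na.1, na.2 + r)) o.

Lemma aterm_shift o r (y : R) : (aterm o y%:E + r%:E)%E = aterm (shift_low o r) y%:E.
Proof. by case: o => [[n a]|] //=; congr EFin; ring. Qed.

Lemma aterm_far o M : no_const o -> exists N : R, forall y, (N%:E < y)%E -> (M%:E < aterm o y)%E.
Proof.
case: o => [[[|n] a]|] //= _; last by exists 0 => y _; exact: ltry.
exists (`|M| + `|a|) => -[y||] // h; last by rewrite gt0_muley ?lte_fin ?ltr0n // ltry.
rewrite lte_fin in h; rewrite lte_fin.
have m := ler_norm M; have m0 := normr_ge0 M.
have a1 := ler_norm (- a); have a0 := normr_ge0 a; rewrite normrN in a1.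
have n0 : 0 <= n%:R :> R by [].
rewrite -natr1; have : 0 <= n%:R * y by apply: mulr_ge0 => //; lra.
lra.
Qed.

Lemma minform_far l M : (forall j, no_const (l j)) ->
  \forall x \near tinf, (M%:E < minform l x)%E.
Proof.
move=> wf; have [N0 h0] := aterm_far M (wf 0); have [N1 h1] := aterm_far M (wf 1).
apply/near_tinfP; exists (`|N0| + `|N1|) => x fx; rewrite /minform lt_min; apply/andP.
by split; [apply: h0|apply: h1]; apply: le_lt_trans (fx _); rewrite lee_fin;
  have := ler_norm N0; have := ler_norm N1; have := normr_ge0 N0; have := normr_ge0 N1; lra.
Qed.

Lemma minform_inj l l' (r r' : R) : (forall j, no_const (l j)) -> (forall j, no_const (l' j)) ->
  (\forall x \near tinf, (minform l x + r%:E = minform l' x + r'%:E)%E) ->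
  forall j, shift_low (l j) r = shift_low (l' j) r'.
Proof.
move=> wf wf' /near_tinfP[M hM] j; apply: (@aterm_inj _ _ _ M) => y My.
rewrite -!aterm_shift -!minform_axpoint //; apply: hM; exact: far_axpoint.
Qed.

Lemma no_const_inv_low (l : 'I_2 -> 'I_2 -> low_term R) delta k c :
  (forall i j, no_const (l i j)) -> no_const (inv_low l delta k c).
Proof.
by move=> wf; rewrite /inv_low; case: (l _ _) (wf (oth c) (oth k)) => [[[|n] b]|].
Qed.

Lemma perm_I2 (s : {perm 'I_2}) : (forall i, s i = i) \/ (forall i, s i = oth i).
Proof.
have inj (e : s 0 = s 1) : False by have := perm_inj e.
have [s0|/neq_oth s0] := eqVneq (s 0) 0; [left|right]; apply: I2P => //.
- have [//|/neq_oth s1] := eqVneq (s 1) 1.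
  by case: inj; rewrite s0 -[RHS]othK -s1.
- by rewrite -[LHS]othK -s0.
- have [//|/neq_oth s1] := eqVneq (s 1) 0.
  by case: inj; rewrite -[LHS]othK -s0 -[RHS]othK -s1.
Qed.

(** The reorderings only matter through their quotient, which is the
    identity or the exchange of the two functions. *)
Lemma produces_lows (K : closedFieldType) (nu : K -> \bar R) (hnu : is_valuation nu) f
    (l : 'I_2 -> 'I_2 -> low_term R) delta :
  tropical_germ f -> weakly_nondegenerate nu f -> germ_lows f l delta ->
  produces_dynamical_system nu f ->
  exists (d : 'I_2 -> R), (forall r j, l r j = shift_low (inv_low l delta r j) (d r)) \/
    (forall r j, l r j = shift_low (inv_low l delta (oth r) j) (d r)).
Proof.
move=> gf wnd hl [g cg [s [t [a [b /= [XY _]]]]]].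
have [wf hf _ _] := hl.
have hg := canonical_inverse_uniq hnu gf wnd hl cg.
have wf' k c := no_const_inv_low delta k c wf.
have farR (l0 : 'I_2 -> 'I_2 -> low_term R) F (u : {perm 'I_2}) (v : 'rV[R]_2) :
    (forall i j, no_const (l0 i j)) -> (\forall x \near tinf, F x = minmap l0 x) ->
    forall M : R, \forall x \near tinf, forall i, (M%:E < renormalized F u v i x)%E.
  move=> w hF M; have h i := minform_far (M - v 0 i) (w (u i)).
  apply: filterS3 hF (h 0) (h 1) => x FE h0 h1 i.
  rewrite /renormalized FE mxE -lteBlDr // -EFinB.
  by elim/I2P: i.
have same := modification2_inj (farR _ _ s a wf hf) (farR _ _ t b wf' hg) XY.
have eqs i j : shift_low (l (s i) j) (a 0 i) = shift_low (inv_low l delta (t i) j) (b 0 i).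
  apply: minform_inj => //; apply: filterS3 same hf hg => x e fE gE.
  by have := e i; rewrite /renormalized fE gE !mxE.
exists (fun r => b 0 (s^-1 r)%g - a 0 (s^-1 r)%g).
have eqs' r j : l r j = shift_low (inv_low l delta ((s^-1 * t)%g r) j) (b 0 (s^-1 r)%g - a 0 (s^-1 r)%g).
  have := eqs (s^-1 r)%g j; rewrite permKV permM.
  case: (l r j) => [[n c]|]; case: (inv_low _ _ _ _) => [[n' c']|] //= [-> e].
  by congr (Some (_, _)); lra.
by have [st|st] := perm_I2 (s^-1 * t)%g; [left|right] => r j; rewrite eqs' st.
Qed.

Definition ecoef o : \bar R := if o is Some (_, a) then a%:E else +oo%E.
Definition expo o : option nat := if o is Some (n, _) then Some n else None.

Lemma ecoef_neqNy o : ecoef o != -oo%E. Proof. by case: o => [[n a]|]. Qed.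

Definition linear_or_none o := (o == None :> option (nat * R)) || is_linear o.

Lemma ecoef_linear o (y : \bar R) : linear_or_none o -> y != -oo%E ->
  (ecoef o + y = aterm o y)%E.
Proof.
by case: o => [[[|[|n]] a]|] //= _ yN; rewrite ?mul1e // addye.
Qed.

Lemma germ_lows_normal_form (l : 'I_2 -> 'I_2 -> low_term R) f a1 a2 b1 b2 p q :
  (\forall x \near tinf, f x = minmap l x) ->
  linear_or_none (l 0 0) -> linear_or_none (l 1 1) ->
  a1 = ecoef (l 0 0) -> b2 = ecoef (l 1 1) ->
  p = expo (l 0 1) -> q = expo (l 1 0) ->
  (p != None -> a2 = ecoef (l 0 1)) -> (q != None -> b1 = ecoef (l 1 0)) ->
  \forall x \near tinf, f x = normal_form a1 a2 b1 b2 p q x.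
Proof.
move=> hf l00 l11 -> -> pE qE h2 h1; apply: filterS2 hf (near_Tpt R 2) => x -> N.
apply/rowP => i; rewrite !mxE.
have A (o : low_term R) c r y : r = expo o -> (r != None -> c = ecoef o) ->
    affine_term c r y = aterm o y.
  by move=> ->; case: o => [[n a]|] //= ->.
elim/I2P: i => /=.
  by rewrite ecoef_linear // (A _ _ _ _ pE h2).
by rewrite ecoef_linear // (A _ _ _ _ qE h1).
Qed.

End NormalForms.

Section Necessity.
Variables (R : realType) (K : closedFieldType) (nu : K -> \bar R).
Hypothesis hnu : is_valuation nu.

Definition normal_cases (a1 a2 b1 b2 : \bar R) (p2 q1 : option nat) :=
  [\/ [/\ p2 = Some 1%N \/ p2 = None,
                q1 = Some 1%N \/ q1 = None
              & (a2 = +oo%E /\ b1 = +oo%E) \/ a1 = b2],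
            [/\ [/\ a1 \is a fin_num, a2 \is a fin_num,
                    b1 \is a fin_num & b2 \is a fin_num],
                p2 = None
              & exists2 q : nat, q1 = Some q /\ (1 < q)%N
                               & b2 = (q%:R%:E * a1)%E]
          | [/\ [/\ a1 \is a fin_num, a2 \is a fin_num,
                    b1 \is a fin_num & b2 \is a fin_num],
                q1 = None
              & exists2 p : nat, p2 = Some p /\ (1 < p)%N
                               & a1 = (p%:R%:E * b2)%E]].

Lemma contracting_minmap (f : 'rV[\bar R]_2 -> 'rV[\bar R]_2) l delta (c : 'I_2 -> R) :
  contracting f -> germ_lows f l delta ->
  (forall x, Tpt 2 x -> forall r, below c r x -> below c r (minmap l x)) -> False.
Proof.
move=> contr [wf hf _ _] hc; apply: (contracting_not_below contr (c := c)).
  apply: filterS3 hf (minform_far 0 (wf 0)) (minform_far 0 (wf 1)) => x -> h0 h1 i.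
  rewrite mxE; suff : (0%:E < minform (l i) x)%E by case: (minform _ _).
  by elim/I2P: i.
by apply: filterS2 hf (near_Tpt R 2) => x -> Tx r; exact: hc.
Qed.

(** The condition l = (lowest terms of the inverse) + constants is made
    explicit in each of four cases: equality with or without exchange of the
    two functions, and a diagonal or antidiagonal product in the
    determinant. Comparing the entries in one row eliminates the unknown
    constants. *)
Lemma necessity f : tropical_germ f -> weakly_nondegenerate nu f -> contracting f ->
  produces_dynamical_system nu f ->
  exists (a1 a2 b1 b2 : \bar R) (p2 q1 : option nat),
    [/\ [/\ a1 != -oo%E, a2 != -oo%E, b1 != -oo%E & b2 != -oo%E],
        \forall x \near tinf, f x = normal_form a1 a2 b1 b2 p2 q1 x
      & normal_cases a1 a2 b1 b2 p2 q1].
Proof.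
move=> gf wnd contr pds.
have [l [delta hl]] := germ_lows_exist hnu gf wnd.
have [d hd] := produces_lows hnu gf wnd hl pds.
have [wf hf lin hdet] := hl.
have N := @ecoef_neqNy R.
(* If f_i <= x_i for both i, or f_0 <= a + x_1 and f_1 <= x_0 - a, then f
   does not increase min (x_0, x_1), resp. min (x_0, a + x_1). *)
have contrA : l 0 0 = Some (1%N, 0) -> l 1 1 = Some (1%N, 0) -> False.
  move=> l00 l11; apply: (contracting_minmap (c := fun=> 0) contr hl) => x Tx r [j xj].
  exists j; rewrite mxE; apply: le_lt_trans (minform_le _ _ j) _.
  by elim/I2P: j xj => xj; rewrite ?l00 ?l11 /= add0e mul1e.
have contrB a b : l 0 1 = Some (1%N, a) -> l 1 0 = Some (1%N, b) -> a + b = 0 -> False.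
  move=> l01 l10 ab.
  apply: (contracting_minmap (c := fun i => if i == 0 then 0 else a) contr hl) => x Tx r [j].
  elim/I2P: j => /= xj; [exists 1|exists 0]; rewrite mxE /=.
    apply: le_lt_trans (minform_le _ _ 0) _; rewrite l10 /= mul1e.
    move: xj (Tx 0); case: (x _ _) => [t||] //; rewrite !lte_fin => *; lra.
  apply: le_lt_trans (minform_le _ _ 1) _; rewrite l01 /= mul1e.
  move: xj (Tx 1); case: (x _ _) => [t||] //; rewrite !lte_fin => *; lra.
have nform := germ_lows_normal_form hf.
have wf00 := wf 0 0; have wf01 := wf 0 1; have wf10 := wf 1 0; have wf11 := wf 1 1.
have inv k c : inv_low l delta k c = if l (oth c) (oth k) is Some (q, b)
  then Some (q, b - delta - (q%:R - 1) * lowval (l c (oth k))) else None by [].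
have det : (is_linear (l 0 0) && is_linear (l 1 1)) || (is_linear (l 0 1) && is_linear (l 1 0)).
  move: hdet; rewrite /det_val /linval.
  case: (l 0 0) => [[[|[|n]] a]|]; case: (l 1 1) => [[[|[|n']] a']|] //=;
  case: (l 0 1) => [[[|[|n1]] a1]|]; case: (l 1 0) => [[[|[|n2]] a2]|] //=;
  by rewrite ?miney.
have fin2 (x : R) : x%:E \is a fin_num by [].
case: hd => hd; have e00 := hd 0 0; have e01 := hd 0 1; have e10 := hd 1 0; have e11 := hd 1 1;
  rewrite inv /oth /= in e00; rewrite inv /oth /= in e01; rewrite inv /oth /= in e10;
  rewrite inv /oth /= in e11; case/orP: det => /andP[/is_linearP[u lu] /is_linearP[v lv]].
(* f_i is g_i up to a constant, and the diagonal product is finite *)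
- rewrite lu lv /= in e00 e11 contrA.
  case: e00 => e00; case: e11 => e11.
  case l01: (l 0 1) e01 => [[p w]|] /= e01; case l10: (l 1 0) e10 => [[q z]|] /= e10.
  + rewrite lv /= in e01; rewrite lu /= in e10; case: e01 => e01; case: e10 => e10.
    have E1 : u = p%:R * v by lra.
    have E2 : v = q%:R * u by lra.
    have [/andP[/eqP p1 /eqP q1]|pq1] := boolP ((p == 1%N) && (q == 1%N)).
      exists u%:E, w%:E, z%:E, v%:E, (Some 1%N), (Some 1%N); split=> //.
        by apply: nform; rewrite /linear_or_none ?lu ?lv ?l01 ?l10 ?p1 ?q1.
      by constructor 1; split; [left|left|right; rewrite E1 p1 mul1r].
    have pq : (1 < p * q)%N.
      move: wf01 wf10 pq1; rewrite l01 l10; case: p {e01 E1 l01} => [|[|p]] //; case: q {e10 E2 l10} => [|[|q]] //.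
    have u0 : u = 0.
      have : u * ((p * q)%:R - 1) = 0.
        have -> : u * ((p * q)%:R - 1) = p%:R * (q%:R * u) - u by rewrite natrM; ring.
        by rewrite -E2 -E1 subrr.
      move/eqP; rewrite mulf_eq0 subr_eq0 pnatr_eq1 => /orP[/eqP//|/eqP e].
      by rewrite e in pq.
    by case: contrA; rewrite ?E2 u0 ?mulr0.
  + rewrite lv /= in e01; case: e01 => e01.
    have E1 : u = p%:R * v by lra.
    have [p1|p1] := eqVneq p 1%N.
      exists u%:E, w%:E, +oo%E, v%:E, (Some 1%N), None; split=> //.
        by apply: nform; rewrite /linear_or_none ?lu ?lv ?l01 ?l10 ?p1.
      by constructor 1; split; [left|right|right; rewrite E1 p1 mul1r].
    (* The coefficient attached to an absent term is arbitrary; it is taken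
       real. *)
    exists u%:E, w%:E, 0%:E, v%:E, (Some p), None; split=> //.
      by apply: nform; rewrite /linear_or_none ?lu ?lv ?l01 ?l10.
    constructor 3; split=> //; exists p; last by rewrite E1.
    by split=> //; move: wf01 p1; rewrite l01; case: p {e01 E1 l01} => [|[|p]].
  + rewrite lu /= in e10; case: e10 => e10.
    have E2 : v = q%:R * u by lra.
    have [q1|q1] := eqVneq q 1%N.
      exists u%:E, +oo%E, z%:E, v%:E, None, (Some 1%N); split=> //.
        by apply: nform; rewrite /linear_or_none ?lu ?lv ?l01 ?l10 ?q1.
      by constructor 1; split; [right|left|right; rewrite E2 q1 mul1r].
    exists u%:E, 0%:E, z%:E, v%:E, None, (Some q); split=> //.
      by apply: nform; rewrite /linear_or_none ?lu ?lv ?l01 ?l10.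
    constructor 2; split=> //; exists q; last by rewrite E2.
    by split=> //; move: wf10 q1; rewrite l10; case: q {e10 E2 l10} => [|[|q]].
  + exists u%:E, +oo%E, +oo%E, v%:E, None, None; split=> //.
      by apply: nform; rewrite /linear_or_none ?lu ?lv ?l01 ?l10.
    by constructor 1; split; [right|right|left].
- rewrite lu lv /= in e01 e10.
  case: e01 => e01; case: e10 => e10.
  case l00: (l 0 0) e00 => [[p w]|] /= e00; case l11: (l 1 1) e11 => [[q z]|] /= e11;
    rewrite ?l00 ?l11 ?lu ?lv //= in e00 e11 e01 e10.
  + case: e00 => pq e00; case: e11 => _ e11; subst q.
    have [p1|p1] := eqVneq p 1%N.
      subst p; exists w%:E, u%:E, v%:E, z%:E, (Some 1%N), (Some 1%N); split=> //.
        by apply: nform; rewrite /linear_or_none ?lu ?lv ?l00 ?l11.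
      by constructor 1; split; [left|left|right; congr EFin; lra].
    exfalso; apply: (contrB u v lu lv).
    have : (p%:R - 1) * (u + v) = 0 by lra.
    move/eqP; rewrite mulf_eq0 subr_eq0 pnatr_eq1 => /orP[/eqP e|/eqP//].
    by rewrite e in p1.
  + exists +oo%E, u%:E, v%:E, +oo%E, (Some 1%N), (Some 1%N); split=> //.
      by apply: nform; rewrite /linear_or_none ?lu ?lv ?l00 ?l11.
    by constructor 1; split; [left|left|right].
(* f_i is g_j up to a constant, with j <> i *)
- rewrite lu lv /= in e00 e11 e01 e10.
  case l10: (l 1 0) e00 e10 => [[q z]|] //= [q1 e00] e10; subst q.
  case l01: (l 0 1) e01 e11 => [[p w]|] //= [p1 e01] e11; subst p.
  rewrite ?lu ?lv ?l01 ?l10 /= in e10 e11; case: e10 => e10; case: e11 => e11.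
  exists u%:E, w%:E, z%:E, v%:E, (Some 1%N), (Some 1%N); split=> //.
    by apply: nform; rewrite /linear_or_none ?lu ?lv ?l01 ?l10.
  constructor 1; split; [by left|by left|right; congr EFin; lra].
- rewrite lu lv /= in e00 e11 e01 e10.
  case l00: (l 0 0) e00 e01 => [[p w]|] //= e00 [p1 e01]; subst p.
  case l11: (l 1 1) e11 e10 => [[q z]|] //= e11 [q1 e10]; subst q.
  rewrite ?lu ?lv ?l00 ?l11 /= in e00 e11; case: e00 => e00; case: e11 => e11.
  exists w%:E, u%:E, v%:E, z%:E, (Some 1%N), (Some 1%N); split=> //.
    by apply: nform; rewrite /linear_or_none ?lu ?lv ?l00 ?l11.
  constructor 1; split; [by left|by left|right; congr EFin; lra].
Qed.

End Necessity.

(** * Locality and continuity *)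

Section Locality.
Variable R : realType.

Lemma far_lsubmx n (M : R) (z : 'rV[\bar R]_(n + 1)) : far M z -> far M (lsubmx z).
Proof. by move=> fz i; rewrite mxE. Qed.

Lemma near_far_emb n (M : R) (p : 'rV[R]_n) : far M (emb p) -> \forall y \near p, far M (emb y).
Proof.
move=> fp; exists (fun _ i => [set t | M < t]) => [i j|y hy i].
  rewrite (ord1 i); apply: open_nbhs_nbhs; split; first exact: open_gt.
  by have := fp j; rewrite mxE lte_fin.
by rewrite mxE lte_fin; exact: hy.
Qed.

Lemma nbhs_far n (M : R) (x : 'rV[\bar R]_n) : far M x -> nbhs x (far M).
Proof.
by move=> fx; apply: (@nbhs_rV _ _ _ (fun _ => [set t | (M%:E < t)%E])) => i; exact: nbhs_ereal_gt.
Qed.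

Lemma closure_local (T : topologicalType) (A B U : set T) x : nbhs x U ->
  (forall y, U y -> A y -> B y) -> closure A x -> closure B x.
Proof.
move=> nU AB clA W nW; have [y [Ay [Wy Uy]]] := clA _ (filterI nW nU).
by exists y; split=> //; apply: AB.
Qed.

(** Equality of the data of two modifications at a point; modifications
    depend on their data only locally. *)
Definition same_at n (V V' : wset R n) (P P' : 'rV[\bar R]_n -> \bar R) (x : 'rV[\bar R]_n) :=
  [/\ support V x <-> support V' x, forall w, weight V x w <-> weight V' x w & P x = P' x].

Lemma same_at_sym n (V V' : wset R n) P P' x : same_at V V' P P' x -> same_at V' V P' P x.
Proof. by move=> [h1 h2 h3]; split=> //; [rewrite h1|move=> w; rewrite h2]. Qed.

Lemma restoring_weight_local k n (V V' : wset R n) P P' p omega :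
  (\forall y \near p, same_at V V' P P' (emb y)) ->
  restoring_weight k V P p omega -> restoring_weight k V' P' p omega.
Proof.
move=> same [B [lam [r [v [w [s [star bal]]]]]]].
exists B, lam, r, v, w, s; split=> //.
have [[Vp Pp] basis w0 hV hP] := star.
have [sp _ Pp'] := nbhs_singleton same.
split=> //; first by split; [exact/sp|rewrite -Pp'].
  by apply: filterS2 same hV => y [<- _ _].
apply: filterS2 same hP => y [_ sw sP] h i c t t0 yE.
have [h1 h2] := h i c t t0 yE; rewrite -sP -Pp'; split=> // tp.
exact/sw/h2.
Qed.

Lemma modification_local k n (V V' : wset R n) P P' (M : R) :
  (forall x, far M x -> same_at V V' P P' x) ->
  forall z, far M z ->
    (support (modification k V P) z <-> support (modification k V' P') z) /\
    (forall w, weight (modification k V P) z w <-> weight (modification k V' P') z w).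
Proof.
have restoring (V0 V0' : wset R n) P0 P0' p w : (forall x, far M x -> same_at V0 V0' P0 P0' x) ->
    far M (emb p) -> restoring_weight k V0 P0 p w -> restoring_weight k V0' P0' p w.
  move=> same /near_far_emb np; apply: restoring_weight_local.
  by apply: filterS np => y; exact: same.
have impl (V0 V0' : wset R n) P0 P0' : (forall x, far M x -> same_at V0 V0' P0 P0' x) ->
    forall z, far M z ->
    (support (modification k V0 P0) z -> support (modification k V0' P0') z) /\
    (forall w, weight (modification k V0 P0) z w -> weight (modification k V0' P0') z w).
  move=> same z fz; have fl := far_lsubmx fz; have [h1 h2 h3] := same _ fl.
  split=> [[/h1 s1]|w].
    rewrite h3 => s2; split=> //; case: s2 => [e|[cl le]]; [by left|right; split=> //].
    apply: closure_local (nbhs_far fl) _ cl => y fy [p [om [yE om0 rw]]].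
    by exists p, om; split=> //; apply: (restoring V0 V0' P0 P0') => //; rewrite -yE.
  case=> [[e /h2 wl]|[ne [p pE rw]]]; [left|right]; rewrite -h3; split=> //.
  by exists p => //; apply: (restoring V0 V0' P0 P0') => //; rewrite -pE.
move=> same z fz.
have [a1 a2] := impl V V' P P' same z fz.
have [b1 b2] := impl V' V P' P (fun x fx => same_at_sym (same x fx)) z fz.
by split=> [|w]; split; auto.
Qed.

Lemma modification2_local (h h' : 'I_2 -> 'rV[\bar R]_2 -> \bar R) (M : R) :
  (forall x, far M x -> forall i, h i x = h' i x) ->
  forall z, far M z ->
    (support (modification2 h) z <-> support (modification2 h') z) /\
    (forall w, weight (modification2 h) z w <-> weight (modification2 h') z w).
Proof.
move=> hh'; apply: modification_local => z fz.
have fl := far_lsubmx fz.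
have [h1 h2] : (support (modification 1 (@tplane R) (h 0)) z <->
    support (modification 1 (@tplane R) (h' 0)) z) /\
  (forall w, weight (modification 1 (@tplane R) (h 0)) z w <->
     weight (modification 1 (@tplane R) (h' 0)) z w).
  by apply: (@modification_local 1 2 _ _ (h 0) (h' 0) M _ z fz) => x fx; split=> //; exact: hh'.
by split=> //=; exact: hh'.
Qed.

End Locality.

Section Continuity.
Variable R : realType.

(** The extended reals are separated: equality of continuous functions is a
    closed condition. *)
Lemma closure_eq (T : topologicalType) (F1 F2 : T -> \bar R) x :
  F1 y @[y --> x] --> F1 x -> F2 y @[y --> x] --> F2 x ->
  closure [set y | F1 y = F2 y] x -> F1 x = F2 x.
Proof.
move=> c1 c2 cl; apply: ereal_hausdorff => A B nA nB.
have n1 : nbhs x (F1 @^-1` A) by exact: c1.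
have n2 : nbhs x (F2 @^-1` B) by exact: c2.
have [y [/= e [Ay By]]] := cl _ (filterI n1 n2).
by exists (F1 y); split=> //; rewrite e.
Qed.

Lemma coord_cvg n (x : 'rV[\bar R]_n) i : y 0 i @[y --> x] --> x 0 i.
Proof.
move=> A nA; exists (fun _ j => if j == i then A else setT) => [k j|y hy].
  by rewrite (ord1 k); case: eqP => [->//|_]; exact: filterT.
by have := hy 0 i; rewrite eqxx.
Qed.

Lemma aterm_cvg (T : topologicalType) (F : T -> \bar R) x o :
  F y @[y --> x] --> F x -> aterm o (F y) @[y --> x] --> aterm o (F x).
Proof.
case: o => [[n a]|] c /=; last exact: cvg_cst.
apply: cvgeD; first by rewrite fin_num_adde_defr.
  exact: cvg_cst.
by apply: cvgeZl => //.
Qed.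

Lemma cvg_preimage (T : topologicalType) (F : T -> \bar R) x A :
  F y @[y --> x] --> F x -> nbhs (F x) A -> nbhs x (F @^-1` A).
Proof. by move=> c nA; exact: c. Qed.

Lemma near_lt (T : topologicalType) (F1 F2 : T -> \bar R) x :
  F1 y @[y --> x] --> F1 x -> F2 y @[y --> x] --> F2 x ->
  (F1 x < F2 x)%E -> \forall y \near x, (F1 y < F2 y)%E.
Proof.
move=> c1 c2 ab.
have [[c [ac cb]]|no] := pselect (exists c, (F1 x < c)%E /\ (c < F2 x)%E).
  apply: filterS2 (cvg_preimage c1 (nbhs_ereal_lt ac)) (cvg_preimage c2 (nbhs_ereal_gt cb)).
  by move=> y /= h1 h2; apply: lt_trans h1 h2.
apply: filterS2 (cvg_preimage c1 (nbhs_ereal_lt ab)) (cvg_preimage c2 (nbhs_ereal_gt ab)).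
move=> y /= h1 h2; case: (ltP (F1 x) (F1 y)) => h3.
  by case: no; exists (F1 y).
exact: le_lt_trans h3 h2.
Qed.

(** The minimum is continuous at a point where the arguments differ because
    it is locally one of them, and at a point of equality because both have
    the same limit. *)
Lemma min_cvg (T : topologicalType) (F1 F2 : T -> \bar R) x :
  F1 y @[y --> x] --> F1 x -> F2 y @[y --> x] --> F2 x ->
  Order.min (F1 y) (F2 y) @[y --> x] --> Order.min (F1 x) (F2 x).
Proof.
move=> c1 c2; case: (ltgtP (F1 x) (F2 x)) => h A nA.
- by apply: filterS2 (near_lt c1 c2 h) (cvg_preimage c1 nA) => y /= l Ay; rewrite /Order.min l.
- by apply: filterS2 (near_lt c2 c1 h) (cvg_preimage c2 nA) => y /= l Ay; rewrite /Order.min ltNge (ltW l).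
have nA2 : nbhs (F2 x) A by rewrite -h.
apply: filterS2 (cvg_preimage c1 nA) (cvg_preimage c2 nA2) => y /= h1 h2.
by rewrite /Order.min; case: ifP.
Qed.

Lemma minform_cvg (T : topologicalType) (F : T -> 'rV[\bar R]_2) x l :
  (forall i, F y 0 i @[y --> x] --> F x 0 i) ->
  minform l (F y) @[y --> x] --> minform l (F x).
Proof. by move=> c; apply: min_cvg; exact: aterm_cvg. Qed.

End Continuity.

(** * Balancing at a codimension-one face *)

Section Stars.
Variable R : realType.

Lemma near_line n (p u : 'rV[R]_n) (N : set 'rV[R]_n) : nbhs p N ->
  exists e : R, 0 < e /\ N (p + e *: u).
Proof.
move=> nN; have c : (fun t : R => p + t *: u) @ 0 --> p + 0 *: u.
  apply: cvgD; first exact: cvg_cst.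
  by apply: cvgZr_tmp; exact: cvg_id.
rewrite scale0r addr0 in c.
have /nbhs_ballP[e /= e0 eN] := c _ nN.
exists (e / 2); split; first lra.
by apply: eN; rewrite /ball /= sub0r normrN gtr0_norm; lra.
Qed.

(** Pairing the balancing relation of the graph with the equation of the
    hyperplane containing it leaves omega = 0. *)
Lemma restoring_weight_affine k n (V : wset R n) P p omega (ell : 'cV[R]_n) (c0 : R) :
  (\forall y \near p, support V (emb y) -> P (emb y) = (c0 + (y *m ell) 0 0)%:E) ->
  restoring_weight k V P p omega -> omega = 0%N.
Proof.
move=> aff [B [lam [r [v [w [s [[[Vp Pp] basis w0 hV hP] [mu bal]]]]]]]].
have Pe : P (emb p) = (c0 + (p *m ell) 0 0)%:E by apply: (nbhs_singleton aff).
have key i (c : 'rV[R]_k) (t : R) : 0 <= t ->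
    (c *m lam) 0 0 + t * s i = (c *m real_mx R B *m ell) 0 0 + t * (real_mx R (v i) *m ell) 0 0.
  move=> t0; pose u := c *m real_mx R B + t *: real_mx R (v i).
  have [e [e0 [[ha hb] hc]]] := near_line u (filterI (filterI aff hV) hP).
  have ue : p + e *: u = p + (e *: c) *m real_mx R B + (e * t) *: real_mx R (v i).
    by rewrite /u scalerDr addrA -scalemxAl scalerA.
  have et0 : 0 <= e * t by rewrite mulr_ge0 // ltW.
  have [e1 _] := hc i (e *: c) (e * t) et0 ue.
  have : support V (emb (p + e *: u)) by apply/hb; exists i, (e *: c), (e * t).
  move/ha; rewrite e1 Pe -EFinD => -[].
  rewrite ue !mulmxDl -!scalemxAl !mxE => h.
  by apply: (mulfI (lt0r_neq0 e0)); lra.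
have [i0 _] : exists i0 : 'I_r, True.
  by have [i _] := (nbhs_singleton hV).1 Vp; exists i.
have hs i : (real_mx R (v i) *m ell) 0 0 = s i.
  by have := key i 0 1 ler01; rewrite !mul0mx mxE mxE !add0r !mul1r.
have hlam : real_mx R B *m ell = lam.
  apply/colP => j; have := key i0 (delta_mx 0 j) 0 (lexx _).
  by rewrite !mul0r !addr0 -mulmxA -!rowE !mxE.
have := congr1 (fun M => (M *m col_mx ell (- 1%:M)) 0 0) bal.
rewrite mulmxDl mulmx_suml -scalemxAl !mul_row_col mul0mx add0r mul1mx.
rewrite -mulmxA mul_row_col hlam mulmxN mulmx1 subrr mulmx0 !mxE summxE big1; last first.
  move=> i _; rewrite -scalemxAl mul_row_col mulmxN mulmx1 !mxE eqxx mulr1n.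
  by have := hs i; rewrite mxE => ->; rewrite subrr mulr0.
by rewrite add0r eqxx mulrN mulr1 => /eqP; rewrite oppr_eq0 pnatr_eq0 => /eqP.
Qed.

Lemma mulmx_col2 n (B v : 'rV[int]_n) (c : 'rV[R]_(1 + 1)) j :
  (c *m real_mx R (col_mx B v)) 0 j =
    c 0 (lshift 1 0) * (B 0 j)%:~R + c 0 (rshift 1 0) * (v 0 j)%:~R.
Proof.
rewrite mxE big_split_ord /= !big_ord1; congr (_ * _ + _ * _).
  by rewrite mxE col_mxEu.
by rewrite mxE col_mxEd.
Qed.

(** Two integral vectors with a 2 x 2 minor equal to 1 or -1 are a basis of
    a saturated lattice, by Cramer. *)
Lemma lattice_basis_minor n (B v : 'rV[int]_n) (j0 j1 : 'I_n) :
  `|B 0 j0 * v 0 j1 - B 0 j1 * v 0 j0| = 1 -> @lattice_basis R _ _ (col_mx B v).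
Proof.
move=> D1 c hc; set D := (X in `|X|) in D1.
have DD : (D%:~R * D%:~R : R) = 1.
  have [->|->] : D = 1 \/ D = -1 by move: (D) D1 => E; lia.
    by rewrite mulr1.
  by rewrite rmorphN mulrNN mulr1.
have h0 := hc j0; have h1 := hc j1; rewrite !mulmx_col2 in h0 h1.
set X := (X in X \is a _) in h0; set Y := (X in X \is a _) in h1.
have cl (x : R) (z : int) : x \is a Num.int -> x * z%:~R \is a Num.int.
  by move=> hx; rewrite rpredM // intr_int.
have e0 : c 0 (lshift 1 0) = (X * (v 0 j1)%:~R - Y * (v 0 j0)%:~R) * D%:~R.
  transitivity (c 0 (lshift 1 0) * (D%:~R * D%:~R)); first by rewrite DD mulr1.
  by rewrite /X /Y /D !rmorphB /= !intrM; ring.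
have e1 : c 0 (rshift 1 0) = (Y * (B 0 j0)%:~R - X * (B 0 j1)%:~R) * D%:~R.
  transitivity (c 0 (rshift 1 0) * (D%:~R * D%:~R)); first by rewrite DD mulr1.
  by rewrite /X /Y /D !rmorphB /= !intrM; ring.
move=> i; case: (fintype.splitP i) => j ij; rewrite (ord1 j) in ij.
  by rewrite (_ : i = lshift 1 0) ?e0; [apply/cl/rpredB; exact: cl|exact: val_inj].
by rewrite (_ : i = rshift 1 0) ?e1; [apply/cl/rpredB; exact: cl|exact: val_inj].
Qed.

Lemma minor_independent n (B v : 'rV[int]_n) (j0 j1 : 'I_n) (c : R) :
  `|B 0 j0 * v 0 j1 - B 0 j1 * v 0 j0| = 1 -> real_mx R v <> c *: real_mx R B.
Proof.
move=> D1 e; have e0 := (matrixP _ _).2 e 0 j0; have e1 := (matrixP _ _).2 e 0 j1.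
rewrite !mxE in e0 e1.
have : ((B 0 j0 * v 0 j1 - B 0 j1 * v 0 j0)%:~R : R) = 0.
  by rewrite rmorphB /= !intrM e0 e1; ring.
by move/eqP; rewrite intr_eq0 => /eqP z; rewrite z normr0 in D1.
Qed.

Lemma mul_row1 n (c : 'rV[R]_1) (B : 'rV[R]_n) : c *m B = c 0 0 *: B.
Proof. by rewrite {1}[c]mx11_scalar mul_scalar_mx. Qed.

(** The two half-planes are directed by v and -v, so their contributions
    cancel but in the last coordinate, where they leave the difference of
    the slopes. *)
Lemma restoring_weight_crease n (V : wset R n) P (p : 'rV[R]_n) (B v : 'rV[int]_n)
    (j0 j1 : 'I_n) (lam sp sm : R) (om : nat) :
  `|B 0 j0 * v 0 j1 - B 0 j1 * v 0 j0| = 1 ->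
  P (emb p) \is a fin_num ->
  (\forall y \near p, support V (emb y) <->
     exists c t : R, y = p + c *: real_mx R B + t *: real_mx R v) ->
  (\forall y \near p, forall c t : R, y = p + c *: real_mx R B + t *: real_mx R v ->
     P (emb y) = (P (emb p) + (c * lam + t * (if 0 <= t then sp else sm))%:E)%E /\
     (t != 0 -> weight V (emb y) 1)) ->
  sp + om%:R = sm -> restoring_weight 1 V P p om.
Proof.
move=> D1 Pp hV hP slopes.
exists B, lam%:M, 2%N, (fun i => if i == 0 then v else - v), (fun=> 1%N),
  (fun i => if i == 0 then sp else - sm).
have rN (u : 'rV[int]_n) : real_mx R (- u) = - real_mx R u.
  by apply/rowP => j; rewrite !mxE rmorphN.
have D1N : `|B 0 j0 * (- v) 0 j1 - B 0 j1 * (- v) 0 j0| = 1.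
  by rewrite !mxE !mulrN opprK addrC -normrN opprD opprK addrC D1.
split; last first.
  exists 0; rewrite mul0mx sum_I2 /= !scale1r rN; apply/rowP => j.
  rewrite !mxE; case: (fintype.split j) => k; rewrite !mxE; first by ring.
  by rewrite (ord1 k) eqxx !mulr1n; lra.
have Vp : support V (emb p).
  by apply/(nbhs_singleton hV); exists 0, 0; rewrite !scale0r !addr0.
split=> //.
- split.
    by apply: I2P => /=; apply: lattice_basis_minor; [exact: D1|exact: D1N].
  have r2 (u u' : 'rV[int]_n) : real_mx R (u - u') = real_mx R u - real_mx R u'.
    by apply/rowP => j; rewrite !mxE rmorphB.
  have no (c : 'rV[R]_1) : real_mx R v + real_mx R v = c *m real_mx R B -> False.
    rewrite mul_row1 => e; apply: (minor_independent (c := c 0 0 / 2) D1).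
    have : 2 *: real_mx R v = c 0 0 *: real_mx R B by rewrite -e scaler_nat mulr2n.
    move/(congr1 (fun M => 2^-1 *: M)); rewrite !scalerA mulVf ?scale1r ?pnatr_eq0 //.
    by move->; rewrite mulrC.
  by move=> i j; elim/I2P: i; elim/I2P: j => //= c; rewrite r2 rN ?opprK => e; exfalso;
    [apply: (no c)|apply: (no (- c)); rewrite mulNmx -e opprD opprK].
- apply: filterS hV => y [h1 h2]; split=> [/h1[c [t ->]]|[i [c [t [t0 ye]]]]].
    have [t0|t0] := leP 0 t.
      by exists 0, c%:M, t; rewrite mul_scalar_mx.
    exists 1, c%:M, (- t); rewrite mul_scalar_mx /= rN scalerN scaleNr opprK.
    by split=> //; rewrite oppr_ge0 ltW.
  apply: h2; rewrite ye mul_row1; elim/I2P: i {ye} => /=; exists (c 0 0); [exists t|exists (- t)] => //.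
  by rewrite rN scalerN scaleNr.
- apply: filterS hP => y hy i c t t0; rewrite mul_row1; elim/I2P: i => /= ye.
    have [e hw] := hy _ _ ye; rewrite e mul_row1 !mxE eqxx mulr1n t0; split=> // tp.
    by apply: hw; rewrite gt_eqF.
  rewrite rN scalerN -scaleNr in ye.
  have [e hw] := hy _ _ ye; rewrite e mul_row1 !mxE eqxx mulr1n; split=> [|tp]; last first.
    by apply: hw; rewrite oppr_eq0 gt_eqF.
  rewrite oppr_ge0; have [t0'|t0'] := leP t 0; last by congr (_ + (_ + _)%:E)%E; ring.
  have -> : t = 0 by apply/eqP; rewrite eq_le t0 t0'.
  by congr (_ + (_ + _)%:E)%E; ring.
Qed.

End Stars.

(** * The divisor of a minimum of two terms *)

Section Ties.
Variable R : realType.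
Implicit Types (l : 'I_2 -> low_term R) (p : 'rV[R]_2).

Definition tie l (x : 'rV[\bar R]_2) : Prop :=
  [/\ l 0 != None, l 1 != None & aterm (l 0) (x 0 0) = aterm (l 1) (x 0 1)].

Definition tame l := (forall j, no_const (l j)) /\ exists j, is_linear (l j).

Lemma embE n (p : 'rV[R]_n) i : emb p 0 i = (p 0 i)%:E.
Proof. by rewrite mxE. Qed.

Lemma emb_cvg n (p : 'rV[R]_n) i : emb y 0 i @[y --> p] --> emb p 0 i.
Proof.
move=> A; rewrite embE => nA.
exists (fun _ j => if j == i then EFin @^-1` A else setT) => [k j|y hy].
  by rewrite (ord1 k); case: eqP => [->|_]; [exact: nA|exact: filterT].
by have := hy 0 i; rewrite eqxx /= embE.
Qed.

(** Away from the ties one of the two terms is locally the strict minimum,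
    an absent term being +oo. *)
Lemma affine_near l p : (exists j, is_linear (l j)) -> ~ tie l (emb p) ->
  exists (m : 'I_2 -> int) (h : R), \forall y \near p, ~ tie l (emb y) /\
    minform l (emb y) = (h + \sum_j (m j)%:~R * y 0 j)%:E.
Proof.
move=> [j0 lin] nt.
have [j [n [a [lj lt]]]] : exists j n a, l j = Some (n, a) /\
    (aterm (l j) (emb p 0%R j) < aterm (l (oth j)) (emb p 0%R (oth j)))%E.
  case l0: (l 0) => [[n0 a0]|]; case l1: (l 1) => [[n1 a1]|].
  - case: (ltgtP (aterm (l 0) (emb p 0 0)) (aterm (l 1) (emb p 0 1))) => h.
    + by exists 0, n0, a0.
    + by exists 1, n1, a1.
    + by case: nt; split=> //; rewrite ?l0 ?l1.
  - by exists 0, n0, a0; rewrite l0 /oth /= l1 /= embE -EFinM -EFinD ltry.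
  - by exists 1, n1, a1; rewrite l1 /oth /= l0 /= embE -EFinM -EFinD ltry.
  - by elim/I2P: j0 lin; rewrite ?l0 ?l1.
exists (fun i => if i == j then Posz n else 0), a.
have c i : aterm (l i) (emb y 0 i) @[y --> p] --> aterm (l i) (emb p 0 i).
  exact/aterm_cvg/emb_cvg.
apply: filterS (near_lt (c j) (c (oth j)) lt) => y hy.
have vE : minform l (emb y) = aterm (l j) (emb y 0 j).
  move: hy; rewrite /minform /Order.min; elim/I2P: j {lj lt} => /= hy; first by rewrite hy.
  by rewrite ltNge (ltW hy).
split.
  by move: hy; elim/I2P: j {lj lt vE} => /= hy; case=> _ _ e; rewrite e ltxx in hy.
rewrite vE lj /= (sum_oth _ j) eqxx (negbTE (oth_neq j)) mul0r addr0 embE.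
by rewrite -EFinM -EFinD.
Qed.

Lemma tie_fin l p : tie l (emb p) -> exists a0 a1 n0 n1,
  [/\ l 0 = Some (n0, a0), l 1 = Some (n1, a1) & a0 + n0%:R * p 0 0 = a1 + n1%:R * p 0 1].
Proof.
case; case: (l 0) => [[n0 a0]|] //; case: (l 1) => [[n1 a1]|] // _ _ /=.
rewrite !embE -!EFinM -!EFinD => -[e].
by exists a0, a1, n0, n1.
Qed.

(** One of the exponents is 1, so the line where the two terms are equal has
    a primitive direction B = (n, 1) or (1, n) completed by a coordinate
    vector v, along which the slopes on the two sides are 0 and 1. *)
Lemma minform_crease l p : tame l -> tie l (emb p) ->
  exists (B v : 'I_2 -> int) (lam h : R),
  [/\ `|B 0 * v 1 - B 1 * v 0| = 1, minform l (emb p) = h%:E &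
     forall (c t : R) (y : 'rV[R]_2), (forall j, y 0 j = p 0 j + c * (B j)%:~R + t * (v j)%:~R) ->
       (tie l (emb y) <-> t = 0) /\
       minform l (emb y) = (h + (c * lam + t * (if 0 <= t then 0 else 1)))%:E].
Proof.
move=> [wf [j0 lin]] tp; have [a0 [a1 [n0 [n1 [l0 l1 e]]]]] := tie_fin tp.
have mE y : minform l (emb y) = (Num.min (a0 + n0%:R * y 0 0) (a1 + n1%:R * y 0 1))%:E.
  by rewrite /minform l0 l1 /= !embE -!EFinM -!EFinD -EFin_min.
have tE y : tie l (emb y) <-> a0 + n0%:R * y 0 0 = a1 + n1%:R * y 0 1.
  split=> [[_ _]|h]; first by rewrite l0 l1 /= !embE => -[].
  by split; rewrite ?l0 ?l1 //= !embE -!EFinM -!EFinD h.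
have [n01|n11] : n0 = 1%N \/ n1 = 1%N.
  have cs (n : nat) (a : R) : is_linear (Some (n, a)) -> n = 1%N by case: n => [|[|n]].
  by elim/I2P: j0 lin; rewrite ?l0 ?l1 => /cs; [left|right].
- subst n0; exists (fun j => if j == 0 then Posz n1 else 1), (fun j => if j == 0 then 1 else 0),
    n1%:R, (a0 + p 0 0); split; first by rewrite /= mulr0 mul1r sub0r.
    by rewrite mE -e minxx mul1r.
  move=> c t y hy; rewrite tE mE (hy 0) (hy 1) /= !mul1r !mulr1 !mulr0 !addr0.
  rewrite mul1r in e; rewrite -!pmulrn; split; first by split=> [h|->]; lra.
  by congr EFin; rewrite /Num.min; case: ltP => h; case: leP => t0; lra.
- subst n1; exists (fun j => if j == 0 then 1 else Posz n0), (fun j => if j == 0 then 0 else 1),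
    n0%:R, (a0 + n0%:R * p 0 0); split; first by rewrite /= mulr0 mul1r subr0.
    by rewrite mE -e minxx.
  move=> c t y hy; rewrite tE mE (hy 0) (hy 1) /= !mul1r !mulr1 !mulr0 !addr0.
  rewrite mul1r in e; rewrite -!pmulrn; split; first by split=> [h|->]; lra.
  by congr EFin; rewrite /Num.min; case: ltP => h; case: leP => t0; lra.
Qed.

Lemma minor_coordinates (B v : 'I_2 -> int) (X : 'I_2 -> R) : `|B 0 * v 1 - B 1 * v 0| = 1 ->
  exists c t : R, forall j, X j = c * (B j)%:~R + t * (v j)%:~R.
Proof.
move=> D1; pose D : R := (B 0)%:~R * (v 1)%:~R - (B 1)%:~R * (v 0)%:~R.
have D0 : D != 0.
  have -> : D = (B 0 * v 1 - B 1 * v 0)%:~R by rewrite rmorphB /= !intrM.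
  by rewrite intr_eq0; apply/eqP => z; rewrite z normr0 in D1.
exists ((X 0 * (v 1)%:~R - X 1 * (v 0)%:~R) / D), ((X 1 * (B 0)%:~R - X 0 * (B 1)%:~R) / D).
by apply: I2P; apply: (mulIf D0); rewrite mulrDl [_ / D * _]mulrAC [_ / D * (v _)%:~R]mulrAC !divfK // /D; ring.
Qed.

(** The difference of the slopes is one, hence the weight. *)
Lemma restoring_plane l p : tame l -> tie l (emb p) ->
  restoring_weight 1 (@tplane R) (minform l) p 1.
Proof.
move=> tm tp; have [B [v [lam [h [D1 mp hB]]]]] := minform_crease tm tp.
have coord (c t : R) y : y = p + c *: real_mx R (\row_j B j) + t *: real_mx R (\row_j v j) <->
    forall j, y 0 j = p 0 j + c * (B j)%:~R + t * (v j)%:~R.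
  by split=> [-> j|hy]; [rewrite !mxE|apply/rowP => j; rewrite !mxE].
apply: (@restoring_weight_crease _ _ _ _ p (\row_j B j) (\row_j v j) 0 1 lam 0 1).
- by rewrite !mxE.
- by rewrite mp.
- apply: (@filterE _ (nbhs p)) => y; split=> [_|_]; last by move=> i; rewrite embE.
  have [c [t ct]] := minor_coordinates (fun j => y 0 j - p 0 j) D1.
  by exists c, t; apply/coord => j; rewrite -addrA -ct; ring.
- apply: (@filterE _ (nbhs p)) => y c t /coord/hB[_ ->]; rewrite mp -EFinD; split=> //.
- by rewrite add0r.
Qed.

(** Off the ties the minimum is affine near the point, and no positive
    weight restores a balancing that holds. *)
Lemma div_plane l p : tame l ->
  div_points 1 (@tplane R) (minform l) (emb p) <-> tie l (emb p).
Proof.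
move=> tm; split=> [[p' [om [/(congr1 (map_mx fine)) pE om0 rw]]]|tp]; last first.
  by exists p, 1%N; split=> //; exact: restoring_plane.
have fineK' (u : 'rV[R]_2) : map_mx fine (emb u) = u by apply/rowP => j; rewrite !mxE.
rewrite !fineK' in pE; subst p'.
apply: contrapT => nt; have [m [h am]] := affine_near tm.2 nt.
suff om1 : om = 0%N by rewrite om1 in om0.
apply: (restoring_weight_affine (ell := \col_j (m j)%:~R) (c0 := h)) rw.
apply: filterS am => y [_ ->] _; congr (_ + _)%:E.
by rewrite mxE; apply: eq_bigr => j _; rewrite mxE mulrC.
Qed.

Lemma closure_div_plane l x : tame l ->
  closure (div_points 1 (@tplane R) (minform l)) x -> tie l x.
Proof.
move=> tm cl.
have sub : div_points 1 (@tplane R) (minform l) `<=` [set y | tie l y].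
  by move=> y dy; have [p [om [yE _ _]]] := dy; rewrite yE /=; apply/div_plane => //; rewrite -yE.
have [y ty] : exists y, tie l y by have [y [/sub ? _]] := cl setT filterT; exists y.
case: ty => l0 l1 _; split=> //.
apply: (@closure_eq _ _ (fun y : 'rV[\bar R]_2 => aterm (l 0) (y 0 0)) (fun y => aterm (l 1) (y 0 1))).
- exact/aterm_cvg/coord_cvg.
- exact/aterm_cvg/coord_cvg.
by apply: closureS cl => u /sub[].
Qed.

(** A point of T^2 where the two terms are equal is real or gives them the
    value +oo; in the latter case there is no room above the graph. *)
Lemma tie_cases l x : tame l -> Tpt 2 x -> tie l x ->
  (exists p, x = emb p) \/ minform l x = +oo%E.
Proof.
move=> [wf _] Tx [l0 l1 e].
have h j : l j != None -> (x 0 j == +oo%E) = (aterm (l j) (x 0 j) == +oo%E).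
  move=> lj; have := wf j; have := Tx j; case: (x 0 j) => [r||] // _.
    by case: (l j) lj => [[n a]|].
  by move=> w; rewrite aterm_y // eqxx.
have h0 := h 0 l0; have h1 := h 1 l1; rewrite -e in h1.
case: (boolP (aterm (l 0) (x 0 0) == +oo%E)) => [/eqP i|ni]; [right|left].
  by rewrite /minform -e i minxx.
exists (map_mx fine x); apply/rowP => j; rewrite !mxE fineK // fin_numE Tx /=.
by elim/I2P: j; rewrite ?h0 ?h1.
Qed.

End Ties.

(** * The divisor on the first modification *)

Section SecondDivisor.
Variable R : realType.
Implicit Types (l : 'I_2 -> low_term R) (q : 'rV[R]_(2 + 1)).

Lemma lsubmx_emb q : lsubmx (emb q) = emb (lsubmx q).
Proof. by apply/rowP => j; rewrite !mxE. Qed.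

Lemma rsubmx_emb q : rsubmx (emb q) 0 0 = (rsubmx q 0 0)%:E.
Proof. by rewrite !mxE. Qed.

Lemma nbhs_lsubmx (T : topologicalType) (q : 'rV[T]_(2 + 1)) (A : set 'rV[T]_2) :
  nbhs (lsubmx q) A -> nbhs q (lsubmx @^-1` A).
Proof.
move=> [P nP PA].
exists (fun i j => match fintype.split j with inl k => P i k | inr _ => setT end).
  move=> i j; case: (fintype.splitP j) => k jk; last exact: filterT.
  by have := nP i k; rewrite mxE (_ : lshift 1 k = j) //; apply: val_inj.
move=> y hy; apply: PA => i k; rewrite mxE.
have := hy i (lshift 1 k); case: (fintype.splitP (lshift 1 k)) => k' kk.
  by rewrite (_ : k' = k) //; apply: val_inj.
by have := ltn_ord k; rewrite -[nat_of_ord k]/(nat_of_ord (lshift 1 k)) kk.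
Qed.

Lemma row3P (T : Type) (x y : 'rV[T]_(2 + 1)) :
  x = y <-> (forall j, lsubmx x 0 j = lsubmx y 0 j) /\ rsubmx x 0 0 = rsubmx y 0 0.
Proof.
split=> [-> //|[h1 h2]]; rewrite -[x]hsubmxK -[y]hsubmxK.
by congr row_mx; apply/rowP => j; rewrite ?(ord1 j).
Qed.

Definition lift3 (u : 'I_2 -> int) (z : int) : 'rV[int]_(2 + 1) :=
  row_mx (\row_j u j) (const_mx z).

Lemma lift3_l u z j : lift3 u z 0 (lshift 1 j) = u j.
Proof. by rewrite row_mxEl mxE. Qed.
Lemma lift3_r u z : lift3 u z 0 (rshift 2 0) = z.
Proof. by rewrite row_mxEr mxE. Qed.

Lemma lift3_coord y q (c t : R) (B v : 'I_2 -> int) (beta gamma : int) :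
  y = q + c *: real_mx R (lift3 B beta) + t *: real_mx R (lift3 v gamma) <->
  (forall j, lsubmx y 0 j = lsubmx q 0 j + c * (B j)%:~R + t * (v j)%:~R) /\
  rsubmx y 0 0 = rsubmx q 0 0 + c * beta%:~R + t * gamma%:~R.
Proof.
rewrite row3P; split=> -[h1 h2]; split=> [j|].
- by rewrite h1 !mxE !(unsplitK (inl j)) !mxE.
- by rewrite h2 !mxE !(unsplitK (inr 0)) !mxE.
- by rewrite h1 !mxE !(unsplitK (inl j)) !mxE.
- by rewrite h2 !mxE !(unsplitK (inr 0)) !mxE.
Qed.

Lemma linear_forms (l : 'I_2 -> low_term R) : (forall j, is_linear (l j)) -> exists a b : R,
  (forall y, minform l (emb y) = (Num.min (a + y 0 0) (b + y 0 1))%:E) /\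
  (forall y, tie l (emb y) <-> a + y 0 0 = b + y 0 1).
Proof.
move=> lin; have [a la] := is_linearP (lin 0); have [b lb] := is_linearP (lin 1).
exists a, b; split=> y.
  by rewrite /minform la lb /= !mul1e !embE -!EFinD -EFin_min.
rewrite /tie la lb /= !mul1e !embE -!EFinD.
by split=> [[_ _ []]//|h]; split=> //; rewrite h.
Qed.

Variables l0 l1 : 'I_2 -> low_term R.
Hypotheses (tame0 : tame l0) (tame1 : tame l1).
Hypothesis compat : [\/ forall x, ~ tie l0 x, forall x, ~ tie l1 x |
  forall j, is_linear (l0 j) /\ is_linear (l1 j)].

Let V1 := modification 1 (@tplane R) (minform l0).
Let P1 : 'rV[\bar R]_(2 + 1) -> \bar R := minform l1 \o lsubmx.

Lemma support_V1 q : support V1 (emb q) <->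
  (rsubmx q 0 0)%:E = minform l0 (emb (lsubmx q)) \/
  tie l0 (emb (lsubmx q)) /\ (minform l0 (emb (lsubmx q)) <= (rsubmx q 0%R 0%R)%:E)%E.
Proof.
rewrite /V1 /= lsubmx_emb rsubmx_emb; split=> [[_ [->|[cl le]]]|h].
- by left.
- by right; split=> //; exact: closure_div_plane.
split; first by move=> i; rewrite embE.
case: h => [->|[tp le]]; [by left|right; split=> //].
by apply: subset_closure; apply/div_plane.
Qed.

Lemma weight_V1_wall q : (rsubmx q 0 0)%:E <> minform l0 (emb (lsubmx q)) ->
  tie l0 (emb (lsubmx q)) -> weight V1 (emb q) 1.
Proof.
move=> e tp; right; rewrite lsubmx_emb rsubmx_emb; split=> //.
by exists (lsubmx q) => //; exact: restoring_plane.
Qed.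

(** Where the terms of the first function are distinct, the first
    modification is locally a graph over the plane, so the crease is that of
    the plane. *)
Lemma restoring_space_simple q : tie l1 (emb (lsubmx q)) -> ~ tie l0 (emb (lsubmx q)) ->
  (rsubmx q 0 0)%:E = minform l0 (emb (lsubmx q)) -> restoring_weight 1 V1 P1 q 1.
Proof.
move=> tp ntp e.
have [m [h /nbhs_lsubmx am]] := affine_near tame0.2 ntp.
have [B [v [lam [h1 [D1 mp hB]]]]] := minform_crease tame1 tp.
have qE : rsubmx q 0 0 = h + \sum_j (m j)%:~R * lsubmx q 0 j.
  by have [_] := nbhs_singleton am; rewrite -e => -[].
have sE (y : 'rV[R]_(2 + 1)) c t :
    (forall j, lsubmx y 0 j = lsubmx q 0 j + c * (B j)%:~R + t * (v j)%:~R) ->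
    h + \sum_j (m j)%:~R * lsubmx y 0 j =
    rsubmx q 0 0 + c * (\sum_j m j * B j)%:~R + t * (\sum_j m j * v j)%:~R.
  by move=> hy; rewrite qE !sum_I2 !hy !rmorphD /= !intrM; ring.
apply: (@restoring_weight_crease _ _ _ _ q (lift3 B (\sum_j m j * B j))
  (lift3 v (\sum_j m j * v j)) (lshift 1 0) (lshift 1 1) lam 0 1).
- by rewrite !lift3_l.
- by rewrite /P1 /= lsubmx_emb mp.
- apply: filterS am => y [nt me]; rewrite support_V1 me; split=> [[[ry]|[]//]|].
    have [c [t ct]] := minor_coordinates (fun j => lsubmx y 0 j - lsubmx q 0 j) D1.
    have hy j : lsubmx y 0 j = lsubmx q 0 j + c * (B j)%:~R + t * (v j)%:~R.
      by rewrite -addrA -ct; ring.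
    exists c, t; apply/lift3_coord; split=> //.
    by rewrite ry (sE _ _ _ hy).
  by move=> [c [t /lift3_coord[hy hr]]]; left; rewrite hr (sE _ _ _ hy).
- apply: filterS am => y [nt me] c t /lift3_coord[hy hr].
  rewrite /P1 /= !lsubmx_emb mp; have [_ ->] := hB _ _ _ hy; split=> // _.
  by left; split=> //; rewrite rsubmx_emb me hr (sE _ _ _ hy).
- by rewrite add0r.
Qed.

Lemma I3P (P : 'I_3 -> Prop) : P 0 -> P 1 -> P 2%:R -> forall i, P i.
Proof.
move=> p0 p1 p2 [[|[|[|//]]] h].
- by rewrite (_ : Ordinal h = 0) //; apply: val_inj.
- by rewrite (_ : Ordinal h = 1) //; apply: val_inj.
- by rewrite (_ : Ordinal h = 2%:R) //; apply: val_inj.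
Qed.

Lemma sum_I3 (V : nmodType) (F : 'I_3 -> V) : \sum_i F i = F 0 + F 1 + F 2%:R.
Proof.
rewrite !big_ord_recl big_ord0 addr0 addrA; congr (_ + F _ + F _); exact: val_inj.
Qed.

(** Where both pairs of terms are equal and linear, the first modification
    is a tropical plane: three half-planes along the line B, two on the
    graph and one vertical, with weight one each. On them the second
    function has the transversal slopes 0, -1 and 0, so the three facets of
    its graph add up to (0, 0, 0, -1). *)
Lemma restoring_space_double q : tie l1 (emb (lsubmx q)) -> tie l0 (emb (lsubmx q)) ->
  (rsubmx q 0 0)%:E = minform l0 (emb (lsubmx q)) -> restoring_weight 1 V1 P1 q 1.
Proof.
move=> t1 t0 e.
have lin : forall j, is_linear (l0 j) /\ is_linear (l1 j).
  by case: compat => // nt; [case: (nt _ t0)|case: (nt _ t1)].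
have [a0 [b0 [m0E t0E]]] := linear_forms (fun j => (lin j).1).
have [a1 [b1 [m1E t1E]]] := linear_forms (fun j => (lin j).2).
set x := lsubmx q in t0 t1 e.
move/t0E: t0 => t0; move/t1E: t1 => t1.
rewrite m0E -t0 minxx in e; case: e => e.
(* The facets: x_0 increasing on the graph, x_0 decreasing on the graph, and
   the vertical direction. *)
pose v (i : 'I_3) : 'rV[int]_(2 + 1) :=
  if i == 0 then lift3 (fun j => if j == 0 then 1 else 0) 0 else
  if i == 1 then lift3 (fun j => if j == 0 then -1 else 0) (-1) else lift3 (fun=> 0) 1.
pose B := lift3 (fun=> 1) 1.
pose s (i : 'I_3) : R := if i == 1 then -1 else 0.
have sup y : support V1 (emb y) <-> exists (i : 'I_3) (c : 'rV[R]_1) (t : R),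
    0 <= t /\ y = q + c *m real_mx R B + t *: real_mx R (v i).
  rewrite support_V1 m0E t0E; set Y := lsubmx y.
  have xq j : lsubmx q 0 j = x 0 j by [].
  split=> [hy|[i [c [t [tp]]]]]; last first.
    rewrite mul_row1; elim/I3P: i => /lift3_coord[hy hr]; have y0 := hy 0; have y1 := hy 1;
      rewrite -/Y /= !xq ?mulr1 ?mulr0 ?mulrN1 ?addr0 in y0 y1 hr.
    - by left; congr EFin; rewrite /Num.min; case: ltP => h; lra.
    - by left; congr EFin; rewrite /Num.min; case: ltP => h; lra.
    - right; rewrite lee_fin ge_min; split; first lra.
      by apply/orP; left; lra.
  have [Y01|Y01] := leP (Y 0 1 - x 0 1) (Y 0 0 - x 0 0).
    have [yr|yr] := eqVneq (rsubmx y 0 0) (rsubmx q 0 0 + (Y 0 1 - x 0 1)).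
      exists 0, (Y 0 1 - x 0 1)%:M, (Y 0 0 - x 0 0 - (Y 0 1 - x 0 1)); split; first by rewrite subr_ge0.
      rewrite mul_scalar_mx; apply/lift3_coord; split; last by rewrite yr /=; lra.
      by apply: I2P => /=; rewrite !xq -/Y; lra.
    case: hy => [[yr']|[ty le]].
      by move: yr; rewrite yr' /Num.min; case: ltP => h /eqP[]; lra.
    rewrite lee_fin ge_min in le.
    exists 2%:R, (Y 0 1 - x 0 1)%:M, (rsubmx y 0 0 - (rsubmx q 0 0 + (Y 0 1 - x 0 1))); split.
      by case/orP: le => le; lra.
    rewrite mul_scalar_mx; apply/lift3_coord; split; last by rewrite /=; lra.
    by apply: I2P => /=; rewrite !xq -/Y; lra.
  case: hy => [[yr']|[ty le]]; last by lra.
  exists 1, (Y 0 1 - x 0 1)%:M, (Y 0 1 - x 0 1 - (Y 0 0 - x 0 0)); split; first by rewrite subr_ge0 ltW.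
  rewrite mul_scalar_mx; apply/lift3_coord; split; last first.
    by rewrite /= yr' /Num.min; case: ltP => h; lra.
  by apply: I2P => /=; rewrite !xq -/Y; lra.
have vE i j : real_mx R (v i) 0 (lshift 1 j) =
    (if j == 0 then if i == 0 then 1 else if i == 1 then -1 else 0 else 0).
  by rewrite mxE /v; elim/I3P: i => /=; rewrite lift3_l; case: (j == 0).
have vEr i : real_mx R (v i) 0 (rshift 2 0) = if i == 0 then 0 else if i == 1 then -1 else 1.
  by rewrite mxE /v; elim/I3P: i => /=; rewrite lift3_r.
exists B, 1%:M, 3%N, v, (fun=> 1%N), s; split; last first.
  exists 0; rewrite mul0mx sum_I3 !scale1r !add_row_mx -[RHS]row_mx0 addr0; congr row_mx.
    apply/row3P; split=> [j|]; rewrite !mxE.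
      by have := vE 0 j; have := vE 1 j; have := vE 2%:R j; rewrite !mxE => -> -> ->; case: ifP => _ /=; ring.
    by have := vEr 0; have := vEr 1; have := vEr 2%:R; rewrite !mxE => -> -> -> /=; ring.
  by apply/rowP => j; rewrite (ord1 j) !mxE /s /=; ring.
split.
- by split; [apply/sup; exists 0, 0, 0; rewrite mul0mx scale0r !addr0|rewrite /P1 /= lsubmx_emb m1E].
- split.
    elim/I3P; rewrite /v /=.
    + by apply: (@lattice_basis_minor _ _ _ _ (lshift 1 0) (lshift 1 1)); rewrite !lift3_l.
    + by apply: (@lattice_basis_minor _ _ _ _ (lshift 1 0) (lshift 1 1)); rewrite !lift3_l.
    + by apply: (@lattice_basis_minor _ _ _ _ (lshift 1 0) (rshift 2 0)); rewrite !lift3_l !lift3_r.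
  move=> i j c; rewrite mul_row1 => eq_ij.
  have r2 k : real_mx R (v i - v j) 0 k = real_mx R (v i) 0 k - real_mx R (v j) 0 k.
    by rewrite !mxE rmorphB.
  have e1 := (matrixP _ _).2 eq_ij 0 (lshift 1 1); rewrite r2 !vE mxE mxE lift3_l mulr1 subrr in e1.
  have e0 := (matrixP _ _).2 eq_ij 0 (lshift 1 0); rewrite r2 !vE mxE -e1 mul0r in e0.
  have e2 := (matrixP _ _).2 eq_ij 0 (rshift 2 0); rewrite r2 !vEr mxE -e1 mul0r in e2.
  by elim/I3P: i e0 e2 {eq_ij r2}; elim/I3P: j => //= e0 e2; exfalso; lra.
- by [].
- by apply: (@filterE _ (nbhs q)) => y.
apply: (@filterE _ (nbhs q)) => y i c t tp; rewrite mul_row1 => ye.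
rewrite /P1 /= !lsubmx_emb !m1E -t1 minxx rsubmx_emb; set Y := lsubmx y.
have xq j : lsubmx q 0 j = x 0 j by [].
have wall : (rsubmx y 0 0)%:E <> minform l0 (emb Y) -> tie l0 (emb Y) -> weight V1 (emb y) 1.
  exact: weight_V1_wall.
elim/I3P: i ye => /lift3_coord[hy hr]; have y0 := hy 0; have y1 := hy 1;
  rewrite -/Y /= !xq ?mulr1 ?mulr0 ?mulrN1 ?addr0 in y0 y1 hr; rewrite mulmx1 /s /=.
- split; first by rewrite -EFinD; congr EFin; rewrite /Num.min; case: ltP => h; lra.
  by left; split=> //; rewrite m0E; congr EFin; rewrite /Num.min; case: ltP => h; lra.
- split; first by rewrite -EFinD; congr EFin; rewrite /Num.min; case: ltP => h; lra.
  by left; split=> //; rewrite m0E; congr EFin; rewrite /Num.min; case: ltP => h; lra.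
- split; first by rewrite -EFinD; congr EFin; rewrite /Num.min; case: ltP => h; lra.
  move=> t_gt0; right.
  have tY : tie l0 (emb Y) by apply/t0E; lra.
  split; last by exists Y => //; exact: restoring_plane.
  by rewrite m0E => -[]; rewrite /Num.min; case: ltP => h; lra.
Qed.

(** On the vertical part the second function depends on x only, and x stays
    on the line of ties of the first one: under the compatibility assumption
    it is affine there, and the vertical part does not meet the divisor. *)
Lemma div_space q : div_points 1 V1 P1 (emb q) <->
  tie l1 (emb (lsubmx q)) /\ (rsubmx q 0 0)%:E = minform l0 (emb (lsubmx q)).
Proof.
split=> [[p [om [/(congr1 (map_mx fine)) pE om0 rw]]]|[t1 e]]; last first.
  exists q, 1%N; split=> //.
  by have [t0|t0] := pselect (tie l0 (emb (lsubmx q)));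
    [exact: restoring_space_double|exact: restoring_space_simple].
have fineK' (u : 'rV[R]_(2 + 1)) : map_mx fine (emb u) = u by apply/rowP => j; rewrite !mxE.
rewrite !fineK' in pE; subst p.
have om_neq0 : om <> 0%N by move=> om_0; rewrite om_0 in om0.
have Vq : support V1 (emb q) by case: rw => ? [? [? [? [? [? [[[]]]]]]]].
have t1 : tie l1 (emb (lsubmx q)).
  apply: contrapT => nt; apply: om_neq0.
  have [m [h /nbhs_lsubmx am]] := affine_near tame1.2 nt.
  apply: (restoring_weight_affine (ell := col_mx (\col_j (m j)%:~R) 0) (c0 := h)) rw.
  apply: filterS am => y [_ e] _; rewrite /P1 /= lsubmx_emb e; congr (_ + _)%:E.
  rewrite -{2}[y]hsubmxK mul_row_col mulmx0 addr0 mxE.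
  by apply: eq_bigr => j _; rewrite mulrC; congr (_ * _); rewrite mxE.
split=> //; move/support_V1: Vq => [//|[t0 le]].
apply: contrapT => ne; apply: om_neq0.
have lin : forall j, is_linear (l0 j) /\ is_linear (l1 j).
  by case: compat => // nt; [case: (nt _ t0)|case: (nt _ t1)].
have [a0 [b0 [_ t0E]]] := linear_forms (fun j => (lin j).1).
have [a1 [b1 [m1E t1E]]] := linear_forms (fun j => (lin j).2).
have lt : (minform l0 (emb (lsubmx q)) < (rsubmx q 0%R 0%R)%:E)%E.
  by rewrite lt_neqAle le andbT; apply/eqP => e; apply: ne.
have cl : minform l0 (emb (lsubmx y)) @[y --> q] --> minform l0 (emb (lsubmx q)).
  apply: (@minform_cvg _ _ (fun y : 'rV[R]_(2 + 1) => emb (lsubmx y))) => i.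
  rewrite embE mxE -(embE q).
  rewrite (_ : (fun y : 'rV[R]_(2 + 1) => emb (lsubmx y) 0 i) = (fun y => emb y 0 (lshift 1 i))).
    exact: emb_cvg.
  by apply/funext => y; rewrite !mxE.
have cr : (rsubmx y 0 0)%:E @[y --> q] --> (rsubmx q 0 0)%:E.
  rewrite -rsubmx_emb mxE.
  rewrite (_ : (fun y : 'rV[R]_(2 + 1) => (rsubmx y 0 0)%:E) = (fun y => emb y 0 (rshift 2 0))).
    exact: emb_cvg.
  by apply/funext => y; rewrite !mxE.
have near := @near_lt _ _ (fun y : 'rV[R]_(2 + 1) => minform l0 (emb (lsubmx y)))
  (fun y : 'rV[R]_(2 + 1) => (rsubmx y 0 0)%:E) q cl cr lt.
apply: (restoring_weight_affine (ell := col_mx (\col_j (j == 0)%:R) 0) (c0 := a1)) rw.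
apply: filterS near => y hy /support_V1[e|[ty _]]; first by rewrite e ltxx in hy.
rewrite /P1 /= lsubmx_emb -{2}[y]hsubmxK mul_row_col mulmx0 addr0 mxE sum_I2 !mxE /= mulr1 mulr0 addr0.
rewrite m1E; congr EFin; move: ty t0 t1 => /t0E ty /t0E t0 /t1E t1; move: ty t0 t1; rewrite !mxE; clear.
by rewrite /Num.min; case: ltP => *; lra.
Qed.

Lemma closure_div_space (z : 'rV[\bar R]_(2 + 1)) : closure (div_points 1 V1 P1) z ->
  tie l1 (lsubmx z) /\ rsubmx z 0 0 = minform l0 (lsubmx z).
Proof.
move=> cl.
have sub : div_points 1 V1 P1 `<=`
    [set y | tie l1 (lsubmx y) /\ rsubmx y 0 0 = minform l0 (lsubmx y)].
  move=> y dy; have [p [om [yE _ _]]] := dy; rewrite yE /= lsubmx_emb rsubmx_emb.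
  by apply/div_space; rewrite -yE.
have cc i : (lsubmx y : 'rV[\bar R]_2) 0 i @[y --> z] --> lsubmx z 0 i.
  rewrite mxE (_ : (fun y : 'rV[\bar R]_(2 + 1) => lsubmx y 0 i) = (fun y => y 0 (lshift 1 i))).
    exact: coord_cvg.
  by apply/funext => y; rewrite !mxE.
split.
  have [y [[n0 n1 _] _]] : exists y : 'rV[\bar R]_(2 + 1), tie l1 (lsubmx y) /\ True.
    by have [y [/sub[? _] _]] := cl setT filterT; exists y.
  split=> //.
  apply: (@closure_eq _ _ (fun y : 'rV[\bar R]_(2 + 1) => aterm (l1 0) (lsubmx y 0 0))
    (fun y => aterm (l1 1) (lsubmx y 0 1))).
  - exact/aterm_cvg/cc.
  - exact/aterm_cvg/cc.
  by apply: closureS cl => u /sub[[]].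
apply: (@closure_eq _ _ (fun y : 'rV[\bar R]_(2 + 1) => rsubmx y 0 0)
    (fun y => minform l0 (lsubmx y))).
- rewrite mxE (_ : (fun y : 'rV[\bar R]_(2 + 1) => rsubmx y 0 0) = (fun y => y 0 (rshift 2 0))).
    exact: coord_cvg.
  by apply/funext => y; rewrite !mxE.
- exact: minform_cvg.
by apply: closureS cl => u /sub[].
Qed.

Definition in_modification (x y : 'rV[\bar R]_2) : Prop :=
  (y 0 0 = minform l0 x \/ tie l0 x /\ (minform l0 x <= y 0%R 0%R)%E) /\
  (y 0 1 = minform l1 x \/
     [/\ tie l1 x, y 0 0 = minform l0 x & (minform l1 x <= y 0%R 1%R)%E]).

(** Real points of the closures of the divisors are ties. A tie that is not
    real has an infinite minimum, and the points above it are on the graph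
    anyway. *)
Lemma support_modification2 x y : Tpt 2 x ->
  support (modification2 (fun i => if i == 0 then minform l0 else minform l1)) (xypoint x y) <->
  in_modification x y.
Proof.
move=> Tx; rewrite /modification2 /= /xypoint !row_mxKl !row_mxKr !mxE.
rewrite -/V1 -/P1 /in_modification; split.
  case=> -[_ h0] h1; split.
    by case: h0 => [->|[/closure_div_plane h le]]; [left|right; split=> //; exact: h].
  case: h1 => [->|[/closure_div_space[]]]; first by left.
  by rewrite row_mxKl row_mxKr mxE; right.
move=> [h0 h1]; split.
  split=> //; case: h0 => [->|[t0 le]]; first by left.
  have [[p xE]|i] := tie_cases tame0 Tx t0; last by left; apply/eqP; rewrite i -leye_eq -i.
  right; split=> //; apply: subset_closure; rewrite xE; apply/div_plane => //.
  by rewrite -xE.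
case: h1 => [->|[t1 e le]]; first by left.
have [[p xE]|i] := tie_cases tame1 Tx t1; last by left; apply/eqP; rewrite i -leye_eq -i.
right; split=> //; apply: subset_closure; rewrite e xE.
have [r rE] : exists r : R, minform l0 (emb p) = r%:E.
  have [_ [j]] := tame0; rewrite /minform !embE.
  by elim/I2P: j; case: (l0 0) => [[n0 a0]|]; case: (l0 1) => [[n1 a1]|] //= _;
    rewrite ?miney ?minye -?EFinM -?EFinD -?EFin_min; eexists.
have -> : row_mx (emb p) (const_mx (minform l0 (emb p))) = emb (row_mx p (const_mx r)) :> 'rV_(2 + 1).
  apply/row3P; split=> [j|]; rewrite ?lsubmx_emb ?rsubmx_emb ?row_mxKl ?row_mxKr //.
  by rewrite !mxE rE.
apply/div_space; rewrite row_mxKl row_mxKr mxE rE -xE; split=> //.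
Qed.

End SecondDivisor.

(** * Minima attained twice *)

Section TwiceMin.
Variable R : realType.
Implicit Types (A C y : \bar R).
Local Open Scope ereal_scope.

(** The tropical vanishing condition, symmetric in its three arguments. *)
Definition twice_min A C y : bool :=
  [&& (A <= y) || (C <= y), (A <= C) || (y <= C) & (C <= A) || (y <= A)].

Lemma twice_minAC A C y : twice_min A C y = twice_min A y C.
Proof.
rewrite /twice_min; do 6!case: (_ <= _) => //.
Qed.

Lemma twice_minCA A C y : twice_min A C y = twice_min y C A.
Proof.
rewrite /twice_min; do 6!case: (_ <= _) => //.
Qed.

Lemma twice_minP A C y : twice_min A C y <->
  [\/ y = A /\ A <= C, y = C /\ C <= A | A = C /\ A <= y].
Proof.
rewrite /twice_min; split=> [/and3P[h1 h2 h3]|[[-> h]|[-> h]|[<- h]]]; last 3 first.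
- by rewrite !lexx h !orbT.
- by rewrite !lexx h !orbT.
- by rewrite !lexx h.
have [AC|CA] := leP A C.
  have Ay : A <= y by case/orP: h1 => // h; exact: le_trans AC h.
  case/orP: h3 => h; first by constructor 3; split=> //; apply/eqP; rewrite eq_le AC h.
  by constructor 1; split=> //; apply/eqP; rewrite eq_le h Ay.
have Cy : C <= y by case/orP: h1 => // h; apply: le_trans h; exact: ltW.
rewrite leNgt CA /= in h2.
by constructor 2; split; [apply/eqP; rewrite eq_le h2 Cy|exact: ltW].
Qed.

Lemma twice_min_shift A C y (b : R) :
  twice_min (A - b%:E) (C - b%:E) (y - b%:E) = twice_min A C y.
Proof. by rewrite /twice_min -!EFinN !leeD2rE. Qed.

Lemma twice_min_yr A y : twice_min A +oo y = (y == A).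
Proof.
rewrite /twice_min !leye_eq !leey /=; apply/andP/eqP => [[h1 h2]|->]; last first.
  by rewrite lexx !orbT.
move: h1 h2; case: (eqVneq A +oo) => [->|Ay]; first by rewrite leye_eq orbb => /eqP.
rewrite /=; case: (eqVneq y +oo) => [->|yy] h1 h2.
  by move: h2; rewrite leye_eq => /eqP->.
by apply/eqP; rewrite eq_le h2; case/orP: h1 => // /eqP.
Qed.

(** The system of conditions for a point of a double modification: the last
    clause says that the vertical parts over the two divisors do not add up. *)
Definition twice_min_graph A0 C0 A1 C1 y0 y1 : bool :=
  [&& twice_min A0 C0 y0, twice_min A1 C1 y1 &
    (y1 <= A1) && (y1 <= C1) || (y0 <= A0) && (y0 <= C0)].

Lemma twice_min_tie (l : 'I_2 -> low_term R) (x : 'rV[\bar R]_2) y :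
  twice_min (aterm (l 0%R) (x 0%R 0%R)) (aterm (l 1%R) (x 0%R 1%R)) y <->
  y = minform l x \/ tie l x /\ minform l x <= y.
Proof.
rewrite twice_minP /minform; set A := aterm _ _; set C := aterm _ _.
split=> [[[-> h]|[-> h]|[e h]]|[->|[[_ _ e] h]]].
- by left; rewrite min_l.
- by left; rewrite min_r.
- have [E|nE] := boolP ((l 0%R == None) || (l 1%R == None)).
    have Ay : A = +oo by case/orP: E => /eqP E; [rewrite /A E|rewrite e /C E].
    by left; rewrite -e minxx; move: h; rewrite Ay leye_eq => /eqP.
  by move: nE; rewrite negb_or => /andP[n0 n1]; right; rewrite -e minxx; split.
- have [h|h] := leP A C; first by constructor 1.
  by constructor 2; split=> //; exact: ltW.
- by constructor 3; split=> //; rewrite -/A -/C in e; move: h; rewrite -/A -/C -e minxx.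
Qed.

(** This form is symmetric in the two functions, although the second
    modification is made along a function on the first one. *)
Lemma in_modificationE (l0 l1 : 'I_2 -> low_term R) (x y : 'rV[\bar R]_2) :
  in_modification l0 l1 x y <->
  twice_min_graph (aterm (l0 0%R) (x 0%R 0%R)) (aterm (l0 1%R) (x 0%R 1%R))
    (aterm (l1 0%R) (x 0%R 0%R)) (aterm (l1 1%R) (x 0%R 1%R)) (y 0%R 0%R) (y 0%R 1%R).
Proof.
rewrite /in_modification /twice_min_graph -!le_min -/(minform l0 x) -/(minform l1 x).
have lb (l : 'I_2 -> low_term R) t : y 0%R t = minform l x \/ tie l x /\ minform l x <= y 0%R t ->
    minform l x <= y 0%R t by case=> [->|[]].
split=> [[h0 h1]|/and3P[/twice_min_tie h0 /twice_min_tie h1 /orP h]].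
  apply/and3P; split; first exact/twice_min_tie.
    by apply/twice_min_tie; case: h1 => [->|[? ? ?]]; [left|right].
  by case: h1 => [->|[_ -> _]]; rewrite lexx ?orbT.
split=> //; case: h1 => [->|[t1 le1]]; first by left.
case: h => h; first by left; apply/eqP; rewrite eq_le h le1.
by right; split=> //; apply/eqP; rewrite eq_le h lb.
Qed.

End TwiceMin.

Section LinearCase.
Variable R : realType.
Local Open Scope ereal_scope.

Ltac refute :=
  repeat first [case/andP => [? ?] | case/orP]; try lra; try (case/orP => ?; lra).

(** The constant delta of linear forms with both diagonal coefficients equal
    to a and off-diagonal coefficients o0, o1. *)
Definition equal_diag_det (a : R) (o0 o1 : option R) : R :=
  (if (o0, o1) is (Some a2, Some b1) then Num.min (a + a) (a2 + b1) else a + a)%R.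

(** The tropical adjugate of a matrix with equal diagonal entries is the
    matrix itself, so the exchange of x and y leads to a system of the same
    form. Each hypothesis says which two of the three arguments are minimal,
    and in each combination the conclusion is a set of linear inequalities. *)
Lemma twice_min_linear_real (a a2 b1 x0 x1 y0 y1 : R) :
  let delta := Num.min (a + a)%R (a2 + b1)%R in
  twice_min_graph (a + x0)%:E (a2 + x1)%:E (b1 + x0)%:E (a + x1)%:E y0%:E y1%:E ->
  twice_min_graph (a + (y0 - delta))%:E (a2 + (y1 - delta))%:E
     (b1 + (y0 - delta))%:E (a + (y1 - delta))%:E x0%:E x1%:E.
Proof.
move=> delta /and3P[/twice_minP h0 /twice_minP h1 /orP h2].
have : (delta = a + a /\ a + a <= a2 + b1 \/ delta = a2 + b1 /\ a2 + b1 <= a + a)%R.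
  by rewrite /delta /Num.min; case: ltP => h; [left|right]; split=> //; exact: ltW.
move: delta => d; rewrite /twice_min_graph /twice_min !lee_fin.
case: h2; rewrite !lee_fin => /andP[H3 H4];
case: h0 => -[[E0]]; rewrite lee_fin => H0; case: h1 => -[[E1]]; rewrite lee_fin => H1;
move=> [][E2 H2]; apply/and3P; split; apply: contraT;
  rewrite ?negb_and ?negb_or -?ltNge; subst d; try subst y0; try subst y1; rewrite -?andbA;
  refute.
Qed.

Lemma twice_min_linear_forward (a : R) (o0 o1 : option R) (delta : R) x0 x1 y0 y1 :
  let A2 (o : option R) (x : \bar R) := if o is Some c then c%:E + x else +oo in
  delta = equal_diag_det a o0 o1 ->
  x0 != -oo -> x1 != -oo -> y0 != -oo -> y1 != -oo ->
  twice_min_graph (a%:E + x0) (A2 o0 x1) (A2 o1 x0) (a%:E + x1) y0 y1 ->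
  twice_min_graph (a%:E + (y0 - delta%:E)) (A2 o0 (y1 - delta%:E))
     (A2 o1 (y0 - delta%:E)) (a%:E + (y1 - delta%:E)) x0 x1.
Proof.
move=> A2; rewrite /equal_diag_det.
have minE (b b' : R) : (Num.min b b' = b /\ b <= b' \/ Num.min b b' = b' /\ b' <= b)%R.
  by rewrite /Num.min; case: ltP => h; [left|right]; split=> //; exact: ltW.
case: o0 => [a2|]; case: o1 => [b1|] ->; rewrite /A2;
  case: x0 => [x0||] //; case: x1 => [x1||] //; case: y0 => [y0||] //; case: y1 => [y1||] // _ _ _ _.
1: exact: twice_min_linear_real.
all: rewrite /twice_min_graph /twice_min;
  rewrite -?EFinN -?EFinD ?addye ?addey // ?leey ?leye_eq /= ?lee_fin ?andbT ?andbF ?orbT ?orbF //.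
1-4: have [[-> h]|[-> h]] := minE (a + a)%R (a2 + b1)%R.
all: let H := fresh in move=> H; repeat (apply/andP; split); apply: contraT;
  rewrite ?negb_and ?negb_or -?ltNge -?andbA; move: H; rewrite -?andbA; refute.
Qed.

End LinearCase.

(** * The normal forms give a dynamical system *)

Section SwapInvariance.
Variable R : realType.
Local Open Scope ereal_scope.
Implicit Types (l : 'I_2 -> 'I_2 -> low_term R) (x y : 'rV[\bar R]_2) (b : 'rV[R]_2).

(** F is (x, y) |-> (y, x + b), with inverse (x, y) |-> (y - b, x). *)
Definition translate b x : 'rV[\bar R]_2 := \row_i (x 0%R i - (b 0%R i)%:E).

Lemma translate_Tpt b x : Tpt 2 x -> Tpt 2 (translate b x).
Proof. by move=> Tx i; rewrite mxE; have := Tx i; case: (x 0%R i). Qed.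

(** Translating x by b then translates the i-th function by b_i. *)
Definition homogeneous l b := forall i j n a, l i j = Some (n, a) -> (n%:R * b 0 j = b 0 i)%R.

Lemma aterm_translate l b i j (t : \bar R) : homogeneous l b -> t != -oo ->
  aterm (l i j) (t - (b 0%R j)%:E) = aterm (l i j) t - (b 0%R i)%:E.
Proof.
move=> hom; case E: (l i j) => [[n a]|] // tN; have h := hom _ _ _ _ E.
case: t tN => [t||] //= _; first by congr EFin; rewrite -h; ring.
case: n h {E} => [|n] h; first by rewrite !mul0e adde0 -h mul0r oppr0 adde0.
by rewrite gt0_muley ?lte_fin ?ltr0n.
Qed.

Lemma twice_min_graph_shift (A0 C0 A1 C1 y0 y1 : \bar R) (b0 b1 : R) :
  twice_min_graph (A0 - b0%:E) (C0 - b0%:E) (A1 - b1%:E) (C1 - b1%:E) (y0 - b0%:E) (y1 - b1%:E)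
  = twice_min_graph A0 C0 A1 C1 y0 y1.
Proof. by rewrite /twice_min_graph !twice_min_shift -!EFinN !leeD2rE. Qed.

Lemma in_modification_translate l b x y : homogeneous l b -> Tpt 2 x -> Tpt 2 y ->
  in_modification (l 0%R) (l 1%R) (translate b x) (translate b y) <->
  in_modification (l 0%R) (l 1%R) x y.
Proof.
move=> hom Tx Ty; rewrite !in_modificationE !mxE !(aterm_translate _ _ hom) //.
by rewrite twice_min_graph_shift.
Qed.

Definition swap_invariant l b := forall x y, Tpt 2 x -> Tpt 2 y ->
  (in_modification (l 0%R) (l 1%R) (translate b y) x <-> in_modification (l 0%R) (l 1%R) x y).

(** Since F o F is a translation preserving the modification, one inclusion
    is enough. *)
Lemma swap_invariant_forward l b : homogeneous l b ->
  (forall x y, Tpt 2 x -> Tpt 2 y -> in_modification (l 0%R) (l 1%R) x y ->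
     in_modification (l 0%R) (l 1%R) (translate b y) x) -> swap_invariant l b.
Proof.
move=> hom fwd x y Tx Ty; split; last exact: fwd.
move/fwd => /(_ (translate_Tpt b Ty) Tx).
by move/(in_modification_translate hom Tx Ty).
Qed.

End SwapInvariance.

Section Sufficiency.
Variables (R : realType) (K : closedFieldType) (nu : K -> \bar R).
Hypothesis hnu : is_valuation nu.
Implicit Types (l : 'I_2 -> 'I_2 -> low_term R) (x y : 'rV[\bar R]_2) (b : 'rV[R]_2).

Lemma aterm_shift_far (o : low_term R) r (t : \bar R) : t != -oo%E ->
  aterm (shift_low o r) t = (aterm o t + r%:E)%E.
Proof. by case: o => [[n a]|] //= tN; rewrite EFinD addeAC. Qed.

Lemma minform_shift (k k' : 'I_2 -> low_term R) r x : Tpt 2 x ->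
  (forall j, k j = shift_low (k' j) r) -> (minform k' x + r%:E)%E = minform k x.
Proof.
move=> Tx h; rewrite /minform !h !aterm_shift_far //.
by rewrite /Order.min; case: ifP => h1; rewrite lteD2rE // h1.
Qed.

(** The cases where [div_space] applies. *)
Definition compatible l := [\/ forall x, ~ tie (l 0) x, forall x, ~ tie (l 1) x |
  forall j, is_linear (l 0 j) /\ is_linear (l 1 j)].

(** The modifications coincide because the functions g_i + b_i and f_i do;
    then only the invariance of their support under F is left. *)
Lemma produces_of_lows f l delta b : tropical_germ f -> germ_lows f l delta ->
  compatible l -> (forall i j, l i j = shift_low (inv_low l delta i j) (b 0 i)) ->
  swap_invariant l b -> produces_dynamical_system nu f.
Proof.
move=> gf hl comp shift inv; have [wf /near_tinfP[M0 h0] lin _] := hl.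
exists (minmap (inv_low l delta)); first exact: canonical_inverse_minmap.
exists 1%g, 1%g, 0, b => /=.
pose h i := if i == 0 :> 'I_2 then minform (l 0) else minform (l 1).
have hE i : h i = minform (l i) by elim/I2P: i.
set X := modification2 _; set Y := modification2 _.
have XE z : far M0 z -> (support X z <-> support (modification2 h) z) /\
    (forall w, weight X z w <-> weight (modification2 h) z w).
  apply: modification2_local => x fx i; rewrite hE /renormalized h0 // perm1 !mxE.
  by rewrite adde0.
have YE z : far M0 z -> (support Y z <-> support (modification2 h) z) /\
    (forall w, weight Y z w <-> weight (modification2 h) z w).
  apply: modification2_local => x fx i; rewrite hE /renormalized perm1 !mxE.
  by apply: minform_shift => // j; exact: far_neqNy fx.
have tm i : tame (l i) by split; [exact: wf|exact: lin].
have supp x y : far M0 (xypoint x y) ->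
    (support X (xypoint x y) <-> in_modification (l 0) (l 1) x y).
  move=> /[dup] /XE[-> _] /far_xypoint[fx _].
  by apply: support_modification2 => // i; exact: far_neqNy fx.
split.
  apply/near_tinfP; exists M0 => z fz.
  have [a1 a2] := XE z fz; have [b1 b2] := YE z fz.
  by split=> [|w]; [rewrite a1 b1|rewrite a2 b2].
apply/near_tinfP; exists (`|M0| + `|b 0 0| + `|b 0 1|) => z fz.
have m0 := ler_norm M0; have n0 := ler_norm (b 0 0); have n1 := ler_norm (b 0 1).
have p0 := normr_ge0 M0; have p1 := normr_ge0 (b 0 0); have p2 := normr_ge0 (b 0 1).
have fM : far M0 z by apply: far_le fz; lra.
rewrite -(xypointE z) in fz fM *; move: (xpart z) (ypart z) fz fM => x y fz fM.
have [fx fy] := (far_xypoint _ _ _).1 fM.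
have [_ fyb] := (far_xypoint _ _ _).1 fz.
have Tx : Tpt 2 x by move=> i; exact: far_neqNy fx.
have Ty : Tpt 2 y by move=> i; exact: far_neqNy fy.
have swapE w : swap_map 1 1 0 b w = xypoint (ypart w) (\row_i (xpart w 0%R i + (b 0%R i)%:E)%E).
  rewrite /swap_map; congr xypoint; apply/rowP => i; rewrite [LHS]mxE ?invg1 perm1.
    by rewrite [X in (_ - X%:E)%E]mxE sube0.
  by rewrite [RHS]mxE.
have fw : far M0 (xypoint (translate b y) x).
  apply/far_xypoint; split=> // i; rewrite mxE lteBrDr // -EFinD.
  apply: le_lt_trans (fyb i); rewrite lee_fin.
  by elim/I2P: i; lra.
split=> [[w Xw]|Xz].
  rewrite swapE => e.
  have e1 := congr1 (@xpart R) e; have e2 := congr1 (@ypart R) e.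
  rewrite !xpart_xypoint in e1; rewrite !ypart_xypoint in e2.
  have xw : xpart w = translate b y.
    by apply/rowP => i; rewrite [RHS]mxE -e2 [X in (X - _)%E]mxE addeK.
  apply/supp => //; apply/(inv _ _ Tx Ty); apply/supp => //.
  by rewrite -xw -e1 xypointE.
exists (xypoint (translate b y) x).
  by apply/supp => //; apply/(inv _ _ Tx Ty); apply/supp.
rewrite swapE xpart_xypoint ypart_xypoint; congr xypoint; apply/rowP => i.
by rewrite !mxE subeK.
Qed.

Definition low_of (a : \bar R) (p : option nat) : low_term R :=
  if a is r%:E then (if p is Some n then Some (n, r) else None) else None.

Lemma affine_term_low_of a p (y : \bar R) : a != -oo%E -> y != -oo%E ->
  affine_term a p y = aterm (low_of a p) y.
Proof.
case: a => [a||] //= _ yN; case: p => [n|] //=.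
by rewrite addye // natmul_neqNy.
Qed.

(** The terms of a germ near infinity are unique. *)
Lemma normal_form_lows f l delta (a1 a2 b1 b2 : \bar R) p q : germ_lows f l delta ->
  [/\ a1 != -oo%E, a2 != -oo%E, b1 != -oo%E & b2 != -oo%E] ->
  p <> Some 0%N -> q <> Some 0%N ->
  (\forall x \near tinf, f x = normal_form a1 a2 b1 b2 p q x) ->
  [/\ l 0 0 = low_of a1 (Some 1%N), l 0 1 = low_of a2 p,
      l 1 0 = low_of b1 q & l 1 1 = low_of b2 (Some 1%N)].
Proof.
move=> [wf hf _ _] [N1 N2 N3 N4] p0 q0 nf.
pose l' (i j : 'I_2) := if i == 0 then (if j == 0 then low_of a1 (Some 1%N) else low_of a2 p)
  else if j == 0 then low_of b1 q else low_of b2 (Some 1%N).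
have wf' i j : no_const (l' i j).
  have w (a : \bar R) (r : option nat) : r <> Some 0%N -> no_const (low_of a r).
    by case: a => [a||] //; case: r => [[|n]|].
  by rewrite /l'; case: ifP => _; case: ifP => _; apply: w.
have E i : \forall x \near tinf, (minform (l i) x + 0%:E = minform (l' i) x + 0%:E)%E.
  apply: filterS3 hf nf (near_Tpt R 2) => x e1 e2 xN.
  have := congr1 (fun u : 'rV__ => u 0 i) e1; rewrite e2 !mxE => <-.
  rewrite /minform /l'; elim/I2P: i => /=.
    by rewrite !affine_term_low_of // -(affine_term_low_of (Some 1%N)) //= mul1e.
  by rewrite !affine_term_low_of // -(affine_term_low_of (Some 1%N)) //= mul1e.
have S i j := minform_inj (wf i) (wf' i) (E i) j.
have id0 (o : low_term R) : shift_low o 0 = o by case: o => [[n a]|] //=; rewrite addr0.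
by split; rewrite -[LHS]id0 S id0.
Qed.

Definition pair_row (u v : R) : 'rV[R]_2 := \row_i (if i == 0 then u else v).

Lemma not_tie_None (k : 'I_2 -> low_term R) j x : k j = None -> ~ tie k x.
Proof. by elim/I2P: j => e; case; rewrite e. Qed.

Lemma ereal_cases (P : \bar R -> Prop) : (forall r : R, P r%:E) -> P +oo%E ->
  forall t, t != -oo%E -> P t.
Proof. by move=> h1 h2 [t||]. Qed.

Lemma produces_diagonal f l delta a d : tropical_germ f -> germ_lows f l delta ->
  l 0 0 = Some (1%N, a) -> l 0 1 = None -> l 1 0 = None -> l 1 1 = Some (1%N, d) ->
  produces_dynamical_system nu f.
Proof.
move=> gf hl l00 l01 l10 l11.
have dE : delta = a + d.
  by have [_ _ _] := hl; rewrite /det_val l00 l01 l10 l11 /= ?addye ?addey // miney => -[].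
apply: (@produces_of_lows f l delta (pair_row (a + a) (d + d)) gf hl).
- by constructor 1 => x; apply: (@not_tie_None _ 1).
- move=> i j; rewrite /inv_low /oth; elim/I2P: i; elim/I2P: j; rewrite /= ?l00 ?l01 ?l10 ?l11 //= mxE /= dE;
    congr (Some (_, _)); ring.
apply: swap_invariant_forward => [i j n c|x y Tx Ty].
  by elim/I2P: i; elim/I2P: j; rewrite ?l00 ?l01 ?l10 ?l11 // => -[<- _]; rewrite mul1r.
rewrite !in_modificationE l00 l01 l10 l11 /= !mxE /= !mul1e.
rewrite /twice_min_graph ![twice_min +oo%E _ _]twice_minCA ![twice_min _ _ +oo%E]twice_minAC !twice_min_yr.
move=> /and3P[/eqP -> /eqP e1 _]; rewrite -e1; apply/and3P; split.
- apply/eqP; move: (x 0 0) (Tx 0); apply: ereal_cases => //= r; congr EFin; ring.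
- apply/eqP; move: (x 0 1) (Tx 1); apply: ereal_cases => //= r; congr EFin; ring.
- apply/orP; left; rewrite leey /=; move: (x 0 1) (Tx 1); apply: ereal_cases => //= r; rewrite lee_fin; lra.
Qed.

Lemma produces_antidiagonal f l delta a d : tropical_germ f -> germ_lows f l delta ->
  l 0 0 = None -> l 0 1 = Some (1%N, a) -> l 1 0 = Some (1%N, d) -> l 1 1 = None ->
  produces_dynamical_system nu f.
Proof.
move=> gf hl l00 l01 l10 l11.
have dE : delta = a + d.
  by have [_ _ _] := hl; rewrite /det_val l00 l01 l10 l11 /= ?addye ?addey // minye => -[].
apply: (@produces_of_lows f l delta (pair_row (a + d) (a + d)) gf hl).
- by constructor 1 => x; apply: (@not_tie_None _ 0).
- move=> i j; rewrite /inv_low /oth; elim/I2P: i; elim/I2P: j; rewrite /= ?l00 ?l01 ?l10 ?l11 //= mxE /= dE;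
    congr (Some (_, _)); ring.
apply: swap_invariant_forward => [i j n c|x y Tx Ty].
  by elim/I2P: i; elim/I2P: j; rewrite ?l00 ?l01 ?l10 ?l11 // => -[<- _]; rewrite mul1r !mxE.
rewrite !in_modificationE l00 l01 l10 l11 /= !mxE /= !mul1e.
rewrite /twice_min_graph ![twice_min +oo%E _ _]twice_minCA ![twice_min _ _ +oo%E]twice_minAC !twice_min_yr.
move=> /and3P[/eqP e0 /eqP -> _]; rewrite -e0; apply/and3P; split.
- apply/eqP; move: (x 0 0) (Tx 0); apply: ereal_cases => //= r; congr EFin; ring.
- apply/eqP; move: (x 0 1) (Tx 1); apply: ereal_cases => //= r; congr EFin; ring.
- apply/orP; left; rewrite leey andbT; move: (x 0 1) (Tx 1); apply: ereal_cases => //= r; rewrite lee_fin; lra.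
Qed.

Lemma twice_min_graph_sym (A0 C0 A1 C1 y0 y1 : \bar R) :
  twice_min_graph A0 C0 A1 C1 y0 y1 = twice_min_graph C1 A1 C0 A0 y1 y0.
Proof.
have t A C (y : \bar R) : twice_min A C y = twice_min C A y.
  by rewrite twice_minCA twice_minAC twice_minCA.
rewrite /twice_min_graph (t C1) (t C0) andbCA orbC [(y0 <= C0)%E && _]andbC.
by rewrite [(y1 <= C1)%E && _]andbC.
Qed.

(** The first condition forces y_0 = a + x_0, and d = q a makes the second
    one the same after the exchange, up to a translation. *)
Lemma twice_min_triangular_forward (a c d : R) (q : nat) (x0 x1 y0 y1 : \bar R) :
  (0 < q)%N -> d = q%:R * a -> x0 != -oo%E -> x1 != -oo%E -> y1 != -oo%E ->
  twice_min_graph (a%:E + x0)%E +oo (c%:E + q%:R%:E * x0)%E (d%:E + x1)%E y0 y1 ->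
  twice_min_graph (a%:E + (y0 - (a + a)%:E))%E +oo
    (c%:E + q%:R%:E * (y0 - (a + a)%:E))%E (d%:E + (y1 - (d + d)%:E))%E x0 x1.
Proof.
move=> q0 dq T0 T1 Ty; rewrite /twice_min_graph !twice_min_yr => /and3P[/eqP -> h _].
have -> : (a%:E + x0 - (a + a)%:E = x0 - a%:E)%E.
  by move: x0 T0 {h}; apply: ereal_cases => //= r; congr EFin; ring.
apply/and3P; split.
- apply/eqP; move: x0 T0 {h}; apply: ereal_cases => //= r; congr EFin; ring.
- rewrite -(twice_min_shift _ _ _ d) in h; rewrite twice_minAC; move: h; congr is_true; congr twice_min.
  + move: x0 T0; apply: ereal_cases => //= [r|]; first by congr EFin; rewrite dq; ring.
    by rewrite gt0_muley ?lte_fin ?ltr0n.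
  + move: x1 T1; apply: ereal_cases => //= r; congr EFin; ring.
  + move: y1 Ty; apply: ereal_cases => //= r; congr EFin; ring.
- apply/orP; right; rewrite leey andbT; move: x0 T0 {h}; apply: ereal_cases => //= r; rewrite lee_fin; lra.
Qed.

Lemma produces_lower f l delta a q c d : tropical_germ f -> germ_lows f l delta ->
  (1 < q)%N -> d = q%:R * a ->
  l 0 0 = Some (1%N, a) -> l 0 1 = None -> l 1 0 = Some (q, c) -> l 1 1 = Some (1%N, d) ->
  produces_dynamical_system nu f.
Proof.
move=> gf hl q1 dq l00 l01 l10 l11.
have dE : delta = a + d.
  have [_ _ _] := hl; rewrite /det_val l00 l01 l10 l11.
  by case: q q1 {l10 dq} => [|[|q]] //= _; rewrite ?addye ?addey // miney => -[].
apply: (@produces_of_lows f l delta (pair_row (a + a) (d + d)) gf hl).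
- by constructor 1 => x; apply: (@not_tie_None _ 1).
- move=> i j; rewrite /inv_low /oth; elim/I2P: i; elim/I2P: j; rewrite /= ?l00 ?l01 ?l10 ?l11 //= mxE /= dE ?dq;
    congr (Some (_, _)); ring.
apply: swap_invariant_forward => [i j n e|x y Tx Ty].
  by elim/I2P: i; elim/I2P: j; rewrite ?l00 ?l01 ?l10 ?l11 // => -[<- _]; rewrite ?mul1r // !mxE /= dq; ring.
rewrite !in_modificationE l00 l01 l10 l11 /= !mxE /= !mul1e.
exact: (@twice_min_triangular_forward a c d q _ _ (y 0 0) _ (ltnW q1) dq (Tx 0) (Tx 1) (Ty 1)).
Qed.

Lemma produces_upper f l delta a p c d : tropical_germ f -> germ_lows f l delta ->
  (1 < p)%N -> a = p%:R * d ->
  l 0 0 = Some (1%N, a) -> l 0 1 = Some (p, c) -> l 1 0 = None -> l 1 1 = Some (1%N, d) ->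
  produces_dynamical_system nu f.
Proof.
move=> gf hl p1 ap l00 l01 l10 l11.
have dE : delta = a + d.
  have [_ _ _] := hl; rewrite /det_val l00 l01 l10 l11.
  by case: p p1 {l01 ap} => [|[|p]] //= _; rewrite ?addye ?addey // miney => -[].
apply: (@produces_of_lows f l delta (pair_row (a + a) (d + d)) gf hl).
- by constructor 2 => x; apply: (@not_tie_None _ 0).
- move=> i j; rewrite /inv_low /oth; elim/I2P: i; elim/I2P: j; rewrite /= ?l00 ?l01 ?l10 ?l11 //= mxE /= dE ?ap;
    congr (Some (_, _)); ring.
apply: swap_invariant_forward => [i j n e|x y Tx Ty].
  by elim/I2P: i; elim/I2P: j; rewrite ?l00 ?l01 ?l10 ?l11 // => -[<- _]; rewrite ?mul1r // !mxE /= ap; ring.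
rewrite !in_modificationE l00 l01 l10 l11 /= !mxE /= !mul1e.
rewrite twice_min_graph_sym => h; rewrite twice_min_graph_sym.
exact: (@twice_min_triangular_forward d c a p _ _ (y 0 1) _ (ltnW p1) ap (Tx 1) (Tx 0) (Ty 0) h).
Qed.

Lemma produces_linear f l delta a (o0 o1 : option R) : tropical_germ f -> germ_lows f l delta ->
  l 0 0 = Some (1%N, a) -> l 0 1 = omap (pair 1%N) o0 -> l 1 0 = omap (pair 1%N) o1 ->
  l 1 1 = Some (1%N, a) -> produces_dynamical_system nu f.
Proof.
move=> gf hl l00 l01 l10 l11.
have dE : delta = equal_diag_det a o0 o1.
  have [_ _ _] := hl; rewrite /det_val l00 l01 l10 l11 /equal_diag_det.
  by case: o0 {l01} => [a2|]; case: o1 {l10} => [b1|] /=; rewrite ?miney -?EFinD -?EFin_min => -[].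
apply: (@produces_of_lows f l delta (pair_row delta delta) gf hl).
- case: o0 l01 {dE} => [a2|] l01; last by constructor 1 => x; apply: (@not_tie_None _ 1).
  case: o1 l10 => [b1|] l10; last by constructor 2 => x; apply: (@not_tie_None _ 0).
  by constructor 3; apply: I2P; rewrite ?l00 ?l01 ?l10 ?l11.
- move=> i j; rewrite /inv_low /oth; elim/I2P: i; elim/I2P: j; rewrite /= ?l00 ?l01 ?l10 ?l11 //= ?mxE /=.
  + by congr (Some (_, _)); ring.
  + by case: (o0) => [r|] //=; congr (Some (_, _)); ring.
  + by case: (o1) => [r|] //=; congr (Some (_, _)); ring.
  + by congr (Some (_, _)); ring.
apply: swap_invariant_forward => [i j n c|x y Tx Ty].
  elim/I2P: i; elim/I2P: j; rewrite ?l00 ?l01 ?l10 ?l11 !mxE /=; try by move=> -[<- _]; rewrite mul1r.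
  + by case: (o0) => [r|] //= -[<- _]; rewrite mul1r.
  + by case: (o1) => [r|] //= -[<- _]; rewrite mul1r.
rewrite !in_modificationE l00 l01 l10 l11 /= !mxE /= !mul1e.
have AE (o : option R) (t : \bar R) : aterm (omap (pair 1%N) o) t =
    if o is Some c then (c%:E + t)%E else +oo%E by case: o => [c|] //=; rewrite mul1e.
rewrite !AE.
exact: (twice_min_linear_forward dE (Tx 0) (Tx 1) (Ty 0) (Ty 1)).
Qed.

(** When the common diagonal coefficient is infinite, invertibility forces
    the off-diagonal terms to be linear: the form is antidiagonal. *)
Lemma sufficiency f : tropical_germ f -> weakly_nondegenerate nu f ->
  (exists (a1 a2 b1 b2 : \bar R) (p2 q1 : option nat),
    [/\ [/\ a1 != -oo%E, a2 != -oo%E, b1 != -oo%E & b2 != -oo%E],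
        \forall x \near tinf, f x = normal_form a1 a2 b1 b2 p2 q1 x
      & normal_cases a1 a2 b1 b2 p2 q1]) ->
  produces_dynamical_system nu f.
Proof.
move=> gf wnd [a1 [a2 [b1 [b2 [p2 [q1 [N nf cases]]]]]]].
have [l [delta hl]] := germ_lows_exist hnu gf wnd.
have [N1 N2 N3 N4] := N; have [_ _ lin _] := hl.
have p0 : p2 <> Some 0%N.
  by case: cases => [[[->|->]]|[_ ->]|[_ _ [p [-> h]]]] // _; move=> -[e]; rewrite e in h.
have q0 : q1 <> Some 0%N.
  by case: cases => [[_ [->|->]]|[_ _ [p [-> h]]]|[_ ->]] // _; move=> -[e]; rewrite e in h.
have [l00 l01 l10 l11] := normal_form_lows hl N p0 q0 nf.
have low1 (c : \bar R) p : c != -oo%E -> p = Some 1%N \/ p = None ->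
    exists o, low_of c p = omap (pair 1%N) o.
  move=> cN [->|->]; last by exists None; case: c cN.
  by case: c cN => [r||] // _; [exists (Some r)|exists None].
case: cases => [[hp hq]|[[F1 F2 F3 F4] pN [q [qE q_gt1] e]]|[[F1 F2 F3 F4] qN [p [pE p_gt1] e]]].
- case=> [[a2y b1y]|e].
    rewrite a2y /= in l01; rewrite b1y /= in l10.
    have [j0 lin0] := lin 0; have [j1 lin1] := lin 1.
    elim/I2P: j0 lin0; rewrite ?l01 // l00; case: (a1) l00 N1 => [a||] //= l00 _ _.
    elim/I2P: j1 lin1; rewrite ?l10 // l11; case: (b2) l11 N4 => [d||] //= l11 _ _.
    exact: (produces_diagonal gf hl l00 l01 l10 l11).
  have [r0 r0E] := low1 _ _ N2 hp; have [r1 r1E] := low1 _ _ N3 hq.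
  rewrite r0E in l01; rewrite r1E in l10; rewrite -e in l11.
  case: (a1) l00 l11 N1 => [a||] //= l00 l11 _; first exact: (produces_linear gf hl l00 l01 l10 l11).
  have [j0 lin0] := lin 0; have [j1 lin1] := lin 1.
  elim/I2P: j0 lin0; rewrite ?l00 // l01; case: (r0) l01 => [a|] //= l01 _.
  elim/I2P: j1 lin1; rewrite ?l11 // l10; case: (r1) l10 => [d|] //= l10 _.
  exact: (produces_antidiagonal gf hl l00 l01 l10 l11).
- rewrite pN qE in l01 l10; move: e F1 F3 F4 l00 l01 l10 l11.
  case: (a1) => [a||] //; case: (b1) => [c||] //; case: (b2) => [d||] // -[dq] _ _ _ l00 l01 l10 l11.
  have l01' : l 0 1 = None by rewrite l01; case: (a2).
  exact: (produces_lower gf hl q_gt1 dq l00 l01' l10 l11).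
- rewrite qN pE in l01 l10; move: e F1 F2 F4 l00 l01 l10 l11.
  case: (a1) => [a||] //; case: (a2) => [c||] //; case: (b2) => [d||] // -[ap] _ _ _ l00 l01 l10 l11.
  have l10' : l 1 0 = None by rewrite l10; case: (b1).
  exact: (produces_upper gf hl p_gt1 ap l00 l01 l10' l11).
Qed.

End Sufficiency.

Theorem corollary3p37 (R : realType) (K : closedFieldType)
    (nu : K -> \bar R) (hnu : is_valuation nu)
    (f : 'rV[\bar R]_2 -> 'rV[\bar R]_2)
    (f_germ : tropical_germ f) (f_inf : f tinf = tinf)
    (f_wnd : weakly_nondegenerate nu f) (f_contr : contracting f) :
  produces_dynamical_system nu f <->
  exists (a1 a2 b1 b2 : \bar R) (p2 q1 : option nat),
    [/\ [/\ a1 != -oo%E, a2 != -oo%E, b1 != -oo%E & b2 != -oo%E],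
        \forall x \near tinf, f x = normal_form a1 a2 b1 b2 p2 q1 x
      & [\/ [/\ p2 = Some 1%N \/ p2 = None,
                q1 = Some 1%N \/ q1 = None
              & (a2 = +oo%E /\ b1 = +oo%E) \/ a1 = b2],
            [/\ [/\ a1 \is a fin_num, a2 \is a fin_num,
                    b1 \is a fin_num & b2 \is a fin_num],
                p2 = None
              & exists2 q : nat, q1 = Some q /\ (1 < q)%N
                               & b2 = (q%:R%:E * a1)%E]
          | [/\ [/\ a1 \is a fin_num, a2 \is a fin_num,
                    b1 \is a fin_num & b2 \is a fin_num],
                q1 = None
              & exists2 p : nat, p2 = Some p /\ (1 < p)%N
                               & a1 = (p%:R%:E * b2)%E]]].
Proof.
split; first exact: (necessity hnu f_germ f_wnd f_contr).
exact: (sufficiency hnu f_germ f_wnd).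
Qed.
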